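(* Let $\tau>0$, let $\widetilde A$ be a minimizer of $\|Y-XB\|_F^2+2\tau\|B\|_1$ over all $p\times n$ matrices $B$, let $M=X'X$, and set $$\tilde k=\max\{k:\ d_k(M\widetilde A)>2\tau\}.$$ Let $r=r(A)$ and assume that $d_r(MA)>4\tau$. Then $$\mathbb{P}\{\tilde k\ne r\}\le\mathbb{P}\{d_1(X'E)>\tau\}.$$ If moreover the entries of $E$ are independent $N(0,\sigma^2)$ random variables and $\tau=(1+\theta)\,\sigma\, d_1(X)(\sqrt n+\sqrt q)$ with $\theta>0$ and $q=r(X)$, then the probability $\mathbb{P}\{d_1(X'E)>\tau\}$ is bounded by $\exp(-\theta^2(n+q)/2)$.
   Context: Multivariate response regression model: $Y=XA+E$, where $Y$ is the $m\times n$ response matrix, $X$ is a fixed (nonrandom) $m\times p$ matrix, $A$ is an unknown fixed $p\times n$ matrix, and $E$ is a random $m\times n$ matrix with independent entries of mean zero and variance $\sigma^2$. A prime denotes transpose, $r(C)$ is the rank of $C$, $\|C\|_F$ the Frobenius norm, $d_1(C)\ge d_2(C)\ge\cdots$ the singular values of $C$ in decreasing order ($d_j(C)=0$ for $j$ larger than the rank of $C$), and $\|C\|_1=\sum_jd_j(C)$ the nuclear norm. By convention the maximum of the empty set is $0$. *)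

(* Defs.v *)
From HB Require Import structures.
From mathcomp Require Import all_boot all_order all_algebra.
From mathcomp Require Import all_classical all_reals all_analysis.
From mathcomp Require Import polyrcf.

Set Implicit Arguments.
Unset Strict Implicit.
Unset Printing Implicit Defensive.

Import Order.TTheory GRing.Theory Num.Theory.
Local Open Scope ring_scope.

(* The real eigenvalues of S in nonincreasing order, each repeated according to
   its multiplicity as a root of the characteristic polynomial. *)
Definition eigenvalues (R : rcfType) (n : nat) (S : 'M[R]_n) : seq R :=
  sort >=%O
    (flatten [seq nseq (mup x (char_poly S)) x | x <- rootsR (char_poly S)]).

(* Square roots of the n eigenvalues of C^T *m C. *)
Definition singular_values (R : rcfType) (m n : nat) (C : 'M[R]_(m, n)) :
    seq R :=
  [seq Num.sqrt x | x <- eigenvalues (C^T *m C)].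

(* Indexed from 1: sv 1 C is the largest singular value, and sv j C = 0 beyond
   the end of the list.  The index 0 is meaningless (sv 0 C = sv 1 C). *)
Definition sv (R : rcfType) (j m n : nat) (C : 'M[R]_(m, n)) : R :=
  nth 0 (singular_values C) j.-1.

Definition nuclear_norm (R : rcfType) (m n : nat) (C : 'M[R]_(m, n)) : R :=
  \sum_(s <- singular_values C) s.

Definition frobenius_norm (R : rcfType) (m n : nat) (C : 'M[R]_(m, n)) : R :=
  Num.sqrt (\sum_i \sum_j C i j ^+ 2).

(* max {k >= 1 | sv k C > t}, and 0 if there is no such k.  The range loses
   nothing when 0 <= t, since sv k C = 0 for k > n. *)
Definition nb_sv_above (R : rcfType) (m n : nat) (t : R) (C : 'M[R]_(m, n)) :
    nat :=
  (\max_(1 <= k < n.+1 | (t < sv k C)%R) k)%N.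

Definition penalized_loss (R : rcfType) (m n p : nat) (tau : R)
    (X : 'M[R]_(m, p)) (Y : 'M[R]_(m, n)) (B : 'M[R]_(p, n)) : R :=
  frobenius_norm (Y - X *m B) ^+ 2 + 2 * tau * nuclear_norm B.

Local Open Scope classical_set_scope.

Definition mutually_independent (d : measure_display) (T : measurableType d)
    (R : realType) (P : probability T R) (I : finType)
    (Z : I -> {RV P >-> R}) : Prop :=
  forall (J : {set I}) (B : I -> set R), (forall i, measurable (B i)) ->
    (P (\bigcap_(i in [set` J]) (Z i @^-1` B i)) =
     \prod_(i in J) P (Z i @^-1` B i))%E.

Definition random_mx (d : measure_display) (T : measurableType d)
    (R : realType) (P : probability T R) (m n : nat)
    (Z : 'I_m * 'I_n -> {RV P >-> R}) (w : T) : 'M[R]_(m, n) :=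
  \matrix_(i, j) Z (i, j) w.

(* Main.v *)
(* Rank recovery.  The subgradient inequality of the minimizer, tested on
   rank-one perturbations, shows that X'(Y - X Atilde) has operator norm at most
   tau, so on {d_1(X'E) <= tau} the matrices M Atilde and M A differ by at most
   2 tau in operator norm, and Weyl's inequality together with the gap
   d_r(MA) > 4 tau gives ktilde = r.

   Gaussian bound.  Writing X = Q Z with Q orthonormal reduces d_1(X'E) to the
   supremum of u'Q'E v over unit vectors u, v, hence to a countable dense set of
   pairs.  For finitely many pairs, Gordon's comparison with <g, u> + <h, v>,
   applied to a soft maximum of exponential type, bounds the Laplace transform
   of the maximum by exp(lam (sqrt n + sqrt q) + lam^2 / 2) up to a factor that
   tends to 1, and Chernoff's bound with lam = theta (sqrt n + sqrt q) concludes. *)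
Require Import Defs.
From HB Require Import structures.
From mathcomp Require Import all_boot all_order all_algebra.
From mathcomp Require Import all_classical all_reals all_analysis.
From mathcomp Require Import measurable_realfun polyrcf complex.
From mathcomp Require Import perm ring lra.

Set Implicit Arguments.
Unset Strict Implicit.
Unset Printing Implicit Defensive.

Import Order.TTheory GRing.Theory Num.Theory.
Local Open Scope ring_scope.

(** The Gaussian comparison avoids multivariate integrals. Averaging over one Gaussian direction [a]
    is an operator [gsmooth a], so the mean of F at a sum of independent Gaussian multiples of
    vectors is a composition of such operators, and [gsmooth a] is the limit of [n.+1] random-sign
    averages along [a / sqrt (n+1)]. A round of sign averages with step d adds to F the term d^2/2
    times a sum of second differentials, up to O(d^3); with d^2 = 1/(n+1) the accumulated error is
    O(d). Since all these operators commute, Taylor bounds are needed for F alone, never for the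
    intermediate averages; since every error is a multiple of F, monotone operators propagate it.
    The soft maximum is (sum_i e^(beta x_i))^p with lam = p beta held fixed. Covariances enter its
    second differential with coefficient -p(1-p), the sign that Slepian's inequality needs when p <=
    1, and it exceeds e^(lam max) by a factor at most (k+1)^p. Letting p tend to 0 gives a tail
    bound that does not depend on the number of pairs, hence holds for a countable family. *)

Definition ip (R : rcfType) (m n : nat) (A B : 'M[R]_(m, n)) : R :=
  \tr (A^T *m B).

(** * Trace inner product and Frobenius norm *)

Section InnerProduct.
Variables (R : rcfType).
Implicit Types m n p : nat.

Lemma ipE m n (A B : 'M[R]_(m, n)) : ip A B = \sum_i \sum_j A i j * B i j.
Proof.
rewrite /ip /mxtrace exchange_big /=; apply: eq_bigr => j _.
by rewrite mxE; apply: eq_bigr => i _; rewrite mxE.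
Qed.

Lemma ipC m n (A B : 'M[R]_(m, n)) : ip A B = ip B A.
Proof. by rewrite /ip -mxtrace_tr trmx_mul trmxK. Qed.

Lemma ipDr m n (A B C : 'M[R]_(m, n)) : ip A (B + C) = ip A B + ip A C.
Proof. by rewrite /ip mulmxDr mxtraceD. Qed.

Lemma ipZr m n a (A B : 'M[R]_(m, n)) : ip A (a *: B) = a * ip A B.
Proof. by rewrite /ip -scalemxAr mxtraceZ. Qed.

Lemma ipDl m n (A B C : 'M[R]_(m, n)) : ip (A + B) C = ip A C + ip B C.
Proof. by rewrite ipC ipDr !(ipC C). Qed.

Lemma ipZl m n a (A B : 'M[R]_(m, n)) : ip (a *: A) B = a * ip A B.
Proof. by rewrite ipC ipZr ipC. Qed.

Lemma ipNr m n (A B : 'M[R]_(m, n)) : ip A (- B) = - ip A B.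
Proof. by rewrite -scaleN1r ipZr mulN1r. Qed.

Lemma ipNl m n (A B : 'M[R]_(m, n)) : ip (- A) B = - ip A B.
Proof. by rewrite ipC ipNr ipC. Qed.

Lemma ip0r m n (A : 'M[R]_(m, n)) : ip A 0 = 0.
Proof. by rewrite /ip mulmx0 mxtrace0. Qed.

Lemma ip_mulml m n p (C : 'M[R]_(m, n)) (A : 'M[R]_(n, p)) B :
  ip (C *m A) B = ip A (C^T *m B).
Proof. by rewrite /ip trmx_mul mulmxA. Qed.

Lemma ip_mulmr m n p (C : 'M[R]_(n, p)) (A : 'M[R]_(m, n)) B :
  ip (A *m C) B = ip A (B *m C^T).
Proof. by rewrite /ip trmx_mul -mulmxA mxtrace_mulC mulmxA. Qed.

Lemma ip_ge0 m n (A : 'M[R]_(m, n)) : 0 <= ip A A.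
Proof.
by rewrite ipE; apply: sumr_ge0 => i _; apply: sumr_ge0 => j _; apply: sqr_ge0.
Qed.

Lemma ip_eq0 m n (A : 'M[R]_(m, n)) : (ip A A == 0) = (A == 0).
Proof.
apply/eqP/eqP => [|->]; last by rewrite ip0r.
rewrite ipE => /eqP; rewrite psumr_eq0; last first.
  by move=> i _; apply: sumr_ge0 => j _; apply: sqr_ge0.
move=> /allP h; apply/matrixP => i j; rewrite mxE.
move: (h i (mem_index_enum i)); rewrite implyTb psumr_eq0; last first.
  by move=> k _; apply: sqr_ge0.
by move=> /allP/(_ j (mem_index_enum j)); rewrite implyTb mulf_eq0 orbb => /eqP.
Qed.

Lemma sqr_frobenius_norm m n (A : 'M[R]_(m, n)) :
  frobenius_norm A ^+ 2 = ip A A.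
Proof.
rewrite /frobenius_norm sqr_sqrtr ?ipE //.
by apply: sumr_ge0 => i _; apply: sumr_ge0 => j _; apply: sqr_ge0.
Qed.

Lemma frobenius_norm_ge0 m n (A : 'M[R]_(m, n)) : 0 <= frobenius_norm A.
Proof. exact: sqrtr_ge0. Qed.

Lemma frobenius_norm_le m n (A : 'M[R]_(m, n)) t :
  0 <= t -> ip A A <= t ^+ 2 -> frobenius_norm A <= t.
Proof.
by move=> t0 h; rewrite -(ler_pXn2r (n := 2)) ?nnegrE ?frobenius_norm_ge0 //
  sqr_frobenius_norm.
Qed.

Lemma frobenius_norm_eq0 m n (A : 'M[R]_(m, n)) :
  (frobenius_norm A == 0) = (A == 0).
Proof. by rewrite -ip_eq0 -sqr_frobenius_norm expf_eq0. Qed.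

Lemma frobenius_norm_gt0 m n (A : 'M[R]_(m, n)) :
  (0 < frobenius_norm A) = (A != 0).
Proof. by rewrite lt0r frobenius_norm_ge0 andbT frobenius_norm_eq0. Qed.

Lemma frobenius_normZ m n a (A : 'M[R]_(m, n)) :
  frobenius_norm (a *: A) = `|a| * frobenius_norm A.
Proof.
apply/eqP; rewrite -(eqrXn2 (n := 2)) ?mulr_ge0 ?frobenius_norm_ge0 //.
by rewrite exprMn !sqr_frobenius_norm real_normK ?num_real // ipZl ipZr mulrA.
Qed.

Lemma frobenius_normN m n (A : 'M[R]_(m, n)) :
  frobenius_norm (- A) = frobenius_norm A.
Proof. by rewrite -scaleN1r frobenius_normZ normrN1 mul1r. Qed.

Lemma cauchy_schwarz_ip m n (A B : 'M[R]_(m, n)) :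
  ip A B <= frobenius_norm A * frobenius_norm B.
Proof.
have [->|A0] := eqVneq A 0.
  by rewrite ipC ip0r mulr_ge0 ?frobenius_norm_ge0.
have [->|B0] := eqVneq B 0.
  by rewrite ip0r mulr_ge0 ?frobenius_norm_ge0.
rewrite -!frobenius_norm_gt0 in A0 B0.
set a := frobenius_norm A in A0 *; set b := frobenius_norm B in B0 *.
have := ip_ge0 (b *: A - a *: B).
rewrite !(ipDl, ipDr, ipNl, ipNr, ipZl, ipZr) -!sqr_frobenius_norm (ipC B A).
rewrite -/a -/b => h; rewrite -(ler_pM2l (mulr_gt0 A0 B0)); nra.
Qed.

Lemma frobenius_normD m n (A B : 'M[R]_(m, n)) :
  frobenius_norm (A + B) <= frobenius_norm A + frobenius_norm B.
Proof.
apply: frobenius_norm_le; first by rewrite addr_ge0 ?frobenius_norm_ge0.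
have := cauchy_schwarz_ip A B; have := sqr_frobenius_norm A.
have := sqr_frobenius_norm B.
rewrite !(ipDl, ipDr) (ipC B A); nra.
Qed.

Lemma frobenius_norm_tr m n (A : 'M[R]_(m, n)) :
  frobenius_norm A^T = frobenius_norm A.
Proof.
apply/eqP; rewrite -(eqrXn2 (n := 2)) ?frobenius_norm_ge0 //.
by rewrite !sqr_frobenius_norm /ip trmxK mxtrace_mulC.
Qed.

Lemma ip_outer m n (A : 'M[R]_(m, n)) (u : 'cV[R]_m) (v : 'cV[R]_n) :
  ip A (u *m v^T) = ip u (A *m v).
Proof. by rewrite ipC ip_mulmr trmxK. Qed.

Lemma frobenius_norm_outer m n (u : 'cV[R]_m) (v : 'cV[R]_n) :
  frobenius_norm (u *m v^T) = frobenius_norm u * frobenius_norm v.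
Proof.
apply/eqP; rewrite -(eqrXn2 (n := 2)) ?mulr_ge0 ?frobenius_norm_ge0 //.
rewrite exprMn !sqr_frobenius_norm ip_mulmr trmxK -mulmxA.
rewrite [v^T *m v]mx11_scalar mul_mx_scalar ipZr mulrC.
by apply/eqP; congr (_ * _); rewrite /ip trace_mx11.
Qed.

Lemma frobenius_norm_mulmx m n (A : 'M[R]_(m, n)) (v : 'cV[R]_n) :
  frobenius_norm (A *m v) <= frobenius_norm A * frobenius_norm v.
Proof.
have [->|nz] := eqVneq (A *m v) 0.
  rewrite [X in X <= _](_ : _ = 0); last by apply/eqP; rewrite frobenius_norm_eq0.
  by rewrite mulr_ge0 ?frobenius_norm_ge0.
have p : 0 < frobenius_norm (A *m v) by rewrite frobenius_norm_gt0.
rewrite -(ler_pM2l p) -expr2 sqr_frobenius_norm -ip_outer.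
apply: le_trans (cauchy_schwarz_ip _ _) _.
by rewrite frobenius_norm_outer mulrCA.
Qed.

Lemma ip_orthogonal m n p (Q : 'M[R]_(m, n)) (A B : 'M[R]_(n, p)) :
  Q^T *m Q = 1%:M -> ip (Q *m A) (Q *m B) = ip A B.
Proof. by move=> h; rewrite ip_mulml mulmxA h mul1mx. Qed.

Lemma ip_subZ_sqr m n e (A B : 'M[R]_(m, n)) :
  ip (A - e *: B) (A - e *: B) = ip A A - e * ip A B *+ 2 + e ^+ 2 * ip B B.
Proof. by rewrite !(ipDl, ipDr, ipNl, ipNr, ipZl, ipZr) (ipC B A); ring. Qed.

End InnerProduct.

(** * Spectral theorem and singular values *)

Section Spectral.
Variables (R : rcfType).

(** A complex eigenvalue z exists over the algebraic closure. With a + ib a left eigenvector,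
    symmetry of S forces z to be real, and then a or b is a real eigenvector. *)
Lemma symmetric_eigenvector n (S : 'M[R]_n.+1) : S^T = S ->
  exists v a, [/\ ip v v = 1 & S *m v = a *: v :> 'cV[R]_n.+1].
Proof.
move=> symS.
suff [v [a [v0 va]]] : exists (v : 'rV[R]_n.+1) a, v != 0 /\ v *m S = a *: v.
  exists ((frobenius_norm v)^-1 *: v^T), a; split.
    rewrite ipZl ipZr -sqr_frobenius_norm frobenius_norm_tr mulrA -expr2 -exprMn.
    by rewrite mulVf ?expr1n // frobenius_norm_eq0.
  rewrite -scalemxAr -{1}symS -trmx_mul va linearZ /= !scalerA.
  by rewrite mulrC.
have [z /eigenvalueP [w wz w0]] :=
  eigenvalue_closed (map_mx (real_complex R) S) isT.
pose a := map_mx (@complex.Re R) w; pose b := map_mx (@complex.Im R) w.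
have ha : a *m S = complex.Re z *: a - complex.Im z *: b.
  apply/rowP => j; move/rowP/(_ j): wz; rewrite !mxE.
  move/(congr1 (@complex.Re R)); rewrite raddf_sum /=.
  case: (z) (w 0 j) => [x y] [u v] /= <-.
  by apply: eq_bigr => k _; rewrite !mxE; case: (w 0 k) => u' v' /=;
    rewrite mulr0 subr0.
have hb : b *m S = complex.Re z *: b + complex.Im z *: a.
  apply/rowP => j; move/rowP/(_ j): wz; rewrite !mxE.
  move/(congr1 (@complex.Im R)); rewrite raddf_sum /=.
  case: (z) (w 0 j) => [x y] [u v] /= <-.
  by apply: eq_bigr => k _; rewrite !mxE; case: (w 0 k) => u' v' /=;
    rewrite mulr0 add0r.
have ab0 : (a != 0) || (b != 0).
  rewrite -negb_and; apply: contra w0 => /andP[/eqP a0 /eqP b0].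
  apply/eqP/rowP => j; move/rowP/(_ j): a0; move/rowP/(_ j): b0; rewrite !mxE.
  by case: (w 0 j) => ? ? /= -> ->.
(* Expanding both sides of <aS, b> = <a, bS> leaves Im z (|a|^2 + |b|^2) = 0. *)
have im0 : complex.Im z = 0.
  have : ip (a *m S) b = ip a (b *m S) by rewrite ip_mulmr symS.
  rewrite ha hb !(ipDl, ipDr, ipNl, ipZl, ipZr).
  move=> /eqP; rewrite -subr_eq0 opprD addrACA subrr add0r -opprD oppr_eq0.
  rewrite -mulrDr mulf_eq0 => /orP[/eqP //|].
  rewrite paddr_eq0 ?ip_ge0 // !ip_eq0 => /andP[/eqP b0 /eqP a0].
  by move: ab0; rewrite a0 b0 eqxx.
case/orP: ab0 => h; [exists a|exists b]; exists (complex.Re z); split => //.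
  by rewrite ha im0 scale0r subr0.
by rewrite hb im0 scale0r addr0.
Qed.

(** The reflection along u = v - e exchanges e and v, because |v| = |e| gives <u, e> = -|u|^2 / 2.
    It is undefined for u = 0, where the identity serves. *)
Lemma householder n (v : 'cV[R]_n.+1) : ip v v = 1 ->
  exists2 H : 'M[R]_n.+1, H^T *m H = 1%:M & H *m delta_mx 0 0 = v.
Proof.
move=> v1; pose e : 'cV[R]_n.+1 := delta_mx 0 0.
have [->|ve] := eqVneq v e.
  by exists 1%:M; rewrite ?trmx1 mul1mx.
pose u := v - e; have u0 : ip u u != 0 by rewrite ip_eq0 subr_eq0.
have e1 : ip e e = 1.
  by rewrite /ip trmx_delta mul_delta_mx trace_mx11 mxE.
have ue : ip u e = - (ip u u / 2).
  rewrite /u !(ipDl, ipDr, ipNl, ipNr) v1 e1 (ipC e v); by field.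
pose H := 1%:M - (2 / ip u u) *: (u *m u^T).
have HT : H^T = H.
  by rewrite /H linearB /= linearZ /= trmx_mul trmxK trmx1.
have uu : u^T *m u = (ip u u)%:M by rewrite [LHS]mx11_scalar /ip trace_mx11.
exists H.
  have BB : u *m u^T *m (u *m u^T) = ip u u *: (u *m u^T).
    by rewrite mulmxA -(mulmxA u) uu mul_mx_scalar -scalemxAl.
  rewrite HT /H mulmxBl mul1mx mulmxBr mulmx1 -!scalemxAl -!scalemxAr BB.
  rewrite !scalerA (_ : 2 / _ * _ * _ = 2 / ip u u + 2 / ip u u); last by field.
  by rewrite scalerDl opprB addrK addrNK.
rewrite -/e /H mulmxBl mul1mx -scalemxAl -mulmxA.
have -> : u^T *m e = (ip u e)%:M by rewrite [LHS]mx11_scalar /ip trace_mx11.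
rewrite ue mul_mx_scalar scalerA (_ : _ * _ = -1); last by field.
by rewrite scaleN1r opprK /u addrC subrK.
Qed.

(** Deflation: an orthogonal H sends the first basis vector to an eigenvector, so the first column
    of H'SH is a multiple of that basis vector. By symmetry so is the first row, and induction
    applies to the remaining block. *)
Lemma symmetric_spectral n (S : 'M[R]_n) : S^T = S ->
  exists (Q : 'M[R]_n) d, Q^T *m Q = 1%:M /\ S *m Q = Q *m diag_mx d.
Proof.
elim: n S => [|n IH] S symS.
  by exists 1%:M, 0; split; apply/matrixP => -[].
have [v [a [v1 Sv]]] := symmetric_eigenvector symS.
have [H HH He] := householder v1.
have HH' : H *m H^T = 1%:M by apply: mulmx1C.
pose S' := H^T *m S *m H.
have symS' : S'^T = S' by rewrite /S' !trmx_mul trmxK symS mulmxA.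
have col0 : S' *m delta_mx 0 0 = a *: (delta_mx 0 0 : 'cV[R]_n.+1).
  by rewrite /S' -mulmxA He -mulmxA Sv -scalemxAr -He mulmxA HH mul1mx.
have SH : S *m H = H *m S' by rewrite /S' !mulmxA HH' mul1mx.
clearbody S'.
have S'E i : S' i 0 = a *+ (i == 0).
  by move/colP/(_ i): col0; rewrite -colE !mxE andbT mulr_natr.
pose S1 := drsubmx (S' : 'M[R]_(1 + n)).
have symS1 : S1^T = S1.
  by rewrite /S1 trmx_drsub; congr drsubmx; exact: symS'.
have [Q [d [QQ SQ]]] := IH S1 symS1.
have S'b : S' = block_mx a%:M 0 0 S1 :> 'M[R]_(1 + n).
  rewrite -[LHS](@submxK _ 1 n 1 n); congr block_mx; apply/matrixP => i j; rewrite !mxE.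
  - by rewrite !ord1 lshift0 S'E eqxx !mulr1n.
  - by rewrite ord1 lshift0 -symS' mxE S'E.
  - by rewrite ord1 lshift0 S'E.
pose B : 'M[R]_(1 + n) := block_mx 1%:M 0 0 Q.
have BB : B^T *m B = 1%:M.
  rewrite /B tr_block_mx mulmx_block !trmx0 trmx1 !mulmx0 !mul0mx !addr0 !add0r.
  by rewrite mulmx1 QQ -scalar_mx_block.
exists (H *m B), (row_mx a%:M d); split.
  by rewrite trmx_mul mulmxA -(mulmxA B^T) HH mulmx1.
have -> : S *m (H *m B) = H *m (S' *m B).
  by rewrite !mulmxA SH.
rewrite -mulmxA; congr (_ *m _).
apply: etrans (congr1 (fun Z : 'M[R]_(1 + n) => Z *m B) S'b) _.
pose D := @diag_mx_row R n 1 a%:M d.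
apply: etrans _ (congr1 (fun Z : 'M[R]_(1 + n) => B *m Z) (esym D)).
rewrite /B !mulmx_block !mulmx0 !mul0mx !addr0 !add0r.
rewrite mul1mx mulmx1 SQ; congr block_mx; apply/matrixP => i j.
by rewrite !ord1 !mxE eqxx.
Qed.

(** Links the definition by root multiplicities to diagonalization: conjugation leaves the
    characteristic polynomial equal to the product of the X - d_i, whose multiplicity at x counts
    the d_i equal to x. *)
Lemma perm_eigenvalues n (S Q : 'M[R]_n) d :
  Q^T *m Q = 1%:M -> S *m Q = Q *m diag_mx d ->
  perm_eq (eigenvalues S) [seq d 0 i | i <- enum 'I_n].
Proof.
move=> QQ SQ.
have QQ' : Q *m Q^T = 1%:M by apply: mulmx1C.
have cp : char_poly S = \prod_(x <- [seq d 0 i | i <- enum 'I_n]) ('X - x%:P).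
  rewrite big_map big_enum /=.
  transitivity (char_poly (diag_mx d)).
    have -> : S = Q *m diag_mx d *m Q^T by rewrite -SQ -mulmxA QQ' mulmx1.
    rewrite /char_poly /char_poly_mx !map_mxM.
    set q := map_mx polyC Q; set qt := map_mx polyC Q^T.
    have qq : q *m qt = 1%:M by rewrite -map_mxM QQ' map_mx1.
    rewrite [X in \det (X - _) = _](_ : _ = q *m 'X%:M *m qt); last first.
      by rewrite mul_mx_scalar -scalemxAl qq scalemx1.
    rewrite -mulmxBl -mulmxBr !det_mulmx mulrAC -det_mulmx qq det1 mul1r.
    by [].
  rewrite char_poly_trig ?diag_mx_is_trig //; apply: eq_bigr => i _.
  by rewrite mxE eqxx mulr1n.
set s := [seq _ | _ <- _] in cp *.
rewrite /eigenvalues perm_sort.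
apply/allP => x _ /=; apply/eqP.
have p0 : char_poly S != 0 by rewrite monic_neq0 ?char_poly_monic.
rewrite count_flatten -!map_comp.
rewrite (eq_map (g := fun y => (y == x) * count_mem x s)%N); last first.
  move=> y /=; rewrite count_nseq cp mu_prod_XsubC.
  by have [->|/negPf yx] := eqVneq y x; rewrite /= ?eqxx ?yx ?mul0n.
rewrite sumnE big_map.
have rx : (x \in rootsR (char_poly S)) = (0 < count_mem x s)%N.
  have := roots_on_rootsR p0 x; rewrite /= => <-.
  by rewrite cp root_prod_XsubC -has_pred1 has_count.
have [xs|xs] := boolP (x \in rootsR (char_poly S)); last first.
  rewrite rx lt0n negbK in xs; rewrite (eqP xs).
  by rewrite big1 // => y _; rewrite muln0.
rewrite (bigD1_seq x) //= ?uniq_roots // eqxx mul1n big1 ?addn0 //.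
by move=> y /negPf ->.
Qed.

Lemma sorted_eigenvalues n (S : 'M[R]_n) : sorted >=%O (eigenvalues S).
Proof. by apply: sort_sorted => x y; exact: ge_total. Qed.

Lemma size_eigenvalues n (S : 'M[R]_n) : S^T = S -> size (eigenvalues S) = n.
Proof.
move=> /symmetric_spectral [Q [d [QQ SQ]]].
by rewrite (perm_size (perm_eigenvalues QQ SQ)) size_map size_enum_ord.
Qed.

Lemma sorted_spectral n (S : 'M[R]_n) : S^T = S ->
  exists2 Q : 'M[R]_n, Q^T *m Q = 1%:M &
    S *m Q = Q *m diag_mx (\row_i nth 0 (eigenvalues S) i).
Proof.
move=> symS; have [Q [d [QQ SQ]]] := symmetric_spectral symS.
have /tuple_permP [s es] :
    perm_eq (eigenvalues S) [tuple d 0 i | i < n].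
  by rewrite (permPl (perm_eigenvalues QQ SQ)) /= perm_map // enumT.
exists (col_perm s Q).
  apply/matrixP => i j; move/matrixP/(_ (s i) (s j)): QQ; rewrite !mxE.
  by rewrite (inj_eq perm_inj) => <-; apply: eq_bigr => k _; rewrite !mxE.
apply/matrixP => i j; move/matrixP/(_ i (s j)): SQ.
rewrite !mul_mx_diag !mxE => sq.
transitivity (\sum_k S i k * Q k (s j)).
  by apply: eq_bigr => k _; rewrite !mxE.
rewrite sq es -tnth_nth !tnth_map.
by rewrite !tnth_ord_tuple.
Qed.

End Spectral.

(** * Singular values: min-max principle, Weyl's inequality, vanishing beyond the rank *)

Section SingularValues.
Variables (R : rcfType).

Lemma size_singular_values m n (C : 'M[R]_(m, n)) :
  size (singular_values C) = n.
Proof. by rewrite size_map size_eigenvalues // trmx_mul trmxK. Qed.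

Lemma sv_ge0 j m n (C : 'M[R]_(m, n)) : 0 <= sv j C.
Proof.
rewrite /sv; have [h|h] := ltnP j.-1 (size (singular_values C)).
  by rewrite (nth_map 0) ?sqrtr_ge0 // -(size_map (@Num.sqrt R)).
by rewrite nth_default.
Qed.

Lemma sv_oversize j m n (C : 'M[R]_(m, n)) : (n < j)%N -> sv j C = 0.
Proof.
by case: j => // j h; rewrite /sv nth_default // size_singular_values.
Qed.

Lemma svd m n (C : 'M[R]_(m, n)) :
  exists2 Q : 'M[R]_n, Q^T *m Q = 1%:M &
    C^T *m C *m Q = Q *m diag_mx (\row_(i < n) sv i.+1 C ^+ 2).
Proof.
have symC : (C^T *m C)^T = C^T *m C by rewrite trmx_mul trmxK.
have [Q QQ CQ] := sorted_spectral symC; exists Q => //.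
rewrite CQ; congr (_ *m diag_mx _); apply/rowP => i; rewrite !mxE.
have ltin : (i < size (eigenvalues (C^T *m C)))%N by rewrite size_eigenvalues.
rewrite /sv (nth_map 0) //= sqr_sqrtr //.
(* For a unit eigenvector the eigenvalue of C'C is |Cq|^2, hence nonnegative; this is what makes it
   the square of its [Num.sqrt]. *)
have : ip (C *m col i Q) (C *m col i Q) =
       nth 0 (eigenvalues (C^T *m C)) i * ip (col i Q) (col i Q).
  rewrite ip_mulml mulmxA -ipZr; congr (ip _ _).
  rewrite colE mulmxA CQ -!colE; apply/colP => k.
  by rewrite mxE mul_mx_diag !mxE mulrC.
have -> : ip (col i Q) (col i Q) = 1.
  rewrite colE ip_orthogonal // /ip trmx_delta mul_delta_mx trace_mx11 mxE.
  by rewrite eqxx.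
by rewrite mulr1 => <-; exact: ip_ge0.
Qed.

Lemma svd_quadratic m n (C : 'M[R]_(m, n)) (Q : 'M[R]_n) (d : 'rV_n)
    (x : 'cV[R]_n) :
  Q^T *m Q = 1%:M -> C^T *m C *m Q = Q *m diag_mx d ->
  ip (C *m x) (C *m x) = \sum_i d 0 i * (Q^T *m x) i 0 ^+ 2.
Proof.
move=> QQ CQ; have QQ' : Q *m Q^T = 1%:M by apply: mulmx1C.
rewrite -[x in LHS]mul1mx -QQ' -mulmxA; set y := Q^T *m x.
rewrite ip_mulml mulmxA (mulmxA _ Q) CQ -mulmxA ip_orthogonal // ipE.
apply: eq_bigr => i _; rewrite big_ord1 mul_diag_mx [X in _ * X]mxE.
by rewrite expr2 mulrCA.
Qed.

Lemma sum_sqr_orthogonal n (Q : 'M[R]_n) (x : 'cV[R]_n) : Q^T *m Q = 1%:M ->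
  ip x x = \sum_i (Q^T *m x) i 0 ^+ 2.
Proof.
move=> QQ; have QQ' : Q^T^T *m Q^T = 1%:M by rewrite trmxK; apply: mulmx1C.
rewrite -(ip_orthogonal x x QQ') ipE; apply: eq_bigr => i _.
by rewrite big_ord1 expr2.
Qed.

Lemma sv_nonincreasing i j m n (C : 'M[R]_(m, n)) :
  (0 < i)%N -> (i <= j)%N -> sv j C <= sv i C.
Proof.
case: i j => // i [//|j] _; rewrite ltnS => ij.
have [h|h] := ltnP j n; last by rewrite sv_oversize ?ltnS // sv_ge0.
have := sorted_eigenvalues (C^T *m C); rewrite /sv /singular_values.
have sz : size (eigenvalues (C^T *m C)) = n.
  by rewrite size_eigenvalues // trmx_mul trmxK.
move=> so; rewrite !(nth_map 0) ?sz ?(leq_ltn_trans ij) // ler_wsqrtr //.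
by apply: (sorted_leq_nth ge_trans ge_refl 0 so) => //;
  rewrite inE sz ?(leq_ltn_trans ij).
Qed.

Lemma common_kernel a b n (A : 'M[R]_(a, n)) (B : 'M[R]_(b, n)) :
  (\rank A + \rank B < n)%N ->
  exists x : 'cV[R]_n, [/\ x != 0, A *m x = 0 & B *m x = 0].
Proof.
move=> h; pose N := col_mx A B.
have rN : (\rank N < n)%N.
  apply: leq_ltn_trans h; rewrite -addsmxE.
  exact: (leq_of_leqif (mxrank_adds_leqif _ _)).
have : kermx N^T != 0.
  by rewrite -mxrank_eq0 mxrank_ker mxrank_tr -lt0n subn_gt0.
move=> /rowV0Pn [v /sub_kermxP vN v0]; exists v^T.
have Nv : N *m v^T = 0 by rewrite -(trmxK N) -trmx_mul vN trmx0.
rewrite mul_col_mx in Nv; split.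
- by rewrite -(inj_eq trmx_inj) trmxK trmx0.
- by have := congr1 usubmx Nv; rewrite col_mxKu linear0.
- by have := congr1 dsubmx Nv; rewrite col_mxKd linear0.
Qed.

Lemma mul_pid_cV r n (y : 'cV[R]_n) i :
  (pid_mx r *m y) i 0 = y i 0 *+ (i < r).
Proof.
rewrite mxE (bigD1 i) //= big1 => [|j ji].
  by rewrite mxE eqxx addr0 mulr_natl.
by rewrite mxE (negPf (contra_neq (@val_inj _ _ _ _ _) _)) ?mul0r // eq_sym.
Qed.

(* This lemma and the next are the two halves of the min-max principle, with
   subspaces encoded as kernels of matrices of prescribed rank. *)
Lemma sv_lower_space k m n (C : 'M[R]_(m, n)) : (k < n)%N ->
  exists2 L : 'M[R]_n, \rank L = (n - k.+1)%N &
    forall x : 'cV_n, L *m x = 0 ->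
      sv k.+1 C * frobenius_norm x <= frobenius_norm (C *m x).
Proof.
move=> kn; have [Q QQ CQ] := svd C.
have Qu : Q^T \in unitmx by apply: (mulmx1_unit QQ).1.
exists (copid_mx k.+1 *m Q^T).
  by rewrite mxrankMfree ?rank_copid_mx // row_free_unit.
move=> x; rewrite -mulmxA => Lx.
have y0 (i : 'I_n) : (k < i)%N -> (Q^T *m x) i 0 = 0.
  move=> ki; move/matrixP/(_ i 0): Lx; rewrite /copid_mx mulmxBl mul1mx.
  by rewrite mxE [X in _ + X]mxE mul_pid_cV ltnS leqNgt ki mulr0n subr0 [RHS]mxE.
rewrite -(ler_pXn2r (n := 2)) ?nnegrE ?mulr_ge0 ?sv_ge0 ?frobenius_norm_ge0 //.
rewrite exprMn !sqr_frobenius_norm (svd_quadratic x QQ CQ).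
rewrite (sum_sqr_orthogonal x QQ) mulr_sumr; apply: ler_sum => i _.
have [ki|ik] := ltnP k i; first by rewrite y0 // expr0n !mulr0.
rewrite ler_wpM2r ?sqr_ge0 // mxE ler_pXn2r ?nnegrE ?sv_ge0 //.
exact: sv_nonincreasing.
Qed.

Lemma sv_upper_space k m n (C : 'M[R]_(m, n)) : (k <= n)%N ->
  exists2 L : 'M[R]_n, \rank L = k &
    forall x : 'cV_n, L *m x = 0 ->
      frobenius_norm (C *m x) <= sv k.+1 C * frobenius_norm x.
Proof.
move=> kn; have [Q QQ CQ] := svd C.
have Qu : Q^T \in unitmx by apply: (mulmx1_unit QQ).1.
exists (pid_mx k *m Q^T).
  by rewrite mxrankMfree ?rank_pid_mx // row_free_unit.
move=> x; rewrite -mulmxA => Lx.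
have y0 (i : 'I_n) : (i < k)%N -> (Q^T *m x) i 0 = 0.
  by move=> ik; move/matrixP/(_ i 0): Lx; rewrite mul_pid_cV ik [RHS]mxE.
rewrite -(ler_pXn2r (n := 2)) ?nnegrE ?mulr_ge0 ?sv_ge0 ?frobenius_norm_ge0 //.
rewrite exprMn !sqr_frobenius_norm (svd_quadratic x QQ CQ).
rewrite (sum_sqr_orthogonal x QQ) mulr_sumr; apply: ler_sum => i _.
have [ik|ki] := ltnP i k; first by rewrite y0 // expr0n !mulr0.
rewrite ler_wpM2r ?sqr_ge0 // mxE ler_pXn2r ?nnegrE ?sv_ge0 //.
exact: sv_nonincreasing.
Qed.

Lemma frobenius_norm_mulmx_sv m n (C : 'M[R]_(m, n)) (x : 'cV_n) :
  frobenius_norm (C *m x) <= sv 1 C * frobenius_norm x.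
Proof.
have [L L0 h] := sv_upper_space C (leq0n n); apply: h.
by move/eqP: L0; rewrite mxrank_eq0 => /eqP ->; rewrite mul0mx.
Qed.

Lemma sv_le_op m n (C : 'M[R]_(m, n)) t : 0 <= t ->
  (forall x : 'cV_n, frobenius_norm (C *m x) <= t * frobenius_norm x) ->
  sv 1 C <= t.
Proof.
move=> t0 h; have [n0|n0] := posnP n; first by rewrite sv_oversize // n0.
have [L rL hL] := sv_lower_space C n0.
have [|x [x0 Lx _]] := @common_kernel n n n L 0.
  by rewrite mxrank0 addn0 rL; case: (n) n0 => // k _; rewrite subn1.
rewrite -frobenius_norm_gt0 in x0; rewrite -(ler_pM2r x0).
exact: le_trans (hL _ Lx) (h x).
Qed.

(** A nonzero x lies both where C stretches by at least its k-th singular value and where D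
    stretches by at most its own: the two subspaces are kernels of matrices whose ranks add up to n
    - 1. *)
Lemma sv_weyl k m n (C D : 'M[R]_(m, n)) t : 0 <= t ->
  (forall x : 'cV_n, frobenius_norm ((C - D) *m x) <= t * frobenius_norm x) ->
  sv k C <= sv k D + t.
Proof.
(* The index 0 reads the same list entry as the index 1. *)
move=> t0 h; wlog k0 : k / (0 < k)%N => [hw|].
  by case: k => [|k]; [exact: (hw 1%N)|exact: hw].
case: k k0 => // k _; have [kn|nk] := ltnP k n; last first.
  by rewrite !sv_oversize ?add0r.
have [L rL hL] := sv_lower_space C kn.
have [L' rL' hL'] := sv_upper_space D (ltnW kn).
have [|x [x0 Lx Lx']] := @common_kernel n n n L L'.
  by rewrite rL rL' -[leqRHS](subnK kn) -addnS.
rewrite -frobenius_norm_gt0 in x0; rewrite -(ler_pM2r x0) mulrDl.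
apply: le_trans (hL _ Lx) _.
rewrite -[C in C *m x](subrK D) mulmxDl addrC.
apply: le_trans (frobenius_normD _ _) _.
by apply: lerD (h x); exact: hL'.
Qed.

Lemma sv_rank k m n (C : 'M[R]_(m, n)) : (\rank C < k)%N -> sv k C = 0.
Proof.
case: k => // k; rewrite ltnS => rk.
have [kn|nk] := ltnP k n; last by rewrite sv_oversize.
have [L rL hL] := sv_lower_space C kn.
have [|x [x0 Lx Cx]] := @common_kernel n m n L C.
  by rewrite rL -[ltnRHS](subnK kn) ltn_add2l.
rewrite -frobenius_norm_gt0 in x0; apply/eqP; rewrite eq_le sv_ge0 andbT.
rewrite -(ler_pM2r x0) mul0r (le_trans (hL _ Lx)) // Cx.
by rewrite le_eqVlt frobenius_norm_eq0 eqxx.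
Qed.

End SingularValues.

(** * Nuclear norm and the penalized minimizer *)

Section NuclearNorm.
Variables (R : rcfType).

(** Unit ball of the operator norm, stated without singular values. The nuclear norm of C is the
    maximum of <K, C> over this ball; its triangle inequality and homogeneity come from this
    duality. *)
Definition contraction m n (K : 'M[R]_(m, n)) :=
  forall x : 'cV_n, frobenius_norm (K *m x) <= frobenius_norm x.

Lemma nuclear_normE m n (C : 'M[R]_(m, n)) :
  nuclear_norm C = \sum_(i < n) sv i.+1 C.
Proof.
rewrite /nuclear_norm (big_nth 0) size_singular_values big_mkord.
by apply: eq_bigr.
Qed.

Lemma ip_col_orthogonal m n (Q : 'M[R]_n) (A B : 'M[R]_(m, n)) :
  Q^T *m Q = 1%:M -> ip A B = \sum_i ip (A *m col i Q) (B *m col i Q).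
Proof.
move=> QQ; have QQ' : Q *m Q^T = 1%:M by apply: mulmx1C.
have -> : ip A B = ip (A *m Q) (B *m Q).
  by rewrite ip_mulmr -mulmxA QQ' mulmx1.
rewrite {1}/ip /mxtrace; apply: eq_bigr => i _.
have h (U V : 'M[R]_(m, n)) : (U^T *m V) i i = ip (col i U) (col i V).
  by rewrite /ip trace_mx11 !mxE; apply: eq_bigr => k _; rewrite !mxE.
by rewrite h !colE !mulmxA.
Qed.

(** In the basis of right singular vectors q_i the trace is the sum of the <K q_i, C q_i>, each at
    most |C q_i| = d_i. *)
Lemma ip_le_nuclear_norm m n (K C : 'M[R]_(m, n)) :
  contraction K -> ip K C <= nuclear_norm C.
Proof.
move=> hK; have [Q QQ CQ] := svd C.
rewrite (ip_col_orthogonal _ _ QQ) nuclear_normE; apply: ler_sum => i _.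
have q1 : frobenius_norm (col i Q) = 1.
  apply/eqP; rewrite -(eqrXn2 (n := 2)) ?frobenius_norm_ge0 // expr1n.
  rewrite sqr_frobenius_norm colE ip_orthogonal // /ip trmx_delta mul_delta_mx.
  by rewrite trace_mx11 mxE eqxx.
apply: le_trans (cauchy_schwarz_ip _ _) _.
have -> : frobenius_norm (C *m col i Q) = sv i.+1 C.
  apply/eqP; rewrite -(eqrXn2 (n := 2)) ?frobenius_norm_ge0 ?sv_ge0 //.
  rewrite sqr_frobenius_norm ip_mulml mulmxA colE mulmxA CQ -mulmxA.
  rewrite ip_orthogonal // ipE (bigD1 i) //= big_ord1 big1 => [|j ji].
    rewrite addr0 mul_diag_mx !mxE !eqxx mulr1 mul1r //.
  by rewrite big_ord1 !mxE (negPf ji) mul0r.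
by rewrite ler_piMl ?sv_ge0 // (le_trans (hK _)) ?q1.
Qed.

(** The maximizer is the partial isometry of the polar decomposition: C times the pseudo-inverse of
    the square root of C'C. The convention that 0 has inverse 0 handles vanishing singular
    values. *)
Lemma nuclear_norm_attained m n (C : 'M[R]_(m, n)) :
  exists2 K, contraction K & ip K C = nuclear_norm C.
Proof.
have [Q QQ CQ] := svd C.
have QQ' : Q *m Q^T = 1%:M by apply: mulmx1C.
pose s i := sv i.+1 C; pose D := diag_mx (\row_(i < n) (s i)^-1).
have KK : (C *m Q *m D)^T *m (C *m Q *m D) =
    diag_mx (\row_(i < n) (s i != 0)%:R).
  rewrite trmx_mul tr_diag_mx trmx_mul -!mulmxA (mulmxA C^T) mulmxA.
  rewrite (mulmxA (C^T *m C)) CQ -!mulmxA (mulmxA Q^T) QQ mul1mx !mulmxA.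
  rewrite !mulmx_diag; congr diag_mx; apply/rowP => i; rewrite !mxE.
  rewrite -/(s i); have [->|si] := eqVneq (s i) 0; first by rewrite invr0 !mulr0.
  by rewrite expr2 mulrA mulVf // mul1r divff.
exists (C *m Q *m D *m Q^T).
  move=> x; rewrite -[C *m Q *m D *m Q^T *m x]mulmxA.
  rewrite -(ler_pXn2r (n := 2)) ?nnegrE ?frobenius_norm_ge0 //.
  rewrite !sqr_frobenius_norm ip_mulml mulmxA KK (sum_sqr_orthogonal x QQ) ipE.
  apply: ler_sum => i _; rewrite big_ord1 mul_diag_mx [X in _ * X]mxE.
  rewrite mulrCA -expr2 mxE ler_piMl ?sqr_ge0 //.
  by case: (_ != _); rewrite ?ler01.
rewrite ip_mulmr trmxK nuclear_normE ip_mulmr -[C *m Q *m _]mulmxA /ip.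
rewrite trmx_mul tr_diag_mx -!mulmxA (mulmxA C^T) (mulmxA (C^T *m C)) CQ.
rewrite !mulmxA QQ mul1mx mulmx_diag mxtrace_diag; apply: eq_bigr => i _; rewrite !mxE.
rewrite -/(s i); have [->|si] := eqVneq (s i) 0; first by rewrite invr0 mulr0.
by rewrite expr2 mulfK.
Qed.

Lemma nuclear_normD m n (A B : 'M[R]_(m, n)) :
  nuclear_norm (A + B) <= nuclear_norm A + nuclear_norm B.
Proof.
have [K hK <-] := nuclear_norm_attained (A + B).
by rewrite ipDr lerD ?ip_le_nuclear_norm.
Qed.

Lemma nuclear_normZ_le m n t (A : 'M[R]_(m, n)) : 0 <= t ->
  nuclear_norm (t *: A) <= t * nuclear_norm A.
Proof.
move=> t0; have [K hK <-] := nuclear_norm_attained (t *: A).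
by rewrite ipZr ler_wpM2l ?ip_le_nuclear_norm.
Qed.

Lemma nuclear_norm_outer m n (u : 'cV[R]_m) (v : 'cV_n) :
  nuclear_norm (u *m v^T) <= frobenius_norm u * frobenius_norm v.
Proof.
have [K hK <-] := nuclear_norm_attained (u *m v^T).
rewrite ip_outer (le_trans (cauchy_schwarz_ip _ _)) //.
by rewrite ler_wpM2l ?frobenius_norm_ge0.
Qed.

End NuclearNorm.

(** * Optimality conditions for the penalized loss and deterministic rank recovery *)

Section Minimizer.
Variables (R : realType).

Lemma le_of_le_eps (a b c : R) : 0 <= c ->
  (forall e, 0 < e -> e <= 1 -> a <= b + e * c) -> a <= b.
Proof.
move=> c0 h; rewrite leNgt; apply/negP => ba.
have d0 : 0 < a - b by rewrite subr_gt0.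
have cd : 0 < c + (a - b) by rewrite ltr_wpDl.
(* This value of e is at most 1 and satisfies e c < a - b. *)
have := h ((a - b) / (c + (a - b))) (divr_gt0 d0 cd).
rewrite ler_pdivrMr // mul1r lerDr => /(_ c0).
rewrite -lerBlDl mulrAC ler_pdivlMr // mulrDr gerDl.
by rewrite leNgt mulr_gt0.
Qed.

Section Subgradient.
Variables (m n p : nat) (tau : R) (X : 'M[R]_(m, p)) (Y : 'M[R]_(m, n)).
Variable B1 : 'M[R]_(p, n).
Hypotheses (tau0 : 0 <= tau)
  (B1_min : forall B, penalized_loss tau X Y B1 <= penalized_loss tau X Y B).

(** Compares the minimizer with the point at fraction e of the segment towards B. The nuclear norm
    is convex along it; after division by 2e the quadratic term of the loss leaves e |X(B - B1)|^2 /
    2, which vanishes with e. *)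
Lemma minimizer_subgradient B :
  ip (X^T *m (Y - X *m B1)) (B - B1) <=
  tau * (nuclear_norm B - nuclear_norm B1).
Proof.
apply: (@le_of_le_eps _ _ (ip (X *m (B - B1)) (X *m (B - B1)) / 2)).
  by rewrite divr_ge0 ?ip_ge0.
move=> e e0 e1; have := B1_min (B1 + e *: (B - B1)).
rewrite /penalized_loss !sqr_frobenius_norm.
have -> : Y - X *m (B1 + e *: (B - B1)) = (Y - X *m B1) - e *: (X *m (B - B1)).
  by rewrite mulmxDr -scalemxAr opprD addrA.
set r := Y - _; set D := B - B1.
have nn : nuclear_norm (B1 + e *: D) <=
    nuclear_norm B1 + e * (nuclear_norm B - nuclear_norm B1).
  have -> : B1 + e *: D = (1 - e) *: B1 + e *: B.
    by rewrite scalerBr scalerBl scale1r addrCA [RHS]addrC addrA.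
  apply: le_trans (nuclear_normD _ _) _.
  have e1' : 0 <= 1 - e by rewrite subr_ge0.
  apply: le_trans (lerD (nuclear_normZ_le B1 e1') (nuclear_normZ_le B (ltW e0))) _.
  by rewrite mulrBl mul1r mulrBr addrAC addrA.
rewrite ip_subZ_sqr [ip (X^T *m r) D]ip_mulml trmxK.
move: nn; move: (ip r (X *m D)) (ip (X *m D) _) (ip r r) => a c q.
move: (nuclear_norm _) (nuclear_norm B) (nuclear_norm B1) => N N' N1 nn h.
have {}nn := ler_wpM2l tau0 nn.
rewrite -(ler_pM2l e0); clear - nn h; nra.
Qed.

Lemma minimizer_residual_op (v : 'cV_n) :
  frobenius_norm (X^T *m (Y - X *m B1) *m v) <= tau * frobenius_norm v.
Proof.
set G := X^T *m _; have [->|nz] := eqVneq (G *m v) 0.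
  rewrite (_ : frobenius_norm 0 = 0) ?mulr_ge0 ?frobenius_norm_ge0 //.
  by apply/eqP; rewrite frobenius_norm_eq0.
rewrite -frobenius_norm_gt0 in nz; rewrite -(ler_pM2l nz) -expr2.
rewrite sqr_frobenius_norm -ip_outer.
(* The rank-one direction (Gv)v' pairs with G to |Gv|^2, and its nuclear norm is at most |Gv|
   |v|. *)
have := minimizer_subgradient (B1 + G *m v *m v^T).
rewrite (addrC B1) addrK => /le_trans; apply.
rewrite mulrCA ler_wpM2l // lerBlDr.
apply: le_trans (nuclear_normD _ _) _.
by rewrite lerD2r nuclear_norm_outer.
Qed.

End Subgradient.

(** Adding the two subgradient inequalities, each tested at the other minimizer, cancels the nuclear
    norms and leaves |D|^2 <= <Y1 - Y2, D>. So the fitted matrix depends on the data alone, even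
    when the minimizer is not unique. *)
Lemma minimizer_nonexpansive m n p tau (X : 'M[R]_(m, p)) (Y1 Y2 : 'M[R]_(m, n))
    B1 B2 : 0 <= tau ->
  (forall B, penalized_loss tau X Y1 B1 <= penalized_loss tau X Y1 B) ->
  (forall B, penalized_loss tau X Y2 B2 <= penalized_loss tau X Y2 B) ->
  frobenius_norm (X *m B1 - X *m B2) <= frobenius_norm (Y1 - Y2).
Proof.
move=> tau0 min1 min2.
have := minimizer_subgradient tau0 min1 B2.
have := minimizer_subgradient tau0 min2 B1.
set D := X *m B1 - X *m B2.
rewrite !ip_mulml !trmxK !mulmxBr -(opprB (X *m B1) (X *m B2)) -/D ipNr => h2 h1.
have h : ip D D <= ip (Y1 - Y2) D.
  rewrite -subr_ge0 -[in X in _ - X]/D.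
  have -> : ip (Y1 - Y2) D - ip D D =
     ip (Y1 - X *m B1) D - ip (Y2 - X *m B2) D.
    rewrite -!ipNl -!ipDl; congr ip; rewrite /D !opprB !addrA.
    by rewrite [LHS]addrAC [RHS]addrAC (addrAC Y1).
  move: h1 h2; move: (ip (Y1 - _) D) (ip (Y2 - _) D) => a b.
  move: (nuclear_norm B1) (nuclear_norm B2) => c d h1 h2; clear - h1 h2; lra.
have [->|nz] := eqVneq D 0.
  rewrite (_ : frobenius_norm 0 = 0) ?frobenius_norm_ge0 //.
  by apply/eqP; rewrite frobenius_norm_eq0.
rewrite -frobenius_norm_gt0 in nz; rewrite -(ler_pM2r nz) -expr2.
by rewrite sqr_frobenius_norm (le_trans h) ?cauchy_schwarz_ip.
Qed.

(** Singular values are nonincreasing, so two neighbouring ones determine the count. The first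
    condition is guarded because [sv 0] is not a zeroth singular value but the largest one. *)
Lemma nb_sv_aboveP m n t (C : 'M[R]_(m, n)) r : 0 <= t -> (r <= n)%N ->
  reflect (((0 < r)%N -> t < sv r C) /\ sv r.+1 C <= t)
    (nb_sv_above t C == r).
Proof.
move=> t0 rn; rewrite /nb_sv_above; apply: (iffP eqP) => [<-|[h1 h2]].
  split.
    set N := \max_(1 <= k < n.+1 | _) k => N0.
    have [[|k] hk Nk] : exists2 k, ((0 < k)%N -> t < sv k C) & N = k.
      rewrite /N big_seq_cond; elim/big_ind: _ => [|x y [a ha ->] [b hb ->]|i].
      - by exists 0%N.
      - by rewrite /maxn; case: ltnP => _; [exists b|exists a].
      - by case/andP => _ hi; exists i.
    - by rewrite Nk in N0.
    - by rewrite Nk; exact: hk.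
  set N := \max_(1 <= k < n.+1 | _) k; rewrite leNgt; apply/negP => h.
  have : (N.+1 <= N)%N; last by rewrite ltnn.
  rewrite {2}/N; apply: (leq_bigmax_seq N.+1) => //.
  (* If N were at least n, the next singular value would be 0, which cannot exceed the nonnegative
     t. *)
  rewrite mem_index_iota /= ltnS ltnNge; apply/negP => nN.
  by move: h; rewrite sv_oversize ?ltnS // ltNge t0.
apply/eqP; rewrite eqn_leq; apply/andP; split.
  apply/bigmax_leqP_seq => k; rewrite mem_index_iota => /andP[k0 _] hk.
  rewrite leqNgt; apply/negP => rk.
  have := le_lt_trans (le_trans (sv_nonincreasing C _ rk) h2) hk.
  by rewrite ltxx => /(_ isT).
case: (posnP r) => [->//|r0]; apply: (leq_bigmax_seq r) => //.
  by rewrite mem_index_iota r0 ltnS.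
exact: h1.
Qed.

Lemma rank_recovery m n p tau (X : 'M[R]_(m, p)) (A B : 'M[R]_(p, n))
    (E : 'M[R]_(m, n)) :
  0 <= tau ->
  (forall B', penalized_loss tau X (X *m A + E) B <=
              penalized_loss tau X (X *m A + E) B') ->
  ((0 < \rank A)%N -> 4 * tau < sv (\rank A) (X^T *m X *m A)) ->
  sv 1 (X^T *m E) <= tau ->
  nb_sv_above (2 * tau) (X^T *m X *m B) = \rank A.
Proof.
move=> tau0 Bmin gap hE.
have op (x : 'cV_n) : frobenius_norm ((X^T *m X *m A - X^T *m X *m B) *m x) <=
    2 * tau * frobenius_norm x.
  have -> : X^T *m X *m A - X^T *m X *m B =
      X^T *m (X *m A + E - X *m B) - X^T *m E.
    by rewrite mulmxBr mulmxDr !mulmxA addrAC addrK.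
  rewrite mulmxBl (le_trans (frobenius_normD _ _)) // frobenius_normN.
  rewrite mulr_natl mulr2n mulrDl lerD ?(minimizer_residual_op tau0 Bmin) //.
  rewrite (le_trans (frobenius_norm_mulmx_sv _ _)) //.
  by rewrite ler_wpM2r ?frobenius_norm_ge0.
have t2 : 0 <= 2 * tau by rewrite mulr_ge0.
have op' (x : 'cV_n) : frobenius_norm ((X^T *m X *m B - X^T *m X *m A) *m x) <=
    2 * tau * frobenius_norm x.
  by rewrite -opprB mulNmx frobenius_normN.
apply/eqP; apply/(nb_sv_aboveP _ t2 (rank_leq_col A)).
split=> [/gap h|].
  have := sv_weyl (\rank A) t2 op.
  by move: (sv _ _) (sv _ _) h => a b h1 h2; clear - h1 h2; lra.
rewrite (le_trans (sv_weyl _ t2 op')) // sv_rank ?add0r //.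
by rewrite ltnS mxrankM_maxr.
Qed.

End Minimizer.

(** * Orthonormal factorization of X and reduction of d_1(X'E) to a bilinear form *)

Section OrthonormalBasis.
Variables (R : rcfType).

(** A basis C of the column space is orthonormalized to CUD, with U diagonalizing the Gram matrix
    C'C and D its inverse square roots. Having only r(X) columns in Q is what later puts sqrt q in
    place of sqrt m. *)
Lemma orthonormal_range m p (X : 'M[R]_(m, p)) :
  exists2 Q : 'M[R]_(m, \rank X), Q^T *m Q = 1%:M & exists Z, X = Q *m Z.
Proof.
have [C [W [Cfull XC]]] : exists (C : 'M[R]_(m, \rank X)) W, row_full C /\
    X = C *m W.
  by exists (col_base X), (row_base X); rewrite mulmx_base col_base_full.
pose S := C^T *m C.
have [U [d [UU SU]]] : exists (U : 'M[R]_(\rank X)) d,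
    U^T *m U = 1%:M /\ S *m U = U *m diag_mx d.
  by apply: symmetric_spectral; rewrite trmx_mul trmxK.
have UU' : U *m U^T = 1%:M by apply: mulmx1C.
have dE i : d 0 i = ip (C *m col i U) (C *m col i U).
  have -> : d 0 i = ip (col i U) (d 0 i *: col i U).
    rewrite ipZr colE ip_orthogonal // /ip trmx_delta mul_delta_mx trace_mx11.
    by rewrite mxE eqxx mulr1.
  rewrite ip_mulml mulmxA -/S; congr (ip _ _).
  by rewrite [in RHS]colE mulmxA SU -colE; apply/colP => k;
    rewrite mxE [RHS]mxE mul_mx_diag !mxE mulrC.
(* A zero eigenvalue of the Gram matrix would give a unit vector killed by C, which has a left
   inverse. *)
have d0 i : 0 < d 0 i.
  rewrite lt0r dE ip_ge0 andbT ip_eq0; apply/negP => /eqP CU.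
  have [D DC] : exists D, D *m C = 1%:M.
    by apply/row_fullP.
  have : col i U = 0 by rewrite -[LHS]mul1mx -DC -mulmxA CU mulmx0.
  move/(congr1 (mulmx U^T)); rewrite colE mulmxA UU mul1mx mulmx0.
  by move/matrixP/(_ i 0)/eqP; rewrite !mxE !eqxx oner_eq0.
pose D := diag_mx (\row_i (Num.sqrt (d 0 i))^-1).
exists (C *m U *m D).
  rewrite trmx_mul tr_diag_mx trmx_mul -!mulmxA (mulmxA C^T) (mulmxA (C^T *m C)).
  rewrite [C^T *m C *m U]SU.
  rewrite -!mulmxA (mulmxA U^T) UU mul1mx !mulmx_diag -diag_const_mx.
  congr diag_mx; apply/rowP => i; rewrite !mxE -{2}[d 0 i]sqr_sqrtr ?ltW //.
  by rewrite expr2 -!mulrA divff ?mulr1 ?mulVf // gt_eqF // sqrtr_gt0.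
exists (diag_mx (\row_i Num.sqrt (d 0 i)) *m U^T *m W).
rewrite [LHS]XC -[in LHS](mulmx1 C) -UU' !mulmxA.
rewrite -(mulmxA (C *m U) D) /D mulmx_diag (_ : diag_mx _ = 1%:M) ?mulmx1 //.
rewrite -diag_const_mx; congr diag_mx; apply/rowP => i; rewrite !mxE.
by rewrite mulVf // gt_eqF // sqrtr_gt0.
Qed.

(** With c = X'Eb one has |c|^2 = <Xc, Eb> = <Zc, Q'Eb> <= s |Zc| |b|, and |Zc| = |Xc| <= d_1(X) |c|
    since Q is an isometry. *)
Lemma sv_trmul_le m n p q (X : 'M[R]_(m, p)) (E : 'M[R]_(m, n))
    (Q : 'M[R]_(m, q)) Z s : Q^T *m Q = 1%:M -> X = Q *m Z -> 0 <= s ->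
  (forall (a : 'cV_q) (b : 'cV_n), ip a (Q^T *m E *m b) <=
     s * (frobenius_norm a * frobenius_norm b)) ->
  sv 1 (X^T *m E) <= sv 1 X * s.
Proof.
move=> QQ XQ s0 h; apply: sv_le_op => [|b]; first by rewrite mulr_ge0 ?sv_ge0.
have normZ (y : 'cV_p) : frobenius_norm (Z *m y) = frobenius_norm (X *m y).
  apply/eqP; rewrite -(eqrXn2 (n := 2)) ?frobenius_norm_ge0 //.
  by rewrite !sqr_frobenius_norm XQ -mulmxA (ip_orthogonal _ _ QQ).
set c := X^T *m E *m b; have [->|nz] := eqVneq c 0.
  rewrite (_ : frobenius_norm 0 = 0) ?mulr_ge0 ?sv_ge0 ?frobenius_norm_ge0 //.
  by apply/eqP; rewrite frobenius_norm_eq0.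
rewrite -frobenius_norm_gt0 in nz; rewrite -(ler_pM2l nz) -expr2.
rewrite sqr_frobenius_norm {2}/c -mulmxA -ip_mulml [X in ip (X *m c)]XQ -mulmxA.
rewrite ip_mulml mulmxA (le_trans (h _ _)) //.
rewrite normZ.
have := frobenius_norm_mulmx_sv X c; have := frobenius_norm_ge0 b.
move: (frobenius_norm _) (frobenius_norm _) (frobenius_norm _) (sv _ _).
move=> x y z u z0 yx; rewrite [leRHS](_ : _ = s * (u * x * z)); last by ring.
by rewrite ler_wpM2l // ler_wpM2r.
Qed.

End OrthonormalBasis.

Import numFieldNormedType.Exports.
Local Open Scope classical_set_scope.

(** * The rank event *)

Lemma rat_approximation (R : realType) (x e : R) : 0 < e ->
  exists q : rat, `|x - ratr q| < e.
Proof.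
move=> e0; have [|q] := @rat_in_itvoo R (x - e) (x + e).
  by rewrite ltrD2l gtrN.
by rewrite in_itv /= => h; exists q; rewrite distrC ltr_distl.
Qed.

Section LipschitzMeasurable.
Variables (R : realType) (d : measure_display) (T : measurableType d).

Lemma measurable_ltr_set (g : T -> R) c :
  measurable_fun setT g -> measurable [set w | g w < c].
Proof.
move=> mg; have mc : measurable (`]-oo, c[ : set R) by exact: measurable_itv.
have := mg measurableT _ mc; rewrite setTI.
by congr measurable; apply/seteqP; split => w /=; rewrite in_itv.
Qed.

Lemma measurable_gtr_set (g : T -> R) c :
  measurable_fun setT g -> measurable [set w | c < g w].
Proof.
move=> mg; have mc : measurable (`]c, +oo[ : set R) by exact: measurable_itv.
have := mg measurableT _ mc; rewrite setTI.
by congr measurable; apply/seteqP; split => w /=; rewrite in_itv /= andbT.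
Qed.

(** The Lipschitz bound makes {f > t} the union of those boxes in the values of Z, with rational
    centre and width 1/(k+1), that it contains. There are countably many. *)
Lemma measurable_of_lipschitz (I : finType) (Z : I -> T -> R) (f : T -> R) L :
  (forall i, measurable_fun setT (Z i)) -> 0 <= L ->
  (forall w w', f w <= f w' + L * \sum_i `|Z i w - Z i w'|) ->
  measurable_fun setT f.
Proof.
move=> mZ L0 fL; apply: (measurability _ (RGenOInfty.measurableE R)) => //.
move=> _ [_ [t ->] <-]; rewrite setTI.
pose box (c : {ffun I -> rat} * nat) :=
  \bigcap_(i in [set: I]) [set w | `|Z i w - ratr (c.1 i)| < c.2.+1%:R^-1].
have mbox c : measurable (box c).
  apply: fin_bigcap_measurable => // i _.
  apply: measurable_ltr_set; apply: measurableT_comp => //.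
  exact: measurable_funB.
rewrite (_ : _ @^-1` _ =
   \bigcup_c (if pselect (box c `<=` [set w | t < f w]) then box c else set0)).
  apply: countable_bigcupT_measurable => [|c]; first exact: countableP.
  by case: (pselect _) => ? /=; [exact: mbox|exact: measurable0].
apply/seteqP; split => w /=; last first.
  by move=> [c _]; case: (pselect _) => //= h /h /=; rewrite in_itv /= andbT.
rewrite in_itv /= andbT => tw.
(* Two points of one box differ by less than 2/(k+1) in each coordinate, so with this k the whole
   box around w stays in {f > t}. *)
have [k Lk] : exists k : nat, L * #|I|%:R * 2 / k.+1%:R < f w - t.
  pose k := Num.truncn (L * #|I|%:R * 2 / (f w - t)); exists k.
  rewrite ltr_pdivrMr ?ltr0n // [ltRHS]mulrC -ltr_pdivrMr ?subr_gt0 //.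
  exact: truncnS_gt.
have k0 : 0 < k.+1%:R^-1 :> R by rewrite invr_gt0.
have hc i : exists c : rat, `|Z i w - ratr c| < k.+1%:R^-1.
  exact: rat_approximation.
pose c := ([ffun i => sval (cid (hc i))], k).
have cw : box c w by move=> i _ /=; rewrite ffunE; case: (cid _).
exists c => //; case: (pselect _) => //= -[] w' cw' /=.
have h : L * \sum_i `|Z i w - Z i w'| < f w - t.
  apply: le_lt_trans Lk; rewrite -!mulrA ler_wpM2l //.
  rewrite mulr_natl -sumr_const ler_sum // => i _.
  rewrite -(subrKA (ratr (c.1 i))) (le_trans (ler_normD _ _)) //.
  rewrite mulr_natl mulr2n lerD // ltW //; first exact: cw.
  by rewrite distrC; exact: cw'.
rewrite -(ltrD2r (L * \sum_i `|Z i w - Z i w'|)).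
by rewrite (lt_le_trans _ (fL w w')) // -ltrBrDl.
Qed.

End LipschitzMeasurable.

Section RankEvent.
Variables (R : realType).

Lemma frobenius_norm_le_sum m n (A : 'M[R]_(m, n)) :
  frobenius_norm A <= \sum_(ij : 'I_m * 'I_n) `|A ij.1 ij.2|.
Proof.
rewrite -(pair_bigA _ (fun i j => `|A i j|)) /=.
have fD (I : finType) (F : I -> 'M[R]_(m, n)) :
    frobenius_norm (\sum_i F i) <= \sum_i frobenius_norm (F i).
  elim/big_ind2: _ => // [|a b c d ab cd].
    by rewrite le_eqVlt frobenius_norm_eq0 eqxx.
  by apply: le_trans (frobenius_normD _ _) _; exact: lerD.
rewrite [A in frobenius_norm A]matrix_sum_delta (le_trans (fD _ _)) //.
apply: ler_sum => i _; rewrite (le_trans (fD _ _)) //; apply: ler_sum => j _.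
rewrite frobenius_normZ ler_piMr // frobenius_norm_le // expr1n.
by rewrite /ip trmx_delta mul_delta_mx /mxtrace (bigD1 j) //= big1 ?addr0 => [|k kj];
  rewrite mxE ?eqxx // (negPf kj).
Qed.

Lemma sv_mulmx_lipschitz k m n p (C : 'M[R]_(p, m)) (G H : 'M[R]_(m, n)) t :
  frobenius_norm (G - H) <= t ->
  sv k (C *m G) <= sv k (C *m H) + frobenius_norm C * t.
Proof.
move=> GH; have t0 := le_trans (frobenius_norm_ge0 _) GH.
apply: sv_weyl => [|x]; first by rewrite mulr_ge0 ?frobenius_norm_ge0.
rewrite -mulmxBr -!mulmxA (le_trans (frobenius_norm_mulmx _ _)) //.
rewrite -mulrA ler_wpM2l ?frobenius_norm_ge0 //.
rewrite (le_trans (frobenius_norm_mulmx _ _)) //.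
by rewrite ler_wpM2r ?frobenius_norm_ge0.
Qed.

Variables (d : measure_display) (T : measurableType d) (P : probability T R).
Variables (m n p : nat) (E : 'I_m * 'I_n -> {RV P >-> R}).

Lemma random_mx_lipschitz w w' :
  frobenius_norm (random_mx E w - random_mx E w') <=
  \sum_ij `|E ij w - E ij w'|.
Proof.
rewrite (le_trans (frobenius_norm_le_sum _)) //; apply: ler_sum => -[i j] _.
by rewrite !mxE.
Qed.

Lemma measurable_sv_random_mx (C : 'M[R]_(p, m)) k :
  measurable_fun setT (fun w => sv k (C *m random_mx E w)).
Proof.
apply: (measurable_of_lipschitz (Z := E) (L := frobenius_norm C)).
- by move=> i; exact: measurable_funPT.
- exact: frobenius_norm_ge0.
- by move=> w w'; apply: sv_mulmx_lipschitz; exact: random_mx_lipschitz.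
Qed.

Variables (X : 'M[R]_(m, p)) (A : 'M[R]_(p, n)) (tau : R).
Variable Atilde : T -> 'M[R]_(p, n).
Hypotheses (tau0 : 0 <= tau)
  (Atilde_min : forall w B,
      penalized_loss tau X (X *m A + random_mx E w) (Atilde w) <=
      penalized_loss tau X (X *m A + random_mx E w) B)
  (A_gap : (0 < \rank A)%N -> 4 * tau < sv (\rank A) (X^T *m X *m A)).

(* No measurable selection is involved: X *m Atilde w is unique and
   1-Lipschitz in the data. *)
Lemma measurable_sv_minimizer k :
  measurable_fun setT (fun w => sv k (X^T *m X *m Atilde w)).
Proof.
apply: (measurable_of_lipschitz (Z := E) (L := frobenius_norm X^T)).
- by move=> i; exact: measurable_funPT.
- exact: frobenius_norm_ge0.
- move=> w w'; rewrite -!mulmxA; apply: sv_mulmx_lipschitz.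
  apply: le_trans (random_mx_lipschitz w w').
  apply: le_trans (minimizer_nonexpansive tau0 (Atilde_min w) (Atilde_min w')) _.
  by rewrite opprD addrACA subrr add0r.
Qed.

Lemma prob_rank_error :
  (P [set w | nb_sv_above (2 * tau) (X^T *m X *m Atilde w) <> \rank A] <=
   P [set w | (tau < sv 1 (X^T *m random_mx E w))%R])%E.
Proof.
have t2 : 0 <= 2 * tau by rewrite mulr_ge0.
pose f k w := sv k (X^T *m X *m Atilde w).
(* Monotonicity of P needs measurable events; this writes the error event through two thresholds of
   measurable singular values. *)
have nbE : [set w | nb_sv_above (2 * tau) (X^T *m X *m Atilde w) <> \rank A] =
    ~` ((if (0 < \rank A)%N then [set w | 2 * tau < f (\rank A) w] else setT)
        `\` [set w | 2 * tau < f (\rank A).+1 w]).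
  apply/seteqP; split => w /=.
    move=> h [h1 /negP]; rewrite -leNgt => h2; apply: h; apply/eqP.
    apply/(nb_sv_aboveP _ t2 (rank_leq_col A)); split; last exact: h2.
    by move=> r0; move: h1; rewrite r0.
  move=> h /eqP /(nb_sv_aboveP _ t2 (rank_leq_col A)) [h1 h2]; apply: h; split.
    by case: ifPn => // r0; exact: h1.
  by apply/negP; rewrite -leNgt.
apply: le_measure; rewrite ?inE.
- rewrite nbE; apply: measurableC; apply: measurableD; last first.
    by apply: measurable_gtr_set; exact: measurable_sv_minimizer.
  case: ifP => // _; apply: measurable_gtr_set; exact: measurable_sv_minimizer.
- by apply: measurable_gtr_set; exact: measurable_sv_random_mx.
- move=> w /= h; rewrite ltNge; apply/negP => hE; apply: h.
  exact: rank_recovery tau0 (Atilde_min w) A_gap hE.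
Qed.

End RankEvent.

(** * Integrals against the normal law *)

Section Density.
Context (d : measure_display) (T : measurableType d) (R : realType).
Variables (mu nu : {measure set T -> \bar R}) (g : T -> R).
Hypotheses (mg : measurable_fun setT g) (g0 : forall x, 0 <= g x).
Hypothesis nuE :
  forall A, measurable A -> nu A = (\int[mu]_(x in A) (g x)%:E)%E.

Import HBNNSimple.
Local Open Scope ereal_scope.

Let integral_density_nnsfun (f : {nnsfun T >-> R}) :
  \int[nu]_x (f x)%:E = \int[mu]_x ((f x)%:E * (g x)%:E).
Proof.
under [LHS]eq_integral do rewrite fimfunE -fsumEFin//.
rewrite [LHS]ge0_integral_fsum//; last 2 first.
  - by move=> r; exact/measurable_EFinP/measurableT_comp.
  - by move=> n x _; rewrite EFinM nnfun_muleindic_ge0.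
under [RHS]eq_integral.
  move=> x xD; rewrite fimfunE -fsumEFin// ge0_mule_fsuml; last first.
    by move=> r; rewrite EFinM nnfun_muleindic_ge0.
  over.
rewrite [RHS]ge0_integral_fsum//; last 2 first.
  - move=> r; apply: emeasurable_funM; last exact/measurable_EFinP.
    exact/measurable_EFinP/measurableT_comp.
  - move=> n x _; apply: mule_ge0; last by rewrite lee_fin.
    by rewrite EFinM nnfun_muleindic_ge0.
apply: eq_fsbigr => r _.
rewrite integralZl_indic_nnsfun// integral_indic// setIT.
under [RHS]eq_integral do rewrite EFinM -muleA.
have mf : measurable (f @^-1` [set r]) by exact: measurable_funPTI.
have [r0|r0] := leP 0%R r; last first.
  rewrite preimage_nnfun0// measure0 mule0 integral0_eq// => x _.
  by rewrite indic0 mul0e mule0.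
rewrite ge0_integralZl//; last 2 first.
  - apply: emeasurable_funM; exact/measurable_EFinP.
  - by move=> x _; rewrite mule_ge0 ?lee_fin.
congr (_ * _); rewrite nuE// [LHS]integral_mkcond; apply: eq_integral => x _.
by rewrite patchE indicE; case: ifPn; rewrite ?mul1e ?mul0e.
Qed.

Lemma ge0_integral_density (f : T -> \bar R) :
  measurable_fun setT f -> (forall x, 0 <= f x) ->
  \int[nu]_x f x = \int[mu]_x (f x * (g x)%:E).
Proof.
move=> mf f0; pose f_ := nnsfun_approx measurableT mf.
transitivity (lim (\int[nu]_x (f_ n x)%:E @[n --> \oo])).
  rewrite -monotone_convergence//=.
  - apply: eq_integral => ? /[!inE] xD; apply/esym/cvg_lim => //=.
    exact: cvg_nnsfun_approx.
  - by move=> n; exact/measurable_EFinP/measurable_funTS.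
  - by move=> n ? _; rewrite lee_fin.
  - by move=> ? _ ? ? mn; rewrite lee_fin; exact/lefP/nd_nnsfun_approx.
transitivity (lim (\int[mu]_x ((f_ n x)%:E * (g x)%:E) @[n --> \oo])); last first.
  rewrite -monotone_convergence//=.
  - apply: eq_integral => x /[!inE] xD; apply/cvg_lim => //=.
    by apply: cvgeZr => //; exact: cvg_nnsfun_approx.
  - move=> n; apply: emeasurable_funM; last exact/measurable_EFinP.
    exact/measurable_EFinP/measurable_funTS.
  - by move=> n ? _; rewrite mule_ge0 ?lee_fin.
  - move=> x _ ? ? mn; rewrite lee_wpmul2r ?lee_fin//.
    exact/lefP/nd_nnsfun_approx.
by apply: congr_lim; apply/funext => n /=; exact: integral_density_nnsfun.
Qed.

End Density.

Section NormalIntegrals.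
Variable R : realType.
Implicit Types (f : R -> R) (a b c s t x y : R).
Local Notation mu := (@lebesgue_measure R).

Lemma ge0_integral_normal_prob a s (f : R -> \bar R) :
  measurable_fun setT f -> (forall x, 0 <= f x)%E ->
  (\int[normal_prob a s]_x f x = \int[mu]_x (f x * (normal_pdf a s x)%:E))%E.
Proof.
move=> mf f0; apply: ge0_integral_density => //; first exact: measurable_normal_pdf.
exact: normal_pdf_ge0.
Qed.

Lemma continuous_integral_normal_prob a s f :
  continuous f -> (forall x, 0 <= f x) ->
  (\int[normal_prob a s]_x (f x)%:E =
   \int[mu]_x (f x * normal_pdf a s x)%:E)%E.
Proof.
move=> cf f0; apply: ge0_integral_normal_prob => [|x]; last by rewrite lee_fin.
by apply/measurable_EFinP; exact: continuous_measurable_fun.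
Qed.

Lemma normal_pdf_affine s b x : 0 < s ->
  normal_pdf b s (s * x + b) * s = normal_pdf 0 1 x.
Proof.
move=> s0; rewrite !normal_pdfE ?oner_neq0 ?gt_eqF // mulrAC; congr (_ * _).
  rewrite /normal_peak expr1n mul1r -mulrnAr sqrtrM ?sqr_ge0 // sqrtr_sqr.
  by rewrite gtr0_norm // invfM mulrAC mulVf ?mul1r // gt_eqF.
rewrite /normal_fun addrK subr0 expr1n; congr expR.
by rewrite exprMn; field; rewrite gt_eqF.
Qed.

Lemma integral_normal_affine s b f : 0 < s ->
  continuous f -> (forall x, 0 <= f x) ->
  (\int[normal_prob 0 1]_x (f (s * x + b)%R)%:E =
   \int[normal_prob b s]_x (f x)%:E)%E.
Proof.
move=> s0 cf f0.
have cF : continuous (fun x => s * x + b).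
  by move=> x; apply: cvgD; [apply: cvgMr; exact: cvg_id|exact: cvg_cst].
have s0' : s != 0 by rewrite gt_eqF.
rewrite (continuous_integral_normal_prob _ _ cf f0).
rewrite (@continuous_integral_normal_prob _ _ (fun x => f (s * x + b))); last 2 first.
- move=> x; apply: (@continuous_comp _ _ _ (fun x => s * x + b) f).
    exact: cF.
  exact: cf.
- by move=> x; exact: f0.
have sxb : (fun x : R => s * x + b) = (fun x => s * (x + b / s)).
  by apply/funext => x; rewrite mulrDr mulrCA divff // mulr1.
have F'E : (fun x : R => s * x + b)^`()%classic = cst s.
  apply/funext => x; rewrite derive1E deriveD // deriveM // derive_cst.
  by rewrite derive_id derive_cst scaler0 addr0 addr0 scaler1.
rewrite (@increasing_ge0_integration_by_substitutionT _ (fun x => s * x + b)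
  (fun x => f x * normal_pdf b s x)); last 9 first.
- by move=> x y xy; rewrite ltrD2r ltr_pM2l.
- by rewrite F'E => x; exact: cvg_cst.
- by rewrite F'E; exact: is_cvg_cst.
- by rewrite F'E; exact: is_cvg_cst.
- by move=> x; apply: derivableD => //; exact: derivableM.
- rewrite sxb; apply: gt0_cvgMrNy => //; exact: cvg_addrr_Ny.
- rewrite sxb; apply: gt0_cvgMry => //; exact: cvg_addrr.
- move=> x; apply: continuousM; first exact: cf.
  exact: continuous_normal_pdf.
- by move=> x; rewrite mulr_ge0 ?normal_pdf_ge0.
apply: eq_integral => x _; rewrite F'E -(normal_pdf_affine b x s0).
by rewrite mulrA.
Qed.

(** Completing the square turns the exponential weight into a shift of the density by l. *)
Lemma normal_mgf (l : R) : (\int[normal_prob 0 1]_x (expR (l * x))%:E =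
  (expR (l ^+ 2 / 2))%:E)%E.
Proof.
rewrite (@continuous_integral_normal_prob _ _ (fun x => expR (l * x))); last 2 first.
- move=> x; apply: (@continuous_comp _ _ _ (fun x => l * x) expR).
    by apply: cvgMr; exact: cvg_id.
  exact: continuous_expR.
- by move=> x; exact: expR_ge0.
transitivity (\int[mu]_x ((expR (l ^+ 2 / 2))%:E * (normal_pdf l 1 x)%:E))%E.
  apply: eq_integral => x _; rewrite -EFinM !normal_pdfE ?oner_neq0 //.
  rewrite mulrCA [in RHS]mulrCA /normal_fun -!expRD; congr (_ * expR _)%:E.
  by rewrite expr1n; field.
rewrite ge0_integralZl //.
- by rewrite integral_normal_pdf mule1.
- by apply/measurable_EFinP; exact: measurable_normal_pdf.
- by move=> x _; rewrite lee_fin normal_pdf_ge0.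
Qed.

(** The weight e^(c x^2) turns the standard density into s times the density of N(0, s^2), where
    1/s^2 = 1 - 2c. *)
Lemma normal_mgf_sqr c : c < 2^-1 ->
  (\int[normal_prob 0 1]_x (expR (c * x ^+ 2))%:E =
   (Num.sqrt (1 - 2 * c))^-1%:E)%E.
Proof.
move=> c2; have c0 : 0 < 1 - 2 * c by lra.
rewrite (@continuous_integral_normal_prob _ _ (fun x => expR (c * x ^+ 2)));
  last 2 first.
- move=> x; apply: (@continuous_comp _ _ _ (fun x => c * x ^+ 2) expR).
    by apply: cvgMr; exact: exprn_continuous.
  exact: continuous_expR.
- by move=> x; exact: expR_ge0.
set s := (Num.sqrt _)^-1.
have s0 : 0 < s by rewrite invr_gt0 sqrtr_gt0.
have s2 : s ^+ 2 = (1 - 2 * c)^-1 by rewrite exprVn sqr_sqrtr // ltW.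
transitivity (\int[mu]_x (s%:E * (normal_pdf 0 s x)%:E))%E.
  apply: eq_integral => x _; rewrite -EFinM; congr EFin.
  rewrite -(normal_pdf_affine 0 x s0) addr0 [RHS]mulrC mulrA; congr (_ * _).
  rewrite !normal_pdfE ?gt_eqF // mulrCA /normal_fun -expRD; congr (_ * expR _).
  rewrite !subr0 exprMn s2; field.
  by rewrite gt_eqF.
rewrite ge0_integralZl //.
- by rewrite integral_normal_pdf mule1.
- by apply/measurable_EFinP; exact: measurable_normal_pdf.
- by move=> x _; rewrite lee_fin normal_pdf_ge0.
- by rewrite lee_fin ltW.
Qed.

(** Two factorizations of the joint density of (x, y), where x = s g + t y with g, y standard and
    independent: x given y, and y given x, the latter with mean t x / r^2 and standard deviation s /
    r. *)
Lemma normal_pdf_convolution s t r x y : 0 < s -> 0 < t -> r ^+ 2 = s ^+ 2 + t ^+ 2 ->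
  0 < r ->
  normal_pdf (t * y) s x * normal_pdf 0 1 y =
  normal_pdf 0 r x * normal_pdf (t * x / r ^+ 2) (s / r) y.
Proof.
move=> s0 t0 r2 r0; have [s0' r0' t0'] : [/\ s != 0, r != 0 & t != 0].
  by rewrite !gt_eqF.
rewrite !normal_pdfE ?oner_neq0 ?mulf_neq0 ?invr_eq0 //.
rewrite mulrACA [RHS]mulrACA /normal_fun -!expRD; congr (_ * expR _).
  rewrite /normal_peak -!invfM expr1n mul1r -!sqrtrM ?mulrn_wge0 ?mulr_ge0 ?pi_ge0 ?sqr_ge0 ?ltW //.
  by congr (Num.sqrt _)^-1; field.
rewrite expr1n !subr0 expr_div_n r2; field.
by rewrite s0' andbT -r2 expf_neq0.
Qed.

Lemma normal_pdf_center a s x : normal_pdf a s x = normal_pdf 0 s (x - a) \/ s = 0.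
Proof.
have [->|s0] := eqVneq s 0; first by right.
by left; rewrite !normal_pdfE // /normal_fun subr0.
Qed.

Lemma normal_convolution s t r f : 0 < s -> 0 < t -> 0 < r ->
  r ^+ 2 = s ^+ 2 + t ^+ 2 -> continuous f -> (forall x, 0 <= f x) ->
  (\int[normal_prob 0 1]_y \int[normal_prob 0 1]_x (f (s * x + t * y)%R)%:E =
   \int[normal_prob 0 1]_x (f (r * x)%R)%:E)%E.
Proof.
move=> s0 t0 r0 r2 cf f0.
have mf : measurable_fun setT f by exact: continuous_measurable_fun.
pose k (z : R * R) : \bar R := (f z.1 * normal_pdf (t * z.2) s z.1)%:E.
have mk : measurable_fun setT k.
  apply/measurable_EFinP; apply: measurable_funM.
    by apply: measurableT_comp => //.
  (* Joint measurability in the point and the mean: the density depends only on their difference. *)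
  rewrite (_ : (fun z : R * R => normal_pdf (t * z.2) s z.1) =
      normal_pdf 0 s \o (fun z => z.1 - t * z.2)).
    apply: measurableT_comp; first exact: measurable_normal_pdf.
    by apply: measurable_funB => //; apply: measurable_funM.
  apply/funext => z /=; case: (normal_pdf_center (t * z.2) s z.1) => // h.
  by rewrite h ltxx in s0.
have k0 z : (0 <= k z)%E by rewrite lee_fin mulr_ge0 ?normal_pdf_ge0.
transitivity (\int[normal_prob 0 1]_y \int[mu]_x k (x, y))%E.
  apply: eq_integral => y _.
  by rewrite integral_normal_affine // continuous_integral_normal_prob.
rewrite ge0_integral_normal_prob; last 2 first.
- exact: measurable_fun_fubini_tonelli_G.
- by move=> y; exact: integral_ge0.
pose k2 (z : R * R) : \bar R := (k z * (normal_pdf 0 1 z.2)%:E)%E.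
have mk2 : measurable_fun setT k2.
  apply: emeasurable_funM => //; apply/measurable_EFinP.
  by apply: measurableT_comp; first exact: measurable_normal_pdf.
have k20 z : (0 <= k2 z)%E by rewrite mule_ge0 // lee_fin normal_pdf_ge0.
transitivity (\int[mu]_y \int[mu]_x k2 (x, y))%E.
  apply: eq_integral => y _; rewrite /k2 /= ge0_integralZr //.
  - exact: measurableT_comp mk (pair2_measurable y).
  - by rewrite lee_fin normal_pdf_ge0.
rewrite -fubini_tonelli //.
transitivity (\int[mu]_x (f x * normal_pdf 0 r x)%:E)%E.
  apply: eq_integral => x _.
  transitivity (\int[mu]_y ((f x * normal_pdf 0 r x)%:E *
     (normal_pdf (t * x / r ^+ 2) (s / r) y)%:E))%E.
    apply: eq_integral => y _; rewrite /k2 /k -!EFinM; congr EFin => /=.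
    by rewrite -[LHS]mulrA -[RHS]mulrA (normal_pdf_convolution x y s0 t0 r2 r0).
  rewrite ge0_integralZl //.
  - by rewrite integral_normal_pdf mule1.
  - by apply/measurable_EFinP; exact: measurable_normal_pdf.
  - by move=> y _; rewrite lee_fin normal_pdf_ge0.
  - by rewrite lee_fin mulr_ge0 ?normal_pdf_ge0.
rewrite -(continuous_integral_normal_prob 0 r cf f0).
rewrite -(integral_normal_affine 0 r0 cf f0).
by apply: eq_integral => x _; rewrite addr0.
Qed.

End NormalIntegrals.

(** * Third-order Taylor bounds along a segment *)

Section Taylor.
Variable R : realType.
Implicit Types (f : R -> R) (M : R).

Lemma mvt_bound f (df : R -> R) M : f 0 = 0 ->
  (forall t : R, is_derive t 1 f (df t)) ->
  (forall t, 0 <= t <= 1 -> `|df t| <= M) ->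
  forall t, 0 <= t <= 1 -> `|f t| <= M.
Proof.
move=> f0 f' dfM t /andP[t0 t1].
have M0 : 0 <= M by apply: le_trans (dfM 0 _); rewrite ?lexx ?ler01.
have cf : continuous f.
  by move=> u; apply/differentiable_continuous/derivable1_diffP; exact: ex_derive.
have [c] := MVT_segment t0 (fun x _ => f' x) (continuous_subspaceT cf).
rewrite in_itv /= f0 !subr0 => /andP[c0 ct] ->.
rewrite normrM (ger0_norm t0) -[leRHS]mulr1 ler_pM // dfM //.
by rewrite c0 (le_trans ct).
Qed.

(** Three uses of the mean value theorem on [0, 1], each losing nothing but the factorial; the crude
    constant M instead of M/6 is enough. *)
Lemma taylor3 f (f1 f2 f3 : R -> R) M :
  (forall t : R, is_derive t 1 f (f1 t)) -> (forall t : R, is_derive t 1 f1 (f2 t)) ->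
  (forall t : R, is_derive t 1 f2 (f3 t)) ->
  (forall t, 0 <= t <= 1 -> `|f3 t| <= M) ->
  `|f 1 - f 0 - f1 0 - f2 0 / 2| <= M.
Proof.
move=> d1 d2 d3 hM.
pose g2 t := f2 t - f2 0.
pose g1 t := f1 t - f1 0 - f2 0 * t.
pose g0 t := f t - f 0 - f1 0 * t - f2 0 / 2 * t ^+ 2.
have h2 t : 0 <= t <= 1 -> `|g2 t| <= M.
  apply: (@mvt_bound g2 f3) => [|u|]; rewrite /g2 ?subrr //.
  by apply: is_derive_eq; rewrite subr0.
have h1 t : 0 <= t <= 1 -> `|g1 t| <= M.
  apply: (@mvt_bound g1 g2) => [|u|//]; rewrite /g1 /g2; first by ring.
  by apply: is_derive_eq; rewrite subr0 /GRing.scale /= mulr1.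
have := @mvt_bound g0 g1 M _ _ h1 1.
rewrite /g0 expr1n !mulr1 ler01 lexx; apply => //; first by ring.
move=> t; rewrite /g1; apply: is_derive_eq.
by rewrite /GRing.scale /=; field.
Qed.

Lemma exp_taylor3 (x : R) :
  `|expR x - 1 - x - x ^+ 2 / 2| <= `|x| ^+ 3 * expR `|x|.
Proof.
have d k (t : R) : is_derive t 1 (fun t => x ^+ k * expR (t * x))
    (x ^+ k.+1 * expR (t * x)).
  apply: is_derive_eq; rewrite /GRing.scale /= exprS; ring.
have := taylor3 (d 0%N) (d 1%N) (d 2%N) (M := `|x| ^+ 3 * expR `|x|).
rewrite !mul0r expR0 !mul1r !mulr1 ?expr0 ?mul1r ?expr1; apply => t /andP[t0 t1].
rewrite normrM normrX (ger0_norm (expR_ge0 _)) ler_wpM2l ?exprn_ge0 //.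
rewrite ler_expR (le_trans (ler_norm _)) // normrM (ger0_norm t0).
by rewrite ler_piMl.
Qed.

Lemma cube_le_exp (x : R) : 0 <= x -> x ^+ 3 <= 6 * expR x.
Proof.
move=> x0; have := expR_ge1Dxn 2 x0; rewrite (_ : 3`! = 6)%N // => h.
by rewrite mulrC -ler_pdivrMr // (le_trans _ h) // lerDr.
Qed.

End Taylor.

(** * Integrability and the first two moments of the standard normal law *)

Section NormalMoments.
Variable R : realType.
Implicit Types (f g : R -> R) (c l s : R).
Local Notation gam := (normal_prob (0 : R) 1).

Lemma integrable_normal_exp l : gam.-integrable setT (fun s => (expR (l * s))%:E).
Proof.
apply/integrableP; split.
  by apply/measurable_EFinP; apply: measurableT_comp.
under eq_integral do rewrite gee0_abs ?lee_fin ?expR_ge0 //.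
by rewrite normal_mgf ltry.
Qed.

Lemma integrable_normal_dom f C c : measurable_fun setT f ->
  (forall s, `|f s| <= C * expR (c * `|s|)) ->
  gam.-integrable setT (EFin \o f).
Proof.
move=> mf hf.
have C0 : 0 <= C.
  by have := le_trans (normr_ge0 _) (hf 0); rewrite normr0 mulr0 expR0 mulr1.
have i : gam.-integrable setT
    (fun s => C%:E * ((expR (c * s))%:E + (expR (- c * s))%:E))%E.
  apply: integrableZl => //; apply: integrableD => //;
    exact: integrable_normal_exp.
apply: le_integrable i => //; first exact/measurable_EFinP.
move=> s _; rewrite -EFinD -EFinM !abse_EFin lee_fin (le_trans (hf s)) //.
rewrite [leRHS]ger0_norm ?mulr_ge0 ?addr_ge0 ?expR_ge0 // ler_wpM2l //.
have [s0|s0] := leP 0 s.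
  by rewrite ger0_norm // lerDl expR_ge0.
by rewrite ltr0_norm // mulrN mulNr lerDr expR_ge0.
Qed.

Lemma integrable_normalZ c f : gam.-integrable setT (EFin \o f) ->
  gam.-integrable setT (EFin \o (fun s => c * f s)).
Proof. by move=> /(integrableZl measurableT c); apply: eq_integrable. Qed.

Lemma integrable_normalD f g :
  gam.-integrable setT (EFin \o f) -> gam.-integrable setT (EFin \o g) ->
  gam.-integrable setT (EFin \o (fun s => f s + g s)).
Proof. by move=> hf /(integrableD measurableT hf); apply: eq_integrable. Qed.

Lemma integrable_normal_cst c : gam.-integrable setT (EFin \o (fun=> c)).
Proof.
by apply: (@integrable_normal_dom _ `|c| 0) => // s; rewrite mul0r expR0 mulr1.
Qed.

Definition gaussE f := \int[gam]_s f s.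

Lemma gaussE_exp l : gaussE (fun s => expR (l * s)) = expR (l ^+ 2 / 2).
Proof. by rewrite /gaussE /Rintegral normal_mgf. Qed.

Lemma gaussE_cst c : gaussE (fun=> c) = c.
Proof.
rewrite /gaussE /Rintegral integral_cst // [X in (_ * X)%E](_ : _ = 1%E) ?mule1 //.
exact: probability_setT.
Qed.

Lemma gaussED f g :
  gam.-integrable setT (EFin \o f) -> gam.-integrable setT (EFin \o g) ->
  gaussE (fun s => f s + g s) = gaussE f + gaussE g.
Proof. by move=> hf hg; rewrite /gaussE RintegralD. Qed.

Lemma gaussEZ c f : gam.-integrable setT (EFin \o f) ->
  gaussE (fun s => c * f s) = c * gaussE f.
Proof. by move=> hf; rewrite /gaussE RintegralZl. Qed.

Lemma gaussE_le f g :
  gam.-integrable setT (EFin \o f) -> gam.-integrable setT (EFin \o g) ->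
  (forall s, f s <= g s) -> gaussE f <= gaussE g.
Proof. by move=> hf hg fg; apply: le_Rintegral. Qed.

Lemma gaussE_EFin f : gam.-integrable setT (EFin \o f) ->
  (gaussE f)%:E = (\int[gam]_s (f s)%:E)%E.
Proof. by move=> hf; rewrite /gaussE /Rintegral fineK // integrable_fin_num. Qed.

Lemma gaussE_abs_le f g :
  gam.-integrable setT (EFin \o f) -> gam.-integrable setT (EFin \o g) ->
  (forall s, `|f s| <= g s) -> `|gaussE f| <= gaussE g.
Proof.
move=> hf hg fg; rewrite ler_norml; apply/andP; split; last first.
  by apply: gaussE_le => // s; rewrite (le_trans (ler_norm _)).
rewrite lerNl -mulN1r -gaussEZ //; apply: gaussE_le => //.
  exact: integrable_normalZ.
by move=> s; rewrite mulN1r (le_trans (ler_norm _)) // normrN.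
Qed.

Lemma integrable_normal_id : gam.-integrable setT (EFin \o (fun s => s)).
Proof.
apply: (@integrable_normal_dom _ 1 1) => // s; rewrite !mul1r.
by rewrite (le_trans _ (expR_ge1Dx _)) // lerDr.
Qed.

Lemma integrable_normal_cube c :
  gam.-integrable setT (EFin \o (fun s => `|s| ^+ 3 * expR (c * `|s|))).
Proof.
apply: (@integrable_normal_dom _ 6 (c + 1)) => [|s].
  have mn : measurable_fun setT (fun s : R => `|s|) by exact: normr_measurable.
  apply: measurable_funM; first exact: measurable_funX.
  by apply: measurableT_comp => //; exact: measurable_funM.
rewrite ger0_norm ?mulr_ge0 ?exprn_ge0 ?expR_ge0 //.
rewrite [(c + 1) * _]mulrDl mul1r expRD mulrCA mulrC ler_wpM2l ?expR_ge0 //.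
exact: cube_le_exp.
Qed.

Lemma integrable_normal_sqr : gam.-integrable setT (EFin \o (fun s => s ^+ 2)).
Proof.
apply: (@integrable_normal_dom _ 2 1) => [|s]; first exact: measurable_funX.
rewrite normrX mul1r; have := expR_ge1Dxn 1 (normr_ge0 s).
rewrite (_ : 2`! = 2)%N // => h.
by rewrite mulrC -ler_pdivrMr // (le_trans _ h) // lerDr.
Qed.

Lemma eq0_of_linear_bound (a K : R) : 0 <= K ->
  (forall l, 0 < l -> l <= 1 -> `|a| <= l * K) -> a = 0.
Proof.
move=> K0 h; apply/eqP; rewrite -normr_le0; apply: (le_of_le_eps K0) => e e0 e1.
by rewrite add0r; exact: h.
Qed.

(** The moments are read off the Laplace transform e^(l^2/2): expanding it and e^(ls) to second
    order gives l m1 + l^2/2 (m2 - 1) = O(|l|^3). Combining l and -l isolates m2, then m1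
    follows. *)
Lemma normal_moments : gaussE (fun s => s) = 0 /\ gaussE (fun s => s ^+ 2) = 1.
Proof.
pose K := gaussE (fun s => `|s| ^+ 3 * expR (1 * `|s|)) + 1.
set m1 := gaussE _; set m2 := gaussE _.
have K0 : 0 <= K.
  rewrite addr_ge0 // -[leLHS](gaussE_cst 0) gaussE_le //.
  - exact: integrable_normal_cst.
  - exact: integrable_normal_cube.
have h l : `|l| <= 1 -> `|l * m1 + l ^+ 2 / 2 * (m2 - 1)| <= `|l| ^+ 3 * K.
  move=> l1.
  have i1 := integrable_normalZ l integrable_normal_id.
  have i2 := integrable_normalZ (l ^+ 2 / 2) integrable_normal_sqr.
  have i01 := integrable_normalD (integrable_normal_cst 1) i1.
  have i012 := integrable_normalD i01 i2.
  have E012 : gaussE (fun s => 1 + l * s + l ^+ 2 / 2 * s ^+ 2) =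
      1 + l * m1 + l ^+ 2 / 2 * m2.
    rewrite (gaussED i01 i2) (gaussED (integrable_normal_cst 1) i1) gaussE_cst.
    by rewrite (gaussEZ l integrable_normal_id) (gaussEZ _ integrable_normal_sqr).
  have iN := integrable_normalZ (-1) i012.
  have ic : gam.-integrable setT
      (EFin \o (fun s => `|l| ^+ 3 * (`|s| ^+ 3 * expR (1 * `|s|)))).
    exact/integrable_normalZ/integrable_normal_cube.
  have := gaussE_abs_le (integrable_normalD (integrable_normal_exp l) iN) ic.
  rewrite (gaussED (integrable_normal_exp l) iN) gaussE_exp (gaussEZ _ i012) E012.
  rewrite (gaussEZ _ (integrable_normal_cube 1)).
  move=> hh; have {}hh := hh _.
  set K' := gaussE _ in hh.
  have {}hh : `|expR (l ^+ 2 / 2) - (1 + l * m1 + l ^+ 2 / 2 * m2)| <= `|l| ^+ 3 * K'.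
    rewrite -[X in _ - X]mul1r -mulNr; apply: hh => s.
    have := exp_taylor3 (l * s); rewrite mulN1r normrM !exprMn => h3.
    have -> : expR (l * s) - (1 + l * s + l ^+ 2 / 2 * s ^+ 2) =
        expR (l * s) - 1 - l * s - l ^+ 2 * s ^+ 2 / 2 by field.
    rewrite (le_trans h3) // mulrA ler_wpM2l ?mulr_ge0 ?exprn_ge0 //.
    by rewrite ler_expR mul1r ler_piMl.
  set x := l ^+ 2 / 2 in hh *.
  have x0 : 0 <= x by rewrite divr_ge0 ?sqr_ge0.
  have x2 : x <= 2^-1.
    by rewrite ler_piMl // -real_normK ?num_real // exprn_ile1.
  have e2 : expR x <= 2.
    rewrite (le_trans (_ : _ <= expR 2^-1)) ?ler_expR // -[leRHS]invrK.
    rewrite -[expR _]invrK -expRN lef_pV2 ?posrE ?expR_gt0 ?invr_gt0 //.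
    by apply: le_trans (expR_ge1Dx _); lra.
  (* This remainder, at x = l^2/2, is the [+ 1] in the constant K. *)
  have ax : `|expR x - 1 - x| <= `|l| ^+ 3.
    have := exp_taylor3 x; rewrite (ger0_norm x0) => h3.
    have -> : expR x - 1 - x = (expR x - 1 - x - x ^+ 2 / 2) + x ^+ 2 / 2 by ring.
    rewrite (le_trans (ler_normD _ _)) // (le_trans (lerD h3 (lexx _))) //.
    rewrite ger0_norm ?divr_ge0 ?sqr_ge0 //.
    have x3 : x ^+ 3 * expR x <= x ^+ 2.
      rewrite exprSr -mulrA ler_piMr ?sqr_ge0 //.
      by rewrite (le_trans (ler_pM _ _ x2 e2)) ?expR_ge0 // mulVf.
    have x4 : x ^+ 2 <= `|l| ^+ 3 / 4.
      rewrite /x -(real_normK (num_real l)) [in X in X <= _]exprMn -exprM.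
      by rewrite (exprSr _ 3) exprVn -natrX -mulrA ler_wpM2l ?exprn_ge0 // ler_piMl.
    have l3 : 0 <= `|l| ^+ 3 by rewrite exprn_ge0.
    by clear - x3 x4 l3; lra.
  rewrite (_ : _ + _ = (expR x - 1 - x) - (expR x - (1 + l * m1 + x * m2))).
    by rewrite (le_trans (ler_normB _ _)) // /K mulrDr mulr1 addrC lerD.
  by ring.
have m2E : m2 - 1 = 0.
  apply: (eq0_of_linear_bound (K := 2 * K)) => [|l l0 l1].
    by rewrite mulr_ge0.
  have ln1 : `|l| <= 1 by rewrite gtr0_norm.
  have := h _ ln1; have := h (- l); rewrite normrN => /(_ ln1).
  rewrite (gtr0_norm l0) !ler_norml => /andP[a1 a2] /andP[b1 b2].
  have l2 : 0 < l ^+ 2 by rewrite exprn_gt0.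
  apply/andP; split; rewrite -(ler_pM2l l2); move: a1 a2 b1 b2; clear;
    move: m1 m2 K => u v k; lra.
have m1E : m1 = 0.
  apply: (eq0_of_linear_bound K0) => l l0 l1.
  have := h l; rewrite m2E mulr0 addr0 (gtr0_norm l0) => /(_ l1).
  rewrite normrM (gtr0_norm l0) exprS -mulrA ler_pM2l // => /le_trans; apply.
  by rewrite ler_wpM2r // expr2 ler_piMl // ltW.
by split => //; apply/eqP; rewrite -subr_eq0 m2E.
Qed.

End NormalMoments.

(** * Gaussian smoothing and comparison *)

Section Smoothing.
Variables (R : realType) (V : lmodType R) (N : V -> R) (lam : R).
Hypotheses (N_ge0 : forall x, 0 <= N x)
  (NZ : forall a x, N (a *: x) = `|a| * N x) (lam0 : 0 <= lam).
Implicit Types (F G : V -> R) (a b x y : V) (c s t : R).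
Local Notation gam := (normal_prob (0 : R) 1).

Lemma continuous_of_loglip (f : R -> R) c :
  (forall s u, 0 < f s /\ f (s + u) <= expR (c * `|u|) * f s) -> continuous f.
Proof.
move=> h s.
pose g t := (expR (c * `|t - s|) - 1) * f s.
have cg : g t @[t --> s] --> 0.
  rewrite [X in _ --> X](_ : 0 = (expR (c * `|s - s|) - 1) * f s); last first.
    by rewrite subrr normr0 mulr0 expR0 subrr mul0r.
  apply: cvgMl; apply: cvgB; last exact: cvg_cst.
  apply: continuous_cvg; first exact: continuous_expR.
  apply: cvgMr; apply: cvg_norm.
  by apply: cvgB; [exact: cvg_id|exact: cvg_cst].
have cl : f s - g t @[t --> s] --> f s.
  by rewrite -[X in _ --> X]subr0; apply: cvgB => //; exact: cvg_cst.
have cu : f s + g t @[t --> s] --> f s.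
  by rewrite -[X in _ --> X]addr0; apply: cvgD => //; exact: cvg_cst.
apply: squeeze_cvgr cl cu; apply: nearW => t; rewrite /g.
have [fs h1] := h s (t - s); rewrite addrC subrK in h1.
have [ft h2] := h t (s - t); rewrite addrC subrK distrC in h2.
apply/andP; split; last by rewrite mulrBl mul1r addrC subrK.
rewrite -(ler_pM2l (expR_gt0 (c * `|t - s|))) (le_trans _ h2) //.
(* The lower bound amounts to e (2 - e) <= 1, that is (e - 1)^2 >= 0. *)
move: (expR _) (f s) fs => e u u0; have := mulr_ge0 (sqr_ge0 (e - 1)) (ltW u0).
by lra.
Qed.

(* For F > 0 this says that ln F is lam-Lipschitz for N, which makes every
   Gaussian integral below finite and comparable to F itself. *)
Definition loglip F := forall x d, 0 < F x /\ F (x + d) <= expR (lam * N d) * F x.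

Lemma loglip_gt0 F x : loglip F -> 0 < F x.
Proof. by move=> /(_ x 0)[]. Qed.

Lemma loglip_le F x d : loglip F -> F (x + d) <= expR (lam * N d) * F x.
Proof. by move=> /(_ x d)[]. Qed.

Lemma loglip_line F x a s u : loglip F ->
  0 < F (x + s *: a) /\
  F (x + (s + u) *: a) <= expR (lam * N a * `|u|) * F (x + s *: a).
Proof.
move=> hF; split; first exact: loglip_gt0.
by rewrite scalerDl addrA (le_trans (loglip_le _ _ hF)) // NZ mulrC -mulrA
  (mulrC (N a)) mulrC.
Qed.

Lemma continuous_loglip_line F x a : loglip F ->
  continuous (fun s : R => F (x + s *: a)).
Proof. by move=> hF; apply: continuous_of_loglip => s u; exact: loglip_line. Qed.

Lemma integrable_loglip_line F x a : loglip F ->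
  gam.-integrable setT (EFin \o (fun s => F (x + s *: a))).
Proof.
move=> hF; apply: (@integrable_normal_dom _ _ (F x) (lam * N a)) => [|s].
  by apply: continuous_measurable_fun; exact: continuous_loglip_line.
rewrite gtr0_norm ?loglip_gt0 // mulrC.
by have [_] := loglip_line x a 0 s hF; rewrite add0r scale0r addr0.
Qed.

Lemma loglipD F G : loglip F -> loglip G -> loglip (fun x => F x + G x).
Proof.
move=> hF hG x d; split; first by rewrite addr_gt0 ?loglip_gt0.
by rewrite mulrDr lerD ?loglip_le.
Qed.

Lemma loglipZ c F : 0 < c -> loglip F -> loglip (fun x => c * F x).
Proof.
move=> c0 hF x d; split; first by rewrite mulr_gt0 ?(loglip_gt0 x hF).
by rewrite mulrCA ler_pM2l ?(loglip_le x d hF).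
Qed.

Lemma loglip_shift a F : loglip F -> loglip (fun x => F (x + a)).
Proof.
move=> hF x d; split; first exact: loglip_gt0.
by rewrite addrAC loglip_le.
Qed.

(** Mean of F at x + eps a for a uniform random sign eps. *)
Definition flip a F x := (F (x + a) + F (x - a)) / 2.

Lemma loglip_flip a F : loglip F -> loglip (flip a F).
Proof.
move=> hF x d; have h2 : 0 < 2^-1 :> R by rewrite invr_gt0.
have := loglipZ h2 (loglipD (loglip_shift a hF) (loglip_shift (- a) hF)).
by move=> /(_ x d); rewrite ![2^-1 * _]mulrC.
Qed.

Definition gsmooth a F x := gaussE (fun s => F (x + s *: a)).

Lemma gsmooth_le a F G : loglip F -> loglip G -> (forall x, F x <= G x) ->
  forall x, gsmooth a F x <= gsmooth a G x.
Proof.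
by move=> hF hG FG x; apply: gaussE_le => //; exact: integrable_loglip_line.
Qed.

Lemma gsmoothD a F G x : loglip F -> loglip G ->
  gsmooth a (fun x => F x + G x) x = gsmooth a F x + gsmooth a G x.
Proof.
by move=> hF hG; apply: gaussED; exact: integrable_loglip_line.
Qed.

Lemma gsmoothZ a c F x : loglip F ->
  gsmooth a (fun x => c * F x) x = c * gsmooth a F x.
Proof. by move=> hF; apply: gaussEZ; exact: integrable_loglip_line. Qed.

Lemma gsmooth_shift a b F x : gsmooth a (fun x => F (x + b)) x = gsmooth a F (x + b).
Proof. by rewrite /gsmooth; congr gaussE; apply/funext => s; rewrite addrAC. Qed.

Lemma loglip_gsmooth a F : loglip F -> loglip (gsmooth a F).
Proof.
move=> hF x d; split.
  (* Strict positivity of the integral needs an explicit minorant: 2|s| <= 1 + s^2 bounds F (x + s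
     a) below by F x e^(-k) e^(-k s^2), whose Gaussian mean is positive. *)
  pose k := lam * N a / 2.
  have k0 : 0 <= k by rewrite !mulr_ge0 ?invr_ge0.
  have c0 : - k < 2^-1 by rewrite (@le_lt_trans _ _ 0) ?oppr_le0 ?invr_gt0.
  have i2 : gam.-integrable setT (EFin \o (fun s => expR (- k * s ^+ 2))).
    apply: (@integrable_normal_dom _ _ 1 0) => [|s].
      by apply: measurableT_comp => //; apply: measurable_funM.
    rewrite ger0_norm ?expR_ge0 // mul0r mul1r ler_expR mulNr oppr_le0.
    by rewrite mulr_ge0 ?sqr_ge0.
  pose C := F x * expR (- k).
  have C0 : 0 < C by rewrite mulr_gt0 ?expR_gt0 ?(loglip_gt0 x hF).
  have h2 : gaussE (fun s => C * expR (- k * s ^+ 2)) <= gsmooth a F x.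
    apply: gaussE_le; [exact: integrable_normalZ|exact: integrable_loglip_line|].
    move=> s; have := loglip_le (x + s *: a) (- (s *: a)) hF; rewrite addrK.
    rewrite -scaleNr NZ normrN mulrC -ler_pdivrMr ?expR_gt0 // => h1.
    apply: le_trans h1; rewrite /C -mulrA -expRD -expRN (ler_pM2l (loglip_gt0 x hF)) ler_expR.
    have -> : lam * (`|s| * N a) = k * (`|s| *+ 2) by rewrite /k; field.
    have := sqr_ge0 (`|s| - 1); rewrite sqrrB1 real_normK ?num_real // => h.
    by have := mulr_ge0 k0 h; lra.
  apply: lt_le_trans h2.
  rewrite gaussEZ // mulr_gt0 // /gaussE /Rintegral normal_mgf_sqr //=.
  by rewrite invr_gt0 sqrtr_gt0; move: k0; lra.
rewrite -gsmooth_shift -gsmoothZ //; apply: gsmooth_le.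
- exact: loglip_shift.
- by apply: loglipZ => //; exact: expR_gt0.
- by move=> y; exact: loglip_le.
Qed.

Lemma gsmooth_flip a b F x : loglip F ->
  gsmooth a (flip b F) x = flip b (gsmooth a F) x.
Proof.
move=> hF; rewrite /flip; have h2 : 0 < 2^-1 :> R by rewrite invr_gt0.
transitivity (gsmooth a (fun y => 2^-1 * (F (y + b) + F (y - b))) x).
  by congr gaussE; apply/funext => s; rewrite mulrC.
have hb := loglip_shift b hF; have hNb := loglip_shift (- b) hF.
by rewrite gsmoothZ ?gsmoothD ?gsmooth_shift 1?mulrC //; exact: loglipD.
Qed.

(** Variances of independent normal variables add; this lets one smoothing be cut into many small
    ones. *)
Lemma gsmooth_semigroup a s t r F x : 0 < s -> 0 < t -> 0 < r ->
  r ^+ 2 = s ^+ 2 + t ^+ 2 -> loglip F ->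
  gsmooth (t *: a) (gsmooth (s *: a) F) x = gsmooth (r *: a) F x.
Proof.
move=> s0 t0 r0 r2 hF; apply: EFin_inj.
rewrite !gaussE_EFin; last 2 first.
- exact: integrable_loglip_line.
- by apply: integrable_loglip_line; exact: loglip_gsmooth.
pose f u := F (x + u *: a).
have := @normal_convolution R s t r f s0 t0 r0 r2
  (continuous_loglip_line (x := x) (a := a) hF) _.
rewrite /f => h.
transitivity (\int[gam]_y \int[gam]_u (F (x + (s * u + t * y)%R *: a))%:E)%E.
  apply: eq_integral => y _; rewrite gaussE_EFin.
    by apply: eq_integral => u _; rewrite scalerDl !scalerA (mulrC y) (mulrC u)
      -addrA (addrC (_ *: _)).
  exact: integrable_loglip_line.
rewrite h.
  by apply: eq_integral => u _; rewrite scalerA mulrC.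
by move=> u; rewrite ltW ?loglip_gt0.
Qed.

(** Monotone operators, linear for positive combinations only, since [loglip] functions are positive
    and differences leave the class. *)
Definition good_op (A : (V -> R) -> V -> R) :=
  [/\ forall F, loglip F -> loglip (A F),
      forall F G, loglip F -> loglip G -> (forall x, F x <= G x) ->
        forall x, A F x <= A G x &
      forall F G c, loglip F -> loglip G -> 0 < c ->
        A (fun x => F x + c * G x) = (fun x => A F x + c * A G x)].

Definition commuting (A B : (V -> R) -> V -> R) :=
  forall F, loglip F -> A (B F) = B (A F).

Lemma good_op_comp A B : good_op A -> good_op B -> good_op (fun F => A (B F)).
Proof.
move=> [A1 A2 A3] [B1 B2 B3]; split => [F hF|F G hF hG FG|F G c hF hG c0].
- exact/A1/B1.
- by apply: A2; [exact: B1|exact: B1|exact: B2].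
- by rewrite B3 // A3 //; exact: B1.
Qed.

Lemma good_op_id : good_op id.
Proof. by []. Qed.

Lemma good_op_iter n A : good_op A -> good_op (iter n A).
Proof.
move=> hA; elim: n => [|n IH]; first exact: good_op_id.
exact: good_op_comp hA IH.
Qed.

Lemma good_op_gsmooth a : good_op (gsmooth a).
Proof.
split => [F hF|F G hF hG|F G c hF hG c0]; first exact: loglip_gsmooth.
  exact: gsmooth_le.
apply/funext => x; by rewrite (gsmoothD a x hF (loglipZ c0 hG)) (gsmoothZ a c x hG).
Qed.

Lemma good_op_flip a : good_op (flip a).
Proof.
split => [F hF|F G hF hG FG x|F G c hF hG c0]; first exact: loglip_flip.
  by rewrite ler_pM2r ?invr_gt0 // lerD.
by apply/funext => x; rewrite /flip; ring.
Qed.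

Definition gsmooths (l : seq V) F := foldl (fun G a => gsmooth a G) F l.
Definition flips (l : seq V) F := foldl (fun G a => flip a G) F l.

Lemma good_op_gsmooths l : good_op (gsmooths l).
Proof.
elim: l => [|a l IH]; first exact: good_op_id.
exact: good_op_comp IH (good_op_gsmooth a).
Qed.

Lemma good_op_flips l : good_op (flips l).
Proof.
elim: l => [|a l IH]; first exact: good_op_id.
exact: good_op_comp IH (good_op_flip a).
Qed.

Lemma commuting_iter n A B : good_op A -> good_op B -> commuting A B ->
  commuting (iter n A) B.
Proof.
move=> hA hB AB; elim: n => [//|n IH] F hF /=.
rewrite IH // AB //; have [h _ _] := good_op_iter n hA; exact: h.
Qed.

Lemma commuting_sym A B : commuting A B -> commuting B A.
Proof. by move=> h F hF; rewrite h. Qed.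

Lemma commuting_flip a b : commuting (flip a) (flip b).
Proof.
move=> F _; apply/funext => x; rewrite /flip.
rewrite (addrAC x a b) (addrAC x a (- b)) (addrAC x (- a) b).
by rewrite (addrAC x (- a) (- b)); ring.
Qed.

Lemma commuting_flips a l : commuting (flip a) (flips l).
Proof.
elim: l => [|b l IH] F hF //=.
by rewrite (IH _ (loglip_flip b hF)) (commuting_flip a b hF).
Qed.

Lemma commuting_flipss l l' : commuting (flips l) (flips l').
Proof.
elim: l => [|b l IH] F hF //=.
by rewrite (commuting_flips b l' hF) (IH _ (loglip_flip b hF)).
Qed.

Lemma commuting_gsmooths_flip a l : commuting (gsmooths l) (flip a).
Proof.
elim: l => [|b l IH] F hF //=.
rewrite (_ : gsmooth b (flip a F) = flip a (gsmooth b F)).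
  exact: (IH _ (loglip_gsmooth b hF)).
by apply/funext => x; exact: gsmooth_flip.
Qed.

Lemma iter_comp_commuting n A B F : good_op A -> good_op B -> commuting A B ->
  loglip F -> iter n (fun G => A (B G)) F = iter n A (iter n B F).
Proof.
move=> hA hB AB hF; elim: n => [//|n /= ->].
have [gB _ _] := good_op_iter n hB.
by rewrite -(commuting_iter n hA hB AB) //; exact: gB.
Qed.

Lemma iter_le n A F k : good_op A -> loglip F -> 0 < k ->
  (forall x, A F x <= k * F x) -> forall x, iter n A F x <= k ^+ n * F x.
Proof.
move=> hA hF k0 hk; elim: n => [|n IH] x; first by rewrite mul1r.
have gn := good_op_iter n hA; have [gn1 gn2 gn3] := gn.
have [A1 A2 A3] := hA.
rewrite iterSr (le_trans (gn2 _ _ (A1 _ hF) (loglipZ k0 hF) hk x)) //.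
(* Homogeneity is not part of [good_op]: it follows by evaluating the operator on k F + F = F + k F
   in both orders and cancelling. *)
suff -> : iter n A (fun x => k * F x) x = k * iter n A F x.
  by rewrite exprS -mulrA ler_pM2l.
have h c : 0 < c -> iter n A (fun x => F x + c * F x) x = iter n A F x + c * iter n A F x.
  by move=> c0; rewrite gn3.
have h1 := gn3 (fun x => k * F x) F 1 (loglipZ k0 hF) hF ltr01.
have h2 := gn3 F F k hF hF k0.
have h3 : (fun x => k * F x + 1 * F x) = (fun x => F x + k * F x).
  by apply/funext => y; rewrite mul1r addrC.
rewrite h3 h2 in h1; move: (congr1 (fun f => f x) h1) => /=.
by rewrite mul1r addrC => /addIr ->.
Qed.

(** Telescoping: the A's become B's one at a time. Commutation lets the exchanged factor act
    directly on F, so the one-step hypotheses about F suffice; each exchange costs e times a power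
    of k. *)
Lemma iter_compare n A B F e k : good_op A -> good_op B -> commuting A B ->
  loglip F -> 0 < e -> 1 <= k -> (forall x, A F x <= k * F x) ->
  (forall x, B F x <= k * F x) -> (forall x, A F x <= B F x + e * F x) ->
  forall x, iter n.+1 A F x <= iter n.+1 B F x + n.+1%:R * e * k ^+ n.+1 * F x.
Proof.
move=> hA hB AB hF e0 k1 Ak Bk ABe.
have k0 : 0 < k by exact: lt_le_trans k1.
have [A1 A2 A3] := hA; have [B1 B2 B3] := hB.
have step m x : iter m.+1 A F x <= B (iter m A F) x + e * (k ^+ m * F x).
  have [g1 g2 g3] := good_op_iter m hA.
  rewrite iterSr; apply: le_trans (g2 _ (fun x => B F x + e * F x) _ _ ABe x) _.
  - exact: A1.
  - by apply: loglipD; [exact: B1|exact: loglipZ].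
  rewrite g3 //; last exact: B1.
  by rewrite (commuting_iter m hA hB AB) // lerD2l ler_pM2l // iter_le.
elim: n => [|n IH] x.
  rewrite expr1 -[1%:R * e * k * _]mulrA mul1r (le_trans (ABe x)) // lerD2l.
  by rewrite ler_pM2l // ler_peMl // ltW // loglip_gt0.
rewrite (le_trans (step n.+1 x)) //.
have [gA _ _] := good_op_iter n.+1 hA; have [gB _ _] := good_op_iter n.+1 hB.
pose c := n.+1%:R * e * k ^+ n.+1.
have c0 : 0 < c by rewrite !mulr_gt0 ?exprn_gt0 ?ltr0n.
have h : B (iter n.+1 A F) x <= iter n.+2 B F x + c * (k * F x).
  apply: le_trans (B2 _ (fun x => iter n.+1 B F x + c * F x) _ _ IH x) _.
  - exact: gA.
  - by apply: loglipD; [exact: gB|exact: loglipZ].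
  rewrite B3 //; last exact: gB.
  by rewrite lerD2l ler_pM2l.
rewrite (le_trans (lerD h (lexx _))) // -addrA lerD2l.
rewrite [leRHS](_ : _ = c * (k * F x) + e * (k ^+ n.+2 * F x)); last first.
  by rewrite /c [k ^+ n.+2]exprSr -[n.+2]addn1 natrD; ring.
rewrite lerD2l ler_pM2l // ler_pM2r ?loglip_gt0 //.
by rewrite [k ^+ n.+2]exprS ler_peMl // exprn_ge0 // ltW.
Qed.

Hypothesis ND : forall x y, N (x + y) <= N x + N y.

(** [lin x] and [quad x] stand for the first and second differentials of F at x. The bounds are
    relative to F x so that monotone operators can carry them. *)
Variables (F : V -> R) (lin : V -> V -> R) (quad : V -> V -> V -> R) (C : R).
Hypotheses (hF : loglip F) (C0 : 0 <= C)
  (linZ : forall x c y, lin x (c *: y) = c * lin x y)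
  (linD : forall x y (z : V), lin x (y + z) = lin x y + lin x z)
  (quadZ : forall x c y (z : V), quad x (c *: y) z = c * quad x y z)
  (quadD : forall x y z (w : V), quad x (y + z) w = quad x y w + quad x z w)
  (quadC : forall x y (z : V), quad x y z = quad x z y)
  (quad_le : forall x y, `|quad x y y| <= C * N y ^+ 2 * F x)
  (F_taylor : forall x y, `|F (x + y) - F x - lin x y - quad x y y / 2| <=
     C * N y ^+ 3 * expR (lam * N y) * F x).

Lemma quadZZ x c y : quad x (c *: y) (c *: y) = c ^+ 2 * quad x y y.
Proof. by rewrite quadZ quadC quadZ mulrA. Qed.

(** Integrates the Taylor bound: the linear term has mean 0, the quadratic one has s^2 of mean 1,
    and the cubic remainder has a finite Gaussian mean M. The condition d <= 1 removes d from the
    exponent. *)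
Lemma gsmooth_taylor a : exists2 K, 0 <= K &
  forall (d : R) x, 0 < d -> d <= 1 ->
  `|gsmooth (d *: a) F x - F x - d ^+ 2 / 2 * quad x a a| <= K * d ^+ 3 * F x.
Proof.
pose M := gaussE (fun s => `|s| ^+ 3 * expR (lam * N a * `|s|)).
have M0 : 0 <= M.
  rewrite -[leLHS](gaussE_cst 0); apply: gaussE_le.
  - exact: integrable_normal_cst.
  - exact: integrable_normal_cube.
  - by move=> s; rewrite mulr_ge0 ?exprn_ge0 ?expR_ge0.
exists (C * N a ^+ 3 * M) => [|d x d0 d1]; first by rewrite !mulr_ge0 ?exprn_ge0.
have [m1 m2] := normal_moments R.
have Fx := loglip_gt0 x hF.
have i1 := integrable_normalZ (d * lin x a) (integrable_normal_id R).
have i2 := integrable_normalZ (d ^+ 2 / 2 * quad x a a) (integrable_normal_sqr R).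
have i12 := integrable_normalD i1 i2.
have i012 := integrable_normalD (integrable_normal_cst (F x)) i12.
have E : gaussE (fun s => F x + (d * lin x a * s + d ^+ 2 / 2 * quad x a a * s ^+ 2))
    = F x + d ^+ 2 / 2 * quad x a a.
  rewrite (gaussED (integrable_normal_cst (F x)) i12) gaussE_cst (gaussED i1 i2).
  rewrite (gaussEZ _ (integrable_normal_id R)) (gaussEZ _ (integrable_normal_sqr R)).
  by rewrite m1 m2 mulr0 add0r mulr1.
have ig := integrable_loglip_line x (d *: a) hF.
have iN := integrable_normalZ (-1) i012.
have ic := integrable_normalZ (C * N a ^+ 3 * d ^+ 3 * F x)
  (integrable_normal_cube (lam * N a)).
have := gaussE_abs_le (integrable_normalD ig iN) ic _.
rewrite (gaussED ig iN) (gaussEZ _ i012) E (gaussEZ _ (integrable_normal_cube _)).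
rewrite -/(gsmooth (d *: a) F x) -/M mulN1r opprD addrA => h.
rewrite [leRHS](_ : _ = C * N a ^+ 3 * d ^+ 3 * F x * M); last by ring.
apply: h => s.
have := F_taylor x (s *: (d *: a)); rewrite scalerA linZ quadZZ NZ.
rewrite normrM (gtr0_norm d0) => h.
have -> : F (x + (s * d) *: a) + -1 * (F x + (d * lin x a * s + d ^+ 2 / 2 * quad x a a * s ^+ 2)) =
  F (x + (s * d) *: a) - F x - s * d * lin x a - (s * d) ^+ 2 * quad x a a / 2.
  by field.
apply: le_trans h _.
rewrite [leLHS](_ : _ = (C * N a ^+ 3 * d ^+ 3 * F x * `|s| ^+ 3) *
  expR (lam * (`|s| * d * N a))); last by ring.
rewrite [leRHS]mulrA ler_wpM2l ?mulr_ge0 ?exprn_ge0 ?(ltW d0) ?(ltW Fx) //.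
rewrite ler_expR -[leRHS]mulrA ler_wpM2l // mulrC ler_wpM2l //.
by rewrite ler_piMr.
Qed.

(** Iterated sign averages evaluate a function only within the total length of the steps, so
    closeness of G and H there suffices. *)
Lemma flips_local l (G H : V -> R) (M : R) x y0 :
  (forall y, N (y - y0) <= \sum_(a <- l) N a -> `|G (x + y) - H y| <= M) ->
  `|flips l G (x + y0) - flips l H y0| <= M.
Proof.
elim: l G H => [|a l IH] G H h /=.
  by apply: h; rewrite subrr big_nil -(scale0r 0) NZ normr0 mul0r.
apply: IH => y hy; rewrite /flip.
have Na (b : V) : N b = N a -> N (y + b - y0) <= \sum_(c <- a :: l) N c.
  move=> Nb; rewrite big_cons addrAC (le_trans (ND _ _)) //.
  by rewrite Nb [leRHS]addrC lerD2r.
have NN : N (- a) = N a by rewrite -scaleN1r NZ normrN1 mul1r.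
have h1 := h _ (Na a erefl); have h2 := h _ (Na (- a) NN).
rewrite -mulrBl opprD addrACA normrM [`|2^-1|]ger0_norm ?invr_ge0 //.
rewrite addrA in h1; rewrite addrA in h2.
rewrite ler_pdivrMr // mulr_natr mulr2n.
by rewrite (le_trans (ler_normD _ _)) // lerD.
Qed.

(** On a quadratic polynomial sign averaging is exact: odd and cross terms cancel, and each step a
    adds half of its square. *)
Lemma flips_quadratic l (c : R) x y :
  flips l (fun y => c + lin x y + quad x y y / 2) y =
  c + lin x y + quad x y y / 2 + (\sum_(a <- l) quad x a a) / 2.
Proof.
elim: l c => [|a l IH] c /=; first by rewrite big_nil mul0r addr0.
rewrite (_ : flip a _ = fun y => c + quad x a a / 2 + lin x y + quad x y y / 2).
  by rewrite IH big_cons; field.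
apply/funext => z; rewrite /flip -[- a]scaleN1r !linD !linZ.
rewrite !quadD !(quadC x _ (_ + _)) !quadD !quadZ.
by rewrite !(quadC x _ (_ *: _)) !quadZ (quadC x z a); field.
Qed.

Lemma flips_taylor l : exists2 K, 0 <= K &
  forall (d : R) x, 0 < d -> d <= 1 ->
  `|flips [seq d *: a | a <- l] F x - F x -
    d ^+ 2 / 2 * (\sum_(a <- l) quad x a a)| <= K * d ^+ 3 * F x.
Proof.
pose D := \sum_(a <- l) N a.
have D0 : 0 <= D by apply: sumr_ge0.
exists (C * D ^+ 3 * expR (lam * D)) => [|d x d0 d1].
  by rewrite !mulr_ge0 ?exprn_ge0 ?expR_ge0.
have Fx := ltW (loglip_gt0 x hF).
pose H y := F x + lin x y + quad x y y / 2.
have lin0 : lin x 0 = 0 by rewrite -(scale0r 0) linZ mul0r.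
have quad0 : quad x 0 0 = 0 by rewrite -(scale0r 0) quadZ mul0r.
have := @flips_local [seq d *: a | a <- l] F H
  (C * D ^+ 3 * expR (lam * D) * d ^+ 3 * F x) x 0 _.
have qs : \sum_(b <- [seq d *: a | a <- l]) quad x b b =
    d ^+ 2 * \sum_(a <- l) quad x a a.
  by rewrite big_map mulr_sumr; apply: eq_bigr => a _; rewrite quadZZ.
have Ns : \sum_(b <- [seq d *: a | a <- l]) N b = d * D.
  by rewrite big_map mulr_sumr; apply: eq_bigr => a _; rewrite NZ gtr0_norm.
rewrite addr0 flips_quadratic lin0 quad0 mul0r !addr0 qs Ns.
move=> h; rewrite -addrA -opprD [d ^+ 2 / 2 * _]mulrAC; apply: h => y.
rewrite subr0 => hy.
rewrite /H !opprD !addrA (le_trans (F_taylor x y)) //.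
rewrite [leRHS](_ : _ = C * ((d * D) ^+ 3 * expR (lam * D)) * F x); last by ring.
rewrite ler_wpM2r // -[C * _ * expR _]mulrA ler_wpM2l //.
rewrite ler_pM ?exprn_ge0 ?expR_ge0 //.
  by rewrite ler_pXn2r ?nnegrE // mulr_ge0 // ltW.
by rewrite ler_expR ler_wpM2l // (le_trans hy) // ler_piMl.
Qed.


(** The generator of the family A at F is half the sum of second differentials along l, with a
    remainder relative to F. *)
Definition second_order (l : seq V) (A : R -> (V -> R) -> V -> R) :=
  exists2 K, 0 <= K & forall (d : R) x, 0 < d -> d <= 1 ->
  `|A d F x - F x - d ^+ 2 / 2 * (\sum_(a <- l) quad x a a)| <= K * d ^+ 3 * F x.

Lemma second_order_bound l A : second_order l A ->
  exists2 K, 0 <= K & forall (d : R) x, 0 < d -> d <= 1 ->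
  A d F x <= (1 + K * d ^+ 2) * F x.
Proof.
case=> K K0 hK; pose D := \sum_(a <- l) C * N a ^+ 2.
have D0 : 0 <= D by apply: sumr_ge0 => a _; rewrite mulr_ge0 ?exprn_ge0.
exists (D + K) => [|d x d0 d1]; first by rewrite addr_ge0.
have Fx := loglip_gt0 x hF.
have qD : \sum_(a <- l) quad x a a <= D * F x.
  rewrite mulr_suml; apply: ler_sum => a _.
  exact: le_trans (ler_norm _) (quad_le x a).
have := hK d x d0 d1; rewrite ler_norml => /andP[_].
have d2 : 0 <= d ^+ 2 by rewrite sqr_ge0.
have d3 : d ^+ 3 <= d ^+ 2 by rewrite exprS ler_piMl.
have h1 := ler_wpM2l d2 qD.
have h2 := ler_wpM2r (ltW Fx) (ler_wpM2l K0 d3).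
have h3 : 0 <= d ^+ 2 * (D * F x) by rewrite !mulr_ge0 // ltW.
move: (A d F x) (F x) (\sum_(a <- l) _) h1 h2 h3.
by move: (d ^+ 3) => d3' u f q; move: (d ^+ 2) (D) => d2' e h1 h2 h3 h4; lra.
Qed.

Definition mesh n : R := (Num.sqrt n.+1%:R)^-1.

Lemma mesh_gt0 n : 0 < mesh n.
Proof. by rewrite invr_gt0 sqrtr_gt0 ltr0n. Qed.

Lemma mesh_le1 n : mesh n <= 1.
Proof.
rewrite -[leRHS]invr1 lef_pV2 ?posrE ?sqrtr_gt0 ?ltr0n //.
by rewrite -[leLHS]sqrtr1 ler_wsqrtr // ler1n.
Qed.

Lemma mesh_sqr n : mesh n ^+ 2 = n.+1%:R^-1.
Proof. by rewrite exprVn sqr_sqrtr. Qed.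

(** With d = [mesh n], each step errs by K d^3 and n+1 of them by K d, as (n+1) d^2 = 1. The growth
    factor (1 + M d^2)^(n+1) is at most e^M. *)
Lemma second_order_compare la lb A B :
  second_order la A -> second_order lb B ->
  (forall d, good_op (A d)) -> (forall d, good_op (B d)) ->
  (forall d, commuting (A d) (B d)) ->
  (forall x, \sum_(a <- la) quad x a a <= \sum_(b <- lb) quad x b b) ->
  exists2 K, 0 <= K & forall n x,
    iter n.+1 (A (mesh n)) F x <= iter n.+1 (B (mesh n)) F x + K * mesh n * F x.
Proof.
move=> soA soB gA gB AB qab.
have [Ka Ka0 hKa] := soA; have [Kb Kb0 hKb] := soB.
have [Ma Ma0 hMa] := second_order_bound soA.
have [Mb Mb0 hMb] := second_order_bound soB.
(* The [+ 1] makes the one-step error strictly positive, as [iter_compare] asks. *)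
pose K := Ka + Kb + 1; pose M := Ma + Mb.
have K0 : 0 < K by rewrite ltr_wpDl ?addr_ge0.
have M0 : 0 <= M by rewrite addr_ge0.
exists (K * expR M) => [|n x]; first by rewrite mulr_ge0 ?expR_ge0 ?ltW.
pose d := mesh n; have d0 := mesh_gt0 n; have d1 := mesh_le1 n.
have d2 := mesh_sqr n; rewrite -/d in d0 d1 d2 *.
have Fx y := loglip_gt0 y hF.
have e0 : 0 < K * d ^+ 3 by rewrite mulr_gt0 ?exprn_gt0.
have k1 : 1 <= 1 + M * d ^+ 2 by rewrite lerDl mulr_ge0 ?sqr_ge0.
have hA y : A d F y <= (1 + M * d ^+ 2) * F y.
  rewrite (le_trans (hMa d y d0 d1)) // (ler_pM2r (Fx y)) lerD2l ler_wpM2r ?sqr_ge0 //.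
  by rewrite lerDl.
have hB y : B d F y <= (1 + M * d ^+ 2) * F y.
  rewrite (le_trans (hMb d y d0 d1)) // (ler_pM2r (Fx y)) lerD2l ler_wpM2r ?sqr_ge0 //.
  by rewrite lerDr.
have hAB y : A d F y <= B d F y + K * d ^+ 3 * F y.
  have := hKa d y d0 d1; have := hKb d y d0 d1.
  rewrite !ler_norml => /andP[h1 _] /andP[_ h2].
  have h3 := ler_wpM2l (sqr_ge0 d) (qab y).
  have h4 : 0 <= d ^+ 3 * F y by rewrite mulr_ge0 ?exprn_ge0 ?ltW.
  rewrite /K; move: (A d F y) (B d F y) (F y) (\sum_(a <- la) _) (\sum_(a <- lb) _)
    h1 h2 h3 h4.
  by move: (d ^+ 3) (d ^+ 2) => d3' d2' u v f q r h1 h2 h3 h4; lra.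
apply: le_trans (iter_compare n (gA d) (gB d) (AB d) hF e0 k1 hA hB hAB x) _.
rewrite lerD2l (ler_pM2r (Fx x)).
rewrite [leLHS](_ : _ = (n.+1%:R * d ^+ 2) * (K * d) * (1 + M * d ^+ 2) ^+ n.+1);
  last by ring.
rewrite d2 divff ?pnatr_eq0 // mul1r [leRHS]mulrAC (ler_pM2l (mulr_gt0 K0 d0)).
apply: le_trans (_ : _ <= expR (M / n.+1%:R) ^+ n.+1) _.
  by rewrite ler_pXn2r ?nnegrE ?expR_ge0 ?expR_ge1Dx // addr_ge0 // divr_ge0.
by rewrite -expRM_natl mulrCA divff ?mulr1 // pnatr_eq0.
Qed.


Lemma gsmooth_iter_mesh a n x :
  iter n.+1 (gsmooth (mesh n *: a)) F x = gsmooth a F x.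
Proof.
have d0 := mesh_gt0 n.
suff h k : iter k.+1 (gsmooth (mesh n *: a)) F = gsmooth ((Num.sqrt k.+1%:R * mesh n) *: a) F.
  by rewrite h divff ?scale1r // gt_eqF // sqrtr_gt0 ltr0n.
elim: k => [|k IH]; first by rewrite sqrtr1 mul1r.
rewrite iterS IH; apply/funext => y.
have p j : 0 < Num.sqrt j.+1%:R * mesh n by rewrite mulr_gt0 // sqrtr_gt0 ltr0n.
apply: gsmooth_semigroup => //.
by rewrite !exprMn !sqr_sqrtr // -[k.+2%:R]natr1 mulrDl mul1r.
Qed.

Lemma gsmooth_const_bound a G x : loglip G ->
  gsmooth a G x <= 2 * expR ((lam * N a) ^+ 2 / 2) * G x.
Proof.
move=> hG; set c := lam * N a; have Gx := loglip_gt0 x hG.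
have ip := integrable_normal_exp c; have iN := integrable_normal_exp (- c).
have -> : 2 * expR (c ^+ 2 / 2) * G x =
    gaussE (fun s => G x * (expR (c * s) + expR (- c * s))).
  rewrite gaussEZ ?gaussED ?gaussE_exp ?sqrrN //; first by ring.
  exact: integrable_normalD.
apply: gaussE_le; first exact: integrable_loglip_line.
  by apply: integrable_normalZ; exact: integrable_normalD.
move=> s; rewrite (le_trans (loglip_le _ _ hG)) // mulrC ler_pM2l // NZ.
rewrite mulrCA mulrC -/c; have [s0|s0] := leP 0 s.
  by rewrite ger0_norm // lerDl expR_ge0.
by rewrite ltr0_norm // mulrN mulNr lerDr expR_ge0.
Qed.

Lemma gsmooths_const_bound l : exists2 K, 0 < K &
  forall G x, loglip G -> gsmooths l G x <= K * G x.
Proof.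
elim: l => [|a l [K K0 IH]]; first by exists 1 => // G x _; rewrite mul1r.
exists (K * (2 * expR ((lam * N a) ^+ 2 / 2))) => [|G x hG /=].
  by rewrite !mulr_gt0 ?expR_gt0.
rewrite (le_trans (IH _ _ (loglip_gsmooth a hG))) // -mulrA ler_pM2l //.
exact: gsmooth_const_bound.
Qed.

Lemma second_order_gsmooth a : second_order [:: a] (fun d => gsmooth (d *: a)).
Proof.
by have [K K0 h] := gsmooth_taylor a; exists K => // d x d0 d1; rewrite big_seq1 h.
Qed.

Lemma second_order_flips l : second_order l (fun d => flips [seq d *: a | a <- l]).
Proof. exact: flips_taylor. Qed.

(** A central limit theorem with rate: smoothing and sign averaging along a have the same
    second-order term, so each bounds the other. *)
Lemma gsmooth_flip_limit a : exists2 K, 0 <= K & forall n x,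
  gsmooth a F x <= iter n.+1 (flip (mesh n *: a)) F x + K * mesh n * F x /\
  iter n.+1 (flip (mesh n *: a)) F x <= gsmooth a F x + K * mesh n * F x.
Proof.
have cgf (d : R) : commuting (gsmooth (d *: a)) (flips [seq d *: a | a <- [:: a]]).
  exact: (commuting_gsmooths_flip (d *: a) [:: d *: a]).
have gg (d : R) := good_op_gsmooth (d *: a).
have gf (d : R) := good_op_flips [seq d *: a | a <- [:: a]].
have [K1 K10 h1] := second_order_compare (second_order_gsmooth a)
  (second_order_flips [:: a]) gg gf cgf (fun x => lexx _).
have [K2 K20 h2] := second_order_compare (second_order_flips [:: a])
  (second_order_gsmooth a) gf gg (fun d => commuting_sym (cgf d)) (fun x => lexx _).
exists (K1 + K2) => [|n x]; first by rewrite addr_ge0.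
have p : 0 <= mesh n * F x by rewrite ltW // mulr_gt0 ?mesh_gt0 ?(loglip_gt0 x hF).
have := h1 n x; have := h2 n x; rewrite gsmooth_iter_mesh => H2 H1.
split; [apply: le_trans H1 _|apply: le_trans H2 _];
  by rewrite lerD2l -!mulrA ler_wpM2r // ?lerDl ?lerDr.
Qed.

(** Induction on the directions. The error of replacing a passes through [gsmooths l], at the cost
    of a factor c; the error of replacing l passes through the sign averages along a, at the cost of
    ca + K. *)
Lemma gsmooths_flips_limit l : exists2 K, 0 <= K & forall n x,
  gsmooths l F x <=
    iter n.+1 (flips [seq mesh n *: a | a <- l]) F x + K * mesh n * F x /\
  iter n.+1 (flips [seq mesh n *: a | a <- l]) F x <=
    gsmooths l F x + K * mesh n * F x.
Proof.
elim: l => [|a l [K' K'0 IH]].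
  exists 0 => // n x; rewrite !mul0r !addr0.
  have -> : forall k, iter k (flips [seq mesh n *: a | a <- [::]]) F = F.
    by elim=> [//|k /= ->].
  by [].
have [K0 K00 h0] := gsmooth_flip_limit a.
have [c c0 hc] := gsmooths_const_bound l.
pose K := K0 + 1; pose M := K' + 1.
have Kp : 0 < K by rewrite ltr_wpDl.
have Mp : 0 < M by rewrite ltr_wpDl.
pose ca := 2 * expR ((lam * N a) ^+ 2 / 2).
have ca0 : 0 < ca by rewrite mulr_gt0 ?expR_gt0.
exists (K * c + M * (ca + K)) => [|n x].
  by rewrite addr_ge0 // mulr_ge0 ?addr_ge0 ?(ltW Kp) ?(ltW Mp) ?(ltW c0) ?(ltW ca0).
have m0 := mesh_gt0 n; set m := mesh n in m0 *.
set l' := [seq m *: b | b <- l].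
have gA := good_op_iter n.+1 (good_op_flip (m *: a)).
have gB := good_op_iter n.+1 (good_op_flips l').
have gl := good_op_gsmooths l.
set A := iter n.+1 (flip (m *: a)) in gA *; set B := iter n.+1 (flips l') in gB *.
have [A1 A2 A3] := gA; have [B1 B2 B3] := gB; have [S1 S2 S3] := gl.
have AS : A (gsmooths l F) = gsmooths l (A F).
  apply: (commuting_iter n.+1 (good_op_flip _) gl) => //.
  exact/commuting_sym/commuting_gsmooths_flip.
have AB : A (B F) = B (A F).
  apply: (commuting_iter n.+1 (good_op_flip _) gB) => //.
  apply: commuting_sym; apply: commuting_iter (good_op_flips _) (good_op_flip _) _.
  exact/commuting_sym/commuting_flips.
have -> : iter n.+1 (flips [seq m *: b | b <- a :: l]) F = B (A F).
  apply: (iter_comp_commuting n.+1 (good_op_flips l') (good_op_flip (m *: a))) => //.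
  exact/commuting_sym/commuting_flips.
rewrite [gsmooths (a :: l) F]/(gsmooths l (gsmooth a F)).
have Fp y := loglip_gt0 y hF.
have km0 : 0 < K * m by rewrite mulr_gt0.
have mm0 : 0 < M * m by rewrite mulr_gt0.
have hG := loglip_gsmooth a hF.
have u1 y : gsmooth a F y <= A F y + K * m * F y.
  have [h _] := h0 n y; rewrite (le_trans h) // lerD2l ler_pM2r // ler_pM2r //.
  by rewrite lerDl.
have u2 y : A F y <= gsmooth a F y + K * m * F y.
  have [_ h] := h0 n y; rewrite (le_trans h) // lerD2l ler_pM2r // ler_pM2r //.
  by rewrite lerDl.
have v1 y : gsmooths l F y <= B F y + M * m * F y.
  have [h _] := IH n y; rewrite (le_trans h) // lerD2l ler_pM2r // ler_pM2r //.
  by rewrite lerDl.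
have v2 y : B F y <= gsmooths l F y + M * m * F y.
  have [_ h] := IH n y; rewrite (le_trans h) // lerD2l ler_pM2r // ler_pM2r //.
  by rewrite lerDl.
have AFb y : A F y <= (ca + K) * F y.
  rewrite (le_trans (u2 y)) // [(ca + K) * _]mulrDl.
  apply: lerD; first exact: gsmooth_const_bound.
  rewrite ler_pM2r //.
  by rewrite ler_piMr ?(ltW Kp) // mesh_le1.
have hE : K * m * (c * F x) + M * m * ((ca + K) * F x) =
    (K * c + M * (ca + K)) * m * F x by ring.
split.
  have := S2 _ _ hG (loglipD (A1 _ hF) (loglipZ km0 hF)) u1 x.
  rewrite (S3 _ _ _ (A1 _ hF) hF km0) -AS => /le_trans; apply.
  have := A2 _ _ (S1 _ hF) (loglipD (B1 _ hF) (loglipZ mm0 hF)) v1 x.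
  rewrite (A3 _ _ _ (B1 _ hF) hF mm0) AB -hE => h.
  rewrite (le_trans (lerD h (lexx _))) // -addrA lerD2l addrC.
  by rewrite lerD // ler_pM2l // ?hc.
have := A2 _ _ (B1 _ hF) (loglipD (S1 _ hF) (loglipZ mm0 hF)) v2 x.
rewrite (A3 _ _ _ (S1 _ hF) hF mm0) AB AS => /le_trans; apply.
have := S2 _ _ (A1 _ hF) (loglipD hG (loglipZ km0 hF)) u2 x.
rewrite (S3 _ _ _ hG hF km0) -hE => h.
rewrite (le_trans (lerD h (lexx _))) // -addrA lerD2l.
by rewrite lerD // ler_pM2l // ?hc.
Qed.

Lemma le_of_mesh (a b c : R) : 0 <= c ->
  (forall n, a <= b + c * mesh n) -> a <= b.
Proof.
move=> c0 h; apply: (le_of_le_eps c0) => e e0 e1.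
pose n := Num.truncn (e ^- 2); rewrite (le_trans (h n)) // lerD2l mulrC.
rewrite ler_wpM2r // -(ler_pXn2r (n := 2)) ?nnegrE ?(ltW e0) ?(ltW (mesh_gt0 n)) //.
rewrite mesh_sqr -[leRHS]invrK lef_pV2 ?posrE ?invr_gt0 ?exprn_gt0 ?ltr0n //.
exact/ltW/truncnS_gt.
Qed.

(* Lindeberg replacement: both sides are limits of products of two-point
   averages, whose second-order terms are compared by the hypothesis. *)
Theorem gsmooths_comparison la lb :
  (forall x, \sum_(a <- la) quad x a a <= \sum_(b <- lb) quad x b b) ->
  forall x, gsmooths la F x <= gsmooths lb F x.
Proof.
move=> qab x.
have [K K0 h] := second_order_compare (second_order_flips la) (second_order_flips lb)
  (fun d => good_op_flips _) (fun d => good_op_flips _)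
  (fun d => @commuting_flipss _ _) qab.
have [Ka Ka0 ha] := gsmooths_flips_limit la.
have [Kb Kb0 hb] := gsmooths_flips_limit lb.
have Fx := ltW (loglip_gt0 x hF).
apply: (@le_of_mesh _ _ ((K + Ka + Kb) * F x)).
  by rewrite mulr_ge0 ?addr_ge0.
move=> n; have [h1 _] := ha n x; have [_ h2] := hb n x; have h3 := h n x.
rewrite (le_trans h1) // (le_trans (lerD h3 (lexx _))) //.
rewrite (le_trans (lerD (lerD h2 (lexx _)) (lexx _))) //.
by rewrite le_eqVlt; apply/orP; left; apply/eqP; ring.
Qed.

End Smoothing.

(** * The soft maximum *)

Section SoftMax.
Variables (R : realType) (k : nat) (p beta : R).
Hypotheses (p0 : 0 <= p) (p1 : p <= 1) (beta0 : 0 <= beta).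
Implicit Types (x y z : 'rV[R]_k.+1).

Definition norm1 x := \sum_i `|x 0 i|.

Lemma norm1_ge0 x : 0 <= norm1 x.
Proof. exact: sumr_ge0. Qed.

Lemma norm1Z a x : norm1 (a *: x) = `|a| * norm1 x.
Proof. by rewrite mulr_sumr; apply: eq_bigr => i _; rewrite mxE normrM. Qed.

Lemma norm1D x y : norm1 (x + y) <= norm1 x + norm1 y.
Proof.
by rewrite -big_split; apply: ler_sum => i _; rewrite mxE ler_normD.
Qed.

Lemma coord_le_norm1 x i : `|x 0 i| <= norm1 x.
Proof. by rewrite /norm1 (bigD1 i) //= lerDl sumr_ge0. Qed.

Definition expsum x := \sum_i expR (beta * x 0 i).

Lemma expsum_gt0 x : 0 < expsum x.
Proof.
by rewrite /expsum big_ord_recl ltr_pwDl ?expR_gt0 // sumr_ge0 // => i _;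
  rewrite expR_ge0.
Qed.

Definition softmax x := expR (p * ln (expsum x)).

Lemma loglip_softmax : loglip norm1 (p * beta) softmax.
Proof.
move=> x d; split; first exact: expR_gt0.
rewrite -expRD ler_expR -mulrA -mulrDr ler_wpM2l //.
rewrite -[beta * norm1 d]expRK -lnM ?posrE ?expR_gt0 ?expsum_gt0 //.
rewrite ler_ln ?posrE ?mulr_gt0 ?expR_gt0 ?expsum_gt0 //.
rewrite mulr_sumr; apply: ler_sum => i _; rewrite mxE mulrDr expRD mulrC.
rewrite ler_pM2r ?expR_gt0 // ler_expR ler_wpM2l //.
exact: le_trans (ler_norm _) (coord_le_norm1 d i).
Qed.

(** Gibbs weights: beta times them is the gradient of the logarithm of [expsum]. *)
Definition weight x i := expR (beta * x 0 i) / expsum x.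
Definition wmean x y := \sum_i weight x i * y 0 i.

Definition softmax_lin x y := softmax x * (p * beta) * wmean x y.
Definition softmax_quad x y z := softmax x * beta ^+ 2 *
  (p * (\sum_i weight x i * (y 0 i * z 0 i)) - p * (1 - p) * (wmean x y * wmean x z)).

Lemma wmeanZ x a y : wmean x (a *: y) = a * wmean x y.
Proof. by rewrite mulr_sumr; apply: eq_bigr => i _; rewrite mxE mulrCA. Qed.

Lemma wmeanD x y z : wmean x (y + z) = wmean x y + wmean x z.
Proof. by rewrite -big_split; apply: eq_bigr => i _; rewrite mxE mulrDr. Qed.

Lemma softmax_linZ x a y : softmax_lin x (a *: y) = a * softmax_lin x y.
Proof. by rewrite /softmax_lin wmeanZ; ring. Qed.

Lemma softmax_linD x y z : softmax_lin x (y + z) = softmax_lin x y + softmax_lin x z.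
Proof. by rewrite /softmax_lin wmeanD; ring. Qed.

Lemma softmax_quadZ x a y z : softmax_quad x (a *: y) z = a * softmax_quad x y z.
Proof.
rewrite /softmax_quad wmeanZ.
rewrite [X in p * X](_ : _ = a * \sum_i weight x i * (y 0 i * z 0 i)); first by ring.
by rewrite mulr_sumr; apply: eq_bigr => i _; rewrite mxE; ring.
Qed.

Lemma softmax_quadD x y z w :
  softmax_quad x (y + z) w = softmax_quad x y w + softmax_quad x z w.
Proof.
rewrite /softmax_quad wmeanD.
rewrite [X in p * X](_ : _ = \sum_i weight x i * (y 0 i * w 0 i) +
  \sum_i weight x i * (z 0 i * w 0 i)); first by ring.
by rewrite -big_split /=; apply: eq_bigr => i _; rewrite mxE; ring.
Qed.

Lemma softmax_quadC x y z : softmax_quad x y z = softmax_quad x z y.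
Proof.
rewrite /softmax_quad (mulrC (wmean x y)); congr (_ * (p * _ - _)).
by apply: eq_bigr => i _; rewrite (mulrC (y 0 i)).
Qed.

(* [moment j x y s / expsum (x + s *: y)] is the [j]-th moment of [beta * y]
   under the Gibbs weights at [x + s *: y]. *)
Definition moment j x y s := \sum_i (beta * y 0 i) ^+ j * expR (beta * (x + s *: y) 0 i).

Lemma is_derive_moment j x y (s : R) :
  is_derive s 1 (moment j x y) (moment j.+1 x y s).
Proof.
have -> : moment j x y = \sum_(i < k.+1)
    (fun s : R => (beta * y 0 i) ^+ j * expR (beta * (x 0 i + s * y 0 i))).
  by apply/funext => t; rewrite fct_sumE; apply: eq_bigr => i _; rewrite !mxE.
apply: is_derive_sum => i.
apply: is_derive_eq; rewrite !mxE /GRing.scale /= exprS; ring.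
Qed.

Definition ratio j x y s := moment j x y s / moment 0 x y s.

Lemma moment0 x y s : moment 0 x y s = expsum (x + s *: y).
Proof. by apply: eq_bigr => i _; rewrite expr0 mul1r. Qed.

(** The derivative of a Gibbs mean along y is its covariance with beta y. *)
Lemma is_derive_ratio j x y (s : R) : is_derive s 1 (ratio j x y)
  (ratio j.+1 x y s - ratio j x y s * ratio 1 x y s).
Proof.
have m0 : moment 0 x y s != 0 by rewrite moment0 gt_eqF ?expsum_gt0.
have d1 := is_derive_moment j x y s.
have d2 := is_deriveV m0 (is_derive_moment 0 x y s).
apply: (is_derive_eq (f := ratio j x y) (is_deriveM d1 d2)).
by rewrite /GRing.scale /= /ratio; field.
Qed.

Definition softline x y s := softmax (x + s *: y).

Lemma is_derive_softline x y (s : R) :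
  is_derive s 1 (softline x y) (p * ratio 1 x y s * softline x y s).
Proof.
have -> : softline x y = expR \o (fun s => p * ln (moment 0 x y s)).
  by apply/funext => t; rewrite /softline /softmax /= moment0.
have m0 : 0 < moment 0 x y s by rewrite moment0 expsum_gt0.
have d1 := is_derive1_comp (is_derive1_ln m0) (is_derive_moment 0 x y s).
have d2 : is_derive s 1 (fun s => p * ln (moment 0 x y s)) (p * ratio 1 x y s).
  apply: (is_derive_eq (f := fun s => p * ln (moment 0 x y s)) (is_deriveZ p d1)).
  by rewrite /ratio /GRing.scale /= (mulrC (moment 1 x y s)).
pose g s := p * ln (moment 0 x y s).
apply: (is_derive_eq (is_derive1_comp (g := g) (is_derive_expR (g s)) d2)).
by rewrite mulrC.
Qed.

Lemma ratio_le j x y s : `|ratio j x y s| <= (beta * norm1 y) ^+ j.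
Proof.
have m0 : 0 < moment 0 x y s by rewrite moment0 expsum_gt0.
rewrite normrM normfV (gtr0_norm m0) ler_pdivrMr // moment0 /expsum mulr_sumr.
rewrite (le_trans (ler_norm_sum _ _ _)) //; apply: ler_sum => i _.
rewrite normrM (gtr0_norm (expR_gt0 _)) ler_pM2r ?expR_gt0 // normrX.
rewrite lerXn2r ?nnegrE ?mulr_ge0 ?norm1_ge0 // normrM ger0_norm //.
by rewrite ler_wpM2l // coord_le_norm1.
Qed.

Lemma ratio_wmean x y : ratio 1 x y 0 = beta * wmean x y.
Proof.
rewrite /ratio moment0 scale0r addr0 /moment mulr_suml mulr_sumr.
by apply: eq_bigr => i _; rewrite scale0r addr0 /weight expr1; ring.
Qed.

Lemma ratio2 x y : ratio 2 x y 0 = beta ^+ 2 * \sum_i weight x i * (y 0 i * y 0 i).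
Proof.
rewrite /ratio moment0 scale0r addr0 /moment mulr_suml mulr_sumr.
by apply: eq_bigr => i _; rewrite scale0r addr0 /weight; ring.
Qed.

Lemma softmax_quad_ratio x y : softmax_quad x y y =
  (p * ratio 2 x y 0 - p * (1 - p) * ratio 1 x y 0 ^+ 2) * softmax x.
Proof. by rewrite ratio_wmean ratio2 /softmax_quad; ring. Qed.

(** One constant for two bounds: 2 beta^2 serves the second differential, and 13 beta^3 amply covers
    the third, whose coefficients add up to at most 6. *)
Definition softmax_const := 13 * beta ^+ 3 + 2 * beta ^+ 2.

Lemma softmax_quad_le x y :
  `|softmax_quad x y y| <= softmax_const * norm1 y ^+ 2 * softmax x.
Proof.
rewrite softmax_quad_ratio normrM (gtr0_norm (expR_gt0 _)) ler_pM2r ?expR_gt0 //.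
have h1 := ratio_le 1 x y 0; have h2 := ratio_le 2 x y 0.
rewrite (le_trans (ler_normB _ _)) // (normrM p) (normrM (p * _)) (normrM p).
rewrite (ger0_norm p0) [`|1 - p|]ger0_norm ?subr_ge0 //.
have B0 : 0 <= beta ^+ 3 * norm1 y ^+ 2 by rewrite mulr_ge0 ?exprn_ge0 // norm1_ge0.
have pp : p * (1 - p) <= 1.
  by rewrite -[leRHS]mulr1 ler_pM ?subr_ge0 // lerBlDr lerDl.
rewrite expr1 in h1.
have h3 : `|ratio 1 x y 0 ^+ 2| <= (beta * norm1 y) ^+ 2.
  by rewrite normrX ler_pXn2r ?nnegrE ?mulr_ge0 ?norm1_ge0.
have h4 : p * `|ratio 2 x y 0| <= (beta * norm1 y) ^+ 2.
  by rewrite -[leRHS]mul1r ler_pM.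
have h5 : p * (1 - p) * `|ratio 1 x y 0 ^+ 2| <= (beta * norm1 y) ^+ 2.
  by rewrite -[leRHS]mul1r ler_pM ?mulr_ge0 ?subr_ge0.
rewrite (le_trans (lerD h4 h5)) // /softmax_const exprMn mulrDl.
rewrite -[leLHS]add0r [X in _ + X <= _](_ : _ = 2 * beta ^+ 2 * norm1 y ^+ 2); last by ring.
by rewrite lerD2r -mulrA mulr_ge0.
Qed.

(** One-variable Taylor along s -> x + s y: each derivative is a polynomial in the Gibbs moments
    times the soft maximum, the moments being bounded by powers of beta times the norm of y. *)
Lemma softmax_taylor x y :
  `|softmax (x + y) - softmax x - softmax_lin x y - softmax_quad x y y / 2| <=
  softmax_const * norm1 y ^+ 3 * expR (p * beta * norm1 y) * softmax x.
Proof.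
pose r j s := ratio j x y s; pose f s := softline x y s.
pose f1 s := p * r 1%N s * f s.
pose f2 s := (p * r 2%N s - p * (1 - p) * r 1%N s ^+ 2) * f s.
pose f3 s := (p * r 3%N s - 3 * p * (1 - p) * (r 1%N s * r 2%N s)
  + p * (1 - p) * (2 - p) * r 1%N s ^+ 3) * f s.
have df (s : R) : is_derive s 1 f (f1 s) by exact: is_derive_softline.
have dr j (s : R) : is_derive s 1 (r j) (r j.+1 s - r j s * r 1%N s).
  exact: is_derive_ratio.
have df1 (s : R) : is_derive s 1 f1 (f2 s).
  rewrite /f1; apply: is_derive_eq; rewrite /GRing.scale /= /f2 /f1; ring.
have df2 (s : R) : is_derive s 1 f2 (f3 s).
  rewrite /f2; apply: is_derive_eq; rewrite /GRing.scale /= /f3 /f1; ring.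
pose B := beta * norm1 y.
have B0 : 0 <= B by rewrite mulr_ge0 ?norm1_ge0.
have E s : 0 <= s <= 1 -> `|f3 s| <= 13 * B ^+ 3 * (expR (p * beta * norm1 y) * softmax x).
  move=> /andP[s0 s1]; rewrite normrM; apply: ler_pM => //.
    have h1 := ratio_le 1 x y s; have h2 := ratio_le 2 x y s.
    have h3 := ratio_le 3 x y s; rewrite -/(r 1%N s) -/(r 2%N s) -/(r 3%N s) -/B in h1 h2 h3.
    rewrite expr1 in h1.
    have q0 : 0 <= 1 - p by rewrite subr_ge0.
    have q1 : 1 - p <= 1 by rewrite lerBlDr lerDl.
    have pq1 : p * (1 - p) <= 1 by rewrite -[leRHS]mulr1 ler_pM.
    have t1 : `|p * r 3%N s| <= B ^+ 3.
      by rewrite normrM (ger0_norm p0) -[leRHS]mul1r ler_pM.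
    have t2 : `|3 * p * (1 - p) * (r 1%N s * r 2%N s)| <= 3 * B ^+ 3.
      rewrite -(mulrA 3) normrM ger0_norm ?mulr_ge0 //.
      rewrite -mulrA ler_wpM2l // -[leRHS]mul1r ler_pM ?mulr_ge0 //.
      by rewrite normrM exprS ler_pM.
    have t3 : `|p * (1 - p) * (2 - p) * r 1%N s ^+ 3| <= 2 * B ^+ 3.
      have q2 : 0 <= 2 - p by rewrite subr_ge0 (le_trans p1) // ler1n.
      rewrite normrM normrX ger0_norm ?mulr_ge0 // ler_pM ?mulr_ge0 ?exprn_ge0 //.
        by rewrite -[leRHS]mul1r ler_pM ?mulr_ge0 // lerBlDr lerDl.
      by rewrite ler_pXn2r ?nnegrE.
    rewrite (le_trans (ler_normD _ _)) // (le_trans (lerD (ler_normB _ _) (lexx _))) //.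
    rewrite (le_trans (lerD (lerD t1 t2) t3)) //.
    have := exprn_ge0 3 B0; move: (B ^+ 3) => b b0; lra.
  rewrite (gtr0_norm (expR_gt0 _)).
  have [_ h] := loglip_softmax x (s *: y).
  rewrite (le_trans h) // ler_pM2r ?expR_gt0 // ler_expR norm1Z (ger0_norm s0).
  rewrite ler_wpM2l ?mulr_ge0 // ler_piMl ?norm1_ge0 //.
have := taylor3 df df1 df2 E.
have f0 : f 0 = softmax x by rewrite /f /softline scale0r addr0.
have f10 : f1 0 = softmax_lin x y.
  by rewrite /f1 f0 /r ratio_wmean /softmax_lin; ring.
have f20 : f2 0 = softmax_quad x y y by rewrite /f2 f0 softmax_quad_ratio.
rewrite f0 f10 f20 /f /softline scale1r => /le_trans; apply.
rewrite (mulrA (13 * B ^+ 3)).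
rewrite (ler_pM2r (expR_gt0 (p * ln (expsum x)))) (ler_pM2r (expR_gt0 _)).
rewrite /B exprMn mulrA; apply: ler_wpM2r; first exact/exprn_ge0/norm1_ge0.
by rewrite lerDl mulr_ge0 ?exprn_ge0.
Qed.

Lemma softmax_const_ge0 : 0 <= softmax_const.
Proof. by rewrite addr_ge0 ?mulr_ge0 ?exprn_ge0. Qed.

End SoftMax.

(** * Slepian's inequality for the soft maximum *)

Section Slepian.
Variables (R : realType) (k : nat) (p beta : R).
Hypotheses (p0 : 0 <= p) (p1 : p <= 1) (beta0 : 0 <= beta).
Implicit Types (x : 'rV[R]_k.+1) (l : seq 'rV[R]_k.+1).

Definition covar l i j := \sum_(a <- l) a 0 i * a 0 j.

Lemma sum_softmax_quad l x : \sum_(a <- l) softmax_quad p beta x a a =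
  softmax p beta x * beta ^+ 2 *
  (p * (\sum_i weight beta x i * covar l i i) - p * (1 - p) *
    (\sum_i \sum_j weight beta x i * weight beta x j * covar l i j)).
Proof.
rewrite -mulr_sumr big_split /= sumrN -!mulr_sumr; congr (_ * (_ * _ - _ * _)).
  rewrite exchange_big /=; apply: eq_bigr => i _.
  by rewrite /covar mulr_sumr; apply: eq_bigr.
transitivity (\sum_(a <- l) \sum_i \sum_j
    (weight beta x i * a 0 i) * (weight beta x j * a 0 j)).
  apply: eq_bigr => a _; rewrite {1}/wmean mulr_suml; apply: eq_bigr => i _.
  by rewrite /wmean mulr_sumr.
rewrite exchange_big /=; apply: eq_bigr => i _.
rewrite exchange_big /=; apply: eq_bigr => j _.
by rewrite /covar mulr_sumr; apply: eq_bigr => a _; rewrite mulrACA.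
Qed.

Lemma weight_ge0 x i : 0 <= weight beta x i.
Proof. by rewrite divr_ge0 ?expR_ge0 // ltW // expsum_gt0. Qed.

(** With equal variances only the covariances remain in the second-order terms, weighted by -p(1-p)
    w_i w_j <= 0. Smaller covariances therefore give a larger mean. *)
Lemma softmax_slepian la lb x :
  (forall i, covar la i i = covar lb i i) ->
  (forall i j, covar lb i j <= covar la i j) ->
  gsmooths la (softmax p beta) x <= gsmooths lb (softmax p beta) x.
Proof.
move=> hd hij.
apply: (gsmooths_comparison (norm1_ge0 (R := R) (k := k)) (@norm1Z _ _) _
  (@norm1D _ _) (loglip_softmax p0 beta0) (softmax_const_ge0 beta0)
  (softmax_linZ p beta) (softmax_linD p beta) (@softmax_quadZ _ _ p beta)
  (softmax_quadD p beta) (softmax_quadC p beta)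
  (softmax_quad_le p0 p1 beta0) (softmax_taylor p0 p1 beta0)) => [|y].
  exact: mulr_ge0.
rewrite !sum_softmax_quad ler_wpM2l ?mulr_ge0 ?sqr_ge0 ?expR_ge0 //.
have -> : \sum_i weight beta y i * covar la i i = \sum_i weight beta y i * covar lb i i.
  by apply: eq_bigr => i _; rewrite hd.
rewrite lerD2l lerN2 ler_wpM2l ?mulr_ge0 ?subr_ge0 //.
apply: ler_sum => i _; apply: ler_sum => j _.
by apply: ler_wpM2l => //; exact: mulr_ge0 (weight_ge0 _ _) (weight_ge0 _ _).
Qed.

End Slepian.

(** * Independence *)

(* The reals carry two measurable structures with the same sets but different
   displays: the one of [{RV P >-> R}] and the one of [normal_prob]. *)
Lemma integral_law (R : realType) (mu : {measure set R -> \bar R})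
    (P : probability (g_sigma_algebraType R.-ocitv.-measurable) R) (f : R -> R) :
  (forall B, measurable B -> mu B = P B) -> continuous f -> (forall x, 0 <= f x) ->
  (\int[mu]_x (f x)%:E = \int[P]_x (f x)%:E)%E.
Proof.
move=> muP cf f0; pose gR := g_sigma_algebraType R.-ocitv.-measurable.
have mid : measurable_fun setT (id : gR -> R) by move=> _ B mB; rewrite setTI.
pose m : {measure set R -> \bar R} := pushforward P (id : gR -> R).
transitivity (\int[m mid]_x (f x)%:E)%E.
  by apply: eq_measure_integral => A mA _; rewrite muP.
rewrite ge0_integral_pushforward ?preimage_setT //.
  by apply/measurable_EFinP; exact: continuous_measurable_fun.
by move=> y _; rewrite lee_fin.
Qed.

Section Independence.
Variables (R : realType) (d : measure_display) (T : measurableType d).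
Variable P : probability T R.
Local Open Scope ereal_scope.

Lemma ge0_integral_indep d1 d2 (T1 : measurableType d1) (T2 : measurableType d2)
    (Y : {mfun T >-> T1}) (W : {mfun T >-> T2}) (f : T1 * T2 -> \bar R) :
  (forall A B, measurable A -> measurable B ->
    P (Y @^-1` A `&` W @^-1` B) = P (Y @^-1` A) * P (W @^-1` B)) ->
  measurable_fun setT f -> (forall z, 0 <= f z) ->
  \int[P]_w f (Y w, W w) = \int[P]_w \int[distribution P Y]_y f (y, W w).
Proof.
move=> ind mf f0.
pose YW w := (Y w, W w).
have mYW : measurable_fun setT YW by apply: measurable_fun_pair.
pose YW' : {mfun T >-> (T1 * T2)%type} :=
  HB.pack YW (isMeasurableFun.Build _ _ _ _ YW mYW).
transitivity (\int[distribution P YW']_z f z).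
  by rewrite ge0_integral_distribution.
transitivity (\int[distribution P Y \x distribution P W]_z f z).
  apply: eq_measure_integral => A mA _; apply/esym.
  by apply: product_measure_unique => // B C mB mC; exact: ind.
rewrite fubini_tonelli2 //.
rewrite ge0_integral_distribution //; last first.
  by move=> y; exact: integral_ge0.
exact: measurable_fun_fubini_tonelli_G.
Qed.

Variables (I : finType) (E : I -> {RV P >-> R}).
Hypothesis E_indep : mutually_independent E.

(* T equipped with the sigma-algebra generated by these sets stands for the
   joint range of the E i, i in J. *)
Definition boxes (J : {set I}) : set (set T) :=
  [set A | exists2 B : I -> set R, forall i, measurable (B i) &
    A = \bigcap_(i in [set` J]) (E i @^-1` B i)].

Lemma boxes_setI J : setI_closed (boxes J).
Proof.
move=> _ _ [B mB ->] [C mC ->]; exists (fun i => B i `&` C i).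
  by move=> i; exact: measurableI.
by apply/seteqP; split => w /= => [[h1 h2] i /[dup] /h1 ? /h2 ?|h]; split => // i /h[].
Qed.

Lemma measurable_boxes J A : boxes J A -> measurable A.
Proof.
move=> [B mB ->]; apply: fin_bigcap_measurable => // i _.
by rewrite -[X in measurable X]setTI; exact: measurable_funPT.
Qed.

Lemma boxes_setT J : boxes J setT.
Proof.
by exists (fun=> setT) => //; apply/seteqP; split.
Qed.

Lemma measurable_sigma_boxes J A : <<s boxes J >> A -> measurable A.
Proof.
apply: smallest_sub; first exact: sigma_algebra_measurable.
by move=> B; exact: measurable_boxes.
Qed.

Lemma sigma_boxes_coord (J : {set I}) i : i \in J ->
  measurable_fun setT (E i : g_sigma_algebraType (boxes J) -> R).
Proof.
move=> iJ _ B mB; rewrite setTI; apply: sub_sigma_algebra.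
exists (fun j => if j == i then B else setT) => [j|]; first by case: ifP.
apply/seteqP; split => w /= => [h j jJ|/(_ i iJ)]; last by rewrite eqxx.
by case: eqP => [->|].
Qed.

(** Two finite measures, the trace of P on the event of i0 and a multiple of P, agree on the boxes.
    These are stable under intersection, so they agree on the generated sigma-algebra. *)
Lemma indep_sigma_boxes (J : {set I}) i0 A B : i0 \notin J -> measurable A ->
  <<s boxes J >> B -> P (E i0 @^-1` A `&` B) = P (E i0 @^-1` A) * P B.
Proof.
move=> i0J mA sB.
have mEA : measurable (E i0 @^-1` A).
  by rewrite -[X in measurable X]setTI; exact: measurable_funPT.
pose gT := g_sigma_algebraType (boxes J).
have mid : measurable_fun setT (id : T -> gT).
  by move=> _ C mC; rewrite setTI; exact: measurable_sigma_boxes mC.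
pose m1 : {measure set gT -> \bar R} := pushforward (mrestr P mEA) (id : T -> gT).
have a0 : (0 <= fine (P (E i0 @^-1` A)))%R by rewrite fine_ge0.
pose m2 : {measure set gT -> \bar R} :=
  mscale (NngNum a0) (pushforward P (id : T -> gT)).
have Pfin : P (E i0 @^-1` A) \is a fin_num by exact: fin_num_measure.
have m1E C : m1 mid C = P (C `&` E i0 @^-1` A) by [].
have m2E C : m2 mid C = P (E i0 @^-1` A) * P C.
  by rewrite /m2 /= /mscale /pushforward /= fineK.
transitivity (m1 mid B); first by rewrite setIC.
transitivity (m2 mid B); last exact: m2E.
apply: (@measure_unique _ R gT (boxes J) (fun=> setT) erefl (@boxes_setI J)
  (fun=> @boxes_setT J) _ (m1 mid) (m2 mid) _ _ B sB).
- by rewrite bigcup_const.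
- move=> C [D mD ->]; rewrite m1E m2E.
  (* Placing A at index i0 turns the claim for one box into independence over i0 and J together. *)
  pose D' i := if i == i0 then A else D i.
  have mD' i : measurable (D' i) by rewrite /D'; case: ifP.
  have := E_indep (i0 |: J) mD'; rewrite big_setU1 //= {2}/D' eqxx.
  have -> : \bigcap_(i in [set` i0 |: J]) (E i @^-1` D' i) =
      \bigcap_(i in [set` J]) (E i @^-1` D i) `&` E i0 @^-1` A.
    apply/seteqP; split => w /= => [h|[h1 h2] i]; last first.
      by rewrite /= in_setU1 /D'; case: eqP => [->|_ /= /h1].
    split => [i iJ|]; last by have := h i0; rewrite /= /D' in_setU1 eqxx; apply.
    have := h i; rewrite /= /D' in_setU1 iJ orbT; case: eqP => [ii0|_]; last by apply.
    by move: iJ; rewrite /= ii0 (negPf i0J).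
  move=> ->; congr (_ * _); rewrite E_indep //.
  apply: eq_bigr => i iJ; rewrite /D'; case: eqP => // ii0.
  by rewrite ii0 (negPf i0J) in iJ.
- move=> k; rewrite m1E -ge0_fin_numE // setTI.
  exact: Pfin.
Qed.

Variables (V : lmodType R) (N : V -> R) (lam : R).
Hypotheses (N_ge0 : (forall x, 0 <= N x)%R)
  (NZ : (forall a x, N (a *: x) = `|a| * N x)%R) (lam0 : (0 <= lam)%R)
  (ND : (forall x y, N (x + y) <= N x + N y)%R).
Variables (sigma : R) (a : I -> V).
Hypotheses (sigma0 : (0 < sigma)%R) (E_law : forall i B, measurable B ->
  distribution P (E i) B = normal_prob 0 sigma B).

Lemma measurable_loglip_sum d' (T' : measurableType d') (K : finType)
    (Z : K -> T' -> R) (F : V -> R) (b : K -> V) x : loglip N lam F ->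
  (forall k, measurable_fun setT (Z k)) ->
  measurable_fun setT (fun w => F (x + \sum_k Z k w *: b k))%R.
Proof.
move=> hF mZ; pose L := (lam * \sum_k N (b k))%R.
pose g w := ln (F (x + \sum_k Z k w *: b k))%R.
rewrite (_ : (fun w => _) = expR \o g); last first.
  by apply/funext => w /=; rewrite lnK // posrE (loglip_gt0 _ hF).
apply: measurableT_comp => //.
apply: (@measurable_of_lipschitz _ _ _ K Z g L) => // [|w w'].
  by rewrite mulr_ge0 // sumr_ge0.
have F0 := loglip_gt0 _ hF.
rewrite addrC -[X in (_ <= X + _)%R]expRK -lnM ?posrE ?expR_gt0 //.
rewrite ler_ln ?posrE ?mulr_gt0 ?expR_gt0 //.
have -> : (x + \sum_k Z k w *: b k = x + \sum_k Z k w' *: b k +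
    \sum_k (Z k w - Z k w') *: b k)%R.
  rewrite -addrA -big_split /=; congr (_ + _)%R; apply: eq_bigr => k _.
  by rewrite -scalerDl addrCA subrr addr0.
rewrite (le_trans (loglip_le _ _ hF)) // ler_pM2r // ler_expR -mulrA ler_wpM2l //.
have NS : (N (\sum_k (Z k w - Z k w') *: b k) <=
    \sum_k N ((Z k w - Z k w') *: b k))%R.
  elim/big_ind2: _ => [|u v u' v' h h'|//]; first by rewrite -(scale0r 0%R) NZ normr0 mul0r.
  exact: le_trans (ND _ _) (lerD h h').
rewrite (le_trans NS) // mulr_sumr; apply: ler_sum => k _.
rewrite NZ mulrC ler_wpM2r // (bigD1 k) //= lerDl.
by rewrite sumr_ge0.
Qed.

(** Entries are integrated out one by one: the first is independent of the others jointly, and its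
    average replaces F by a smoothing of F, again [loglip]. *)
Lemma expectation_gsmooths (s : seq I) (F : V -> R) x : uniq s -> loglip N lam F ->
  \int[P]_w (F (x + \sum_(i <- s) E i w *: a i)%R)%:E =
  (gsmooths [seq sigma *: a i | i <- s] F x)%:E.
Proof.
elim: s F x => [|i0 s IH] F x /=.
  move=> _ hF; under eq_integral do rewrite big_nil addr0.
  by rewrite integral_cst //= probability_setT mule1.
move=> /andP[i0s us] hF; pose J := [set i in s].
have i0J : i0 \notin J by rewrite inE.
pose gT := g_sigma_algebraType (boxes J).
have mid : measurable_fun setT (id : T -> gT).
  by move=> _ C mC; rewrite setTI; exact: measurable_sigma_boxes mC.
pose W : {mfun T >-> gT} := HB.pack (id : T -> gT)
  (isMeasurableFun.Build _ _ _ _ (id : T -> gT) mid).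
pose f (z : R * gT) := (F (x + \sum_(i <- s) E i z.2 *: a i + z.1 *: a i0)%R)%:E.
have mf : measurable_fun setT f.
  apply/measurable_EFinP.
  (* [None] indexes the entry being integrated out, [Some] the remaining ones. *)
  pose Z (k : option 'I_(size s)) (z : R * gT) : R :=
    if k is Some k then E (tnth (in_tuple s) k) z.2 else z.1.
  pose b k := if k is Some k then a (tnth (in_tuple s) k) else a i0.
  rewrite (_ : (fun z : R * gT => _) = fun z => F (x + \sum_k Z k z *: b k)%R).
    apply: measurable_loglip_sum => // -[k|]; last exact: measurable_fst.
    apply: (@measurableT_comp _ _ _ _ _ _ (E (tnth (in_tuple s) k) : gT -> R)).
      by apply: sigma_boxes_coord; rewrite inE mem_tnth.
    exact: measurable_snd.
  apply/funext => z; rewrite -addrA; congr (F (_ + _)%R).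
  rewrite [RHS](bigD1 None) //= addrC; congr (_ + _)%R.
  rewrite big_tnth; apply/esym.
  rewrite (reindex_omap Some id) /=; last by case.
  by apply: eq_bigl => k; rewrite eqxx.
have f0 z : 0 <= f z by rewrite lee_fin ltW // (loglip_gt0 _ hF).
transitivity (\int[P]_w f (E i0 w, W w)).
  apply: eq_integral => w _; rewrite /f /= big_cons.
  by rewrite (addrC (E i0 w *: a i0)) addrA.
rewrite (ge0_integral_indep (Y := E i0) (W := W)) //; last first.
  by move=> A B mA mB; exact: (indep_sigma_boxes i0J mA mB).
rewrite -IH //; last exact: loglip_gsmooth.
apply: eq_integral => w _; rewrite /f /=.
set z := (x + _)%R.
have cF : continuous (fun y : R => F (z + y *: a i0)%R) by exact: (@continuous_loglip_line _ _ _ _ NZ F z (a i0) hF).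
have F0 (y : R) : (0 <= F (z + y *: a i0))%R by rewrite ltW // (loglip_gt0 _ hF).
rewrite (integral_law (E_law i0) cF F0) -(integral_normal_affine 0 sigma0 cF F0).
rewrite gaussE_EFin; last exact: (integrable_loglip_line NZ).
by apply: eq_integral => t _; rewrite addr0 scalerA mulrC.
Qed.

End Independence.

(** * Smoothing of functions dominated by exponentials of squares, and of exponential shifts *)

Section SquareExpBound.
Variables (R : realType) (V : lmodType R) (N : V -> R) (lam : R).
Hypotheses (N_ge0 : forall x, 0 <= N x)
  (NZ : forall a x, N (a *: x) = `|a| * N x) (lam0 : 0 <= lam).

Lemma integrable_normal_exp_sqr (c : R) : c < 2^-1 ->
  (normal_prob (0 : R) 1).-integrable setT (EFin \o (fun s : R => expR (c * s ^+ 2))).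
Proof.
move=> c2; apply/integrableP; split.
  by apply/measurable_EFinP; apply: measurableT_comp => //; apply: measurable_funM.
under eq_integral => s _ do rewrite /= ger0_norm ?expR_ge0 //.
by rewrite normal_mgf_sqr // ltry.
Qed.

(** One coordinate is integrated at a time, each contributing its factor (1 - 2c)^(-1/2); K absorbs
    the coordinates that are held fixed. *)
Lemma gsmooths_exp_sqr_le (I : eqType) (l : seq I) (b : I -> V) (c : I -> R)
    (K : R) (F : V -> R) x : uniq l -> loglip N lam F -> (forall i, i \in l -> c i < 2^-1) ->
  (forall s : I -> R, F (x + \sum_(i <- l) s i *: b i) <=
     K * \prod_(i <- l) expR (c i * s i ^+ 2)) ->
  gsmooths [seq b i | i <- l] F x <= K * \prod_(i <- l) (Num.sqrt (1 - 2 * c i))^-1.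
Proof.
elim: l F K => [|i l IH] F K /=.
  by move=> _ _ _ /(_ (fun=> 0)); rewrite !big_nil addr0 mulr1.
move=> /andP[il ul] hF hc hs.
have ci : c i < 2^-1 by rewrite hc // mem_head.
rewrite big_cons mulrA; apply: IH => // [|j jl|s].
- exact: loglip_gsmooth.
- by rewrite hc // in_cons jl orbT.
pose C := K * \prod_(j <- l) expR (c j * s j ^+ 2).
rewrite -mulrA (mulrC _^-1) mulrA -/C.
have -> : C * (Num.sqrt (1 - 2 * c i))^-1 = gaussE (fun t => C * expR (c i * t ^+ 2)).
  rewrite gaussEZ; last exact: integrable_normal_exp_sqr.
  by rewrite /gaussE /Rintegral normal_mgf_sqr.
apply: gaussE_le => [||t].
- exact: (integrable_loglip_line NZ).
- by apply: integrable_normalZ; exact: integrable_normal_exp_sqr.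
have := hs (fun j => if j == i then t else s j).
have sE j : j \in l -> (if j == i then t else s j) = s j.
  by case: eqP => // -> jl; rewrite jl in il.
rewrite !big_cons eqxx.
under eq_big_seq => j jl do rewrite sE //.
under [X in _ <= _ * (_ * X)]eq_big_seq => j jl do rewrite sE //.
rewrite (addrC (t *: b i)) addrA (mulrC (expR _)) mulrA; exact.
Qed.

Lemma gsmooth_exp_shift (a : V) (F : V -> R) x : loglip N lam F ->
  (forall s y, F (y + s *: a) = expR (lam * s) * F y) ->
  gsmooth a F x = expR (lam ^+ 2 / 2) * F x.
Proof.
move=> hF h; rewrite /gsmooth.
rewrite (_ : (fun s => _) = (fun s => F x * expR (lam * s))); last first.
  by apply/funext => s; rewrite h mulrC.
rewrite gaussEZ ?gaussE_exp 1?mulrC //; exact: integrable_normal_exp.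
Qed.

Lemma gsmooths_scale (l : seq V) (C : R) (F : V -> R) x : loglip N lam F -> 0 < C ->
  gsmooths l (fun y => C * F y) x = C * gsmooths l F x.
Proof.
move=> hF C0; elim: l F hF => [//|a l IH] F hF /=.
rewrite -IH; last exact: loglip_gsmooth.
by congr (gsmooths l _ x); apply/funext => y; exact: (gsmoothZ NZ).
Qed.

End SquareExpBound.

(** * Gordon's inequality and the tail bound *)

Section Gordon.
Variables (R : realType).

Lemma ip_outer_outer m n (u w : 'cV[R]_m) (v x : 'cV[R]_n) :
  ip (u *m v^T) (w *m x^T) = ip u w * ip v x.
Proof.
rewrite ip_outer -mulmxA [v^T *m x]mx11_scalar mul_mx_scalar ipZr mulrC (ipC w).
by congr (_ * _); rewrite /ip trace_mx11.
Qed.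

Lemma ip_cV n (u v : 'cV[R]_n) : ip u v = \sum_i u i 0 * v i 0.
Proof. by rewrite ipE; apply: eq_bigr => i _; rewrite big_ord1. Qed.

Lemma ip_le1 n (u v : 'cV[R]_n) : ip u u = 1 -> ip v v = 1 -> ip u v <= 1.
Proof.
have h (w : 'cV[R]_n) : ip w w = 1 -> frobenius_norm w <= 1.
  by move=> w1; rewrite frobenius_norm_le // expr1n w1.
move=> /h hu /h hv; rewrite (le_trans (cauchy_schwarz_ip _ _)) //.
by rewrite -[leRHS]mulr1 ler_pM ?frobenius_norm_ge0.
Qed.

(** With r = sqrt q the base is sqrt (1 + l/r), and 1 + l/r <= e^(l/r). The case q = 0 is apart, as
    r is then not invertible. *)
Lemma inv_sqrt_expX_le (q : nat) (l : R) : 0 < l ->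
  (Num.sqrt (1 - 2 * (l / (2 * (Num.sqrt q%:R + l)))))^-1 ^+ q <=
  expR (l * Num.sqrt q%:R / 2).
Proof.
move=> l0; case: q => [|q]; first by rewrite expr0 sqrtr0 mulr0 mul0r expR0.
set r := Num.sqrt q.+1%:R; have r0 : 0 < r by rewrite sqrtr_gt0 ltr0n.
have rl : 0 < r + l by exact: addr_gt0.
have -> : l * r / 2 = l / r / 2 * q.+1%:R.
  have -> : q.+1%:R = r ^+ 2 :> R by rewrite sqr_sqrtr ?ler0n.
  by field; rewrite gt_eqF.
rewrite expRM_natr lerXn2r ?nnegrE ?invr_ge0 ?sqrtr_ge0 ?expR_ge0 //.
have -> : 1 - 2 * (l / (2 * (r + l))) = (1 + l / r)^-1.
  by field; rewrite !gt_eqF //= addrC.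
rewrite -[leLHS]mulr1 mulrC ler_pdivrMr ?sqrtr_gt0 ?invr_gt0 ?addr_gt0 ?divr_gt0 //.
rewrite mulrC -ler_pdivrMr ?expR_gt0 // div1r -expRN -mulNr.
rewrite -[leLHS]ger0_norm ?expR_ge0 // -sqrtr_sqr -expRM_natr ler_wsqrtr //.
rewrite divfK // expRN lef_pV2 ?posrE ?expR_gt0 ?addr_gt0 ?divr_gt0 //.
exact: expR_ge1Dx.
Qed.

Variables (k : nat) (p beta : R).
Hypotheses (p0 : 0 < p) (p1 : p <= 1) (beta0 : 0 < beta).
Let lam := p * beta.
Let lam0 : 0 < lam. Proof. exact: mulr_gt0. Qed.

Lemma softmax_ge (x : 'rV[R]_k.+1) i : expR (lam * x 0 i) <= softmax p beta x.
Proof.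
rewrite /softmax ler_expR /lam -mulrA ler_pM2l //.
rewrite -[leLHS]expRK ler_ln ?posrE ?expR_gt0 ?expsum_gt0 //.
rewrite /expsum (bigD1 i) //= lerDl; apply: sumr_ge0 => j _; exact: expR_ge0.
Qed.

Lemma softmax_le (x : 'rV[R]_k.+1) t : (forall i, x 0 i <= t) ->
  softmax p beta x <= expR (p * ln k.+1%:R) * expR (lam * t).
Proof.
move=> xt; rewrite -expRD ler_expR /lam -mulrA -mulrDr ler_pM2l //.
rewrite -[beta * t]expRK -lnM ?posrE ?expR_gt0 // ?ltr0n //.
rewrite ler_ln ?posrE ?expsum_gt0 ?mulr_gt0 ?expR_gt0 ?ltr0n //.
rewrite mulr_natl -[X in _ *+ X]card_ord -sumr_const; apply: ler_sum => i _.
by rewrite ler_expR ler_pM2l.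
Qed.

Lemma softmax_shift (x : 'rV[R]_k.+1) s :
  softmax p beta (x + s *: const_mx 1) = expR (lam * s) * softmax p beta x.
Proof.
rewrite /softmax -expRD; congr expR.
have -> : expsum beta (x + s *: const_mx 1) = expR (beta * s) * expsum beta x.
  rewrite /expsum mulr_sumr; apply: eq_bigr => i _.
  by rewrite -expRD !mxE mulr1 mulrDr addrC.
by rewrite lnM ?posrE ?expR_gt0 ?expsum_gt0 // expRK mulrDr mulrA.
Qed.

Variables (m n q : nat) (u : 'I_k.+1 -> 'cV[R]_m) (a : 'I_k.+1 -> 'cV[R]_q)
  (v : 'I_k.+1 -> 'cV[R]_n).
Hypotheses (ua : forall i j, ip (u i) (u j) = ip (a i) (a j))
  (a1 : forall i, ip (a i) (a i) = 1) (v1 : forall i, ip (v i) (v i) = 1).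

(** Entry z of G contributes g_z times this vector to the process <u_i, G v_i>; [sum_dir] does the
    same for <g, a_i> + <h, v_i>. The u_i enter only through their inner products, which lets
    vectors a_i of a smaller space take their place. *)
Definition outer_dir (z : 'I_m * 'I_n) : 'rV[R]_k.+1 :=
  \row_i (u i *m (v i)^T) z.1 z.2.

Definition sum_dir (z : 'I_q + 'I_n) : 'rV[R]_k.+1 :=
  \row_i match z with inl r => a i r 0 | inr s => v i s 0 end.

Lemma covar_outer_dir i j :
  covar [seq outer_dir z | z <- enum {: 'I_m * 'I_n}] i j =
  ip (a i) (a j) * ip (v i) (v j).
Proof.
rewrite /covar big_map big_enum /= -ua -ip_outer_outer ipE pair_bigA /=.
by apply: eq_bigr => z _; rewrite !mxE.
Qed.

Lemma covar_sum_dir i j :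
  covar [seq sum_dir z | z <- enum {: 'I_q + 'I_n}] i j =
  ip (a i) (a j) + ip (v i) (v j).
Proof.
rewrite /covar big_map big_enum /= big_sumType /= !ip_cV.
by congr (_ + _); apply: eq_bigr => z _; rewrite !mxE.
Qed.

(* |g| <= (|g|^2 / al + al) / 2 reduces the Laplace transform of |g| to that of
   |g|^2, which is explicit. *)
Lemma softmax_sum_dir_le (s : 'I_q + 'I_n -> R) (al be : R) : 0 < al -> 0 < be ->
  softmax p beta (0 + \sum_(z <- enum {: 'I_q + 'I_n}) s z *: sum_dir z) <=
  expR (p * ln k.+1%:R) * expR (lam * (al + be) / 2) *
  \prod_(z <- enum {: 'I_q + 'I_n})
     expR (match z with inl _ => lam / (2 * al) | inr _ => lam / (2 * be) end * s z ^+ 2).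
Proof.
move=> al0 be0; pose g := \col_r s (inl r); pose h := \col_r s (inr r).
have one l (w : 'cV[R]_l) (x : 'cV[R]_l) (c : R) : 0 < c -> ip w w = 1 ->
    ip x w <= (ip x x / c + c) / 2.
  move=> c0 w1; have := ip_ge0 (x - c *: w); rewrite ip_subZ_sqr w1 mulr1 => h0.
  rewrite -(@ler_pM2r _ (c * 2)) ?mulr_gt0 //.
  have -> : (ip x x / c + c) / 2 * (c * 2) = ip x x + c ^+ 2.
    by field; rewrite gt_eqF.
  by move: (ip x x) (ip x w) (c ^+ 2) h0 => y z t; lra.
have hmax i : (0 + \sum_(z <- enum {: 'I_q + 'I_n}) s z *: sum_dir z) 0 i <=
    (ip g g / al + al) / 2 + (ip h h / be + be) / 2.
  rewrite add0r summxE big_enum /= big_sumType /= lerD //.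
    rewrite (le_trans _ (one _ (a i) g al al0 (a1 i))) // le_eqVlt; apply/orP; left.
    by rewrite ip_cV; apply/eqP/eq_bigr => r _; rewrite !mxE.
  rewrite (le_trans _ (one _ (v i) h be be0 (v1 i))) // le_eqVlt; apply/orP; left.
  by rewrite ip_cV; apply/eqP/eq_bigr => r _; rewrite !mxE.
rewrite (le_trans (softmax_le hmax)) // -mulrA ler_pM2l ?expR_gt0 //.
rewrite big_enum /= -expR_sum -expRD ler_expR big_sumType /= -!mulr_sumr.
have -> : \sum_i s (inl i) ^+ 2 = ip g g.
  by rewrite ip_cV; apply: eq_bigr => r _; rewrite !mxE.
have -> : \sum_i s (inr i) ^+ 2 = ip h h.
  by rewrite ip_cV; apply: eq_bigr => r _; rewrite !mxE.
rewrite le_eqVlt; apply/orP; left; apply/eqP; field.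
by rewrite !gt_eqF.
Qed.

(* Shifting all coordinates of the bilinear process by one more standard normal
   variable makes the variances equal to those of <g, a> + <h, v>; the difference
   of the covariances is then (1 - <a_i, a_j>)(1 - <v_i, v_j>) >= 0. *)
Lemma gordon_comparison :
  gsmooths [seq outer_dir z | z <- enum {: 'I_m * 'I_n}] (softmax p beta) 0 <=
  expR (p * ln k.+1%:R) *
  expR (lam * (Num.sqrt n%:R + Num.sqrt q%:R) + lam ^+ 2 / 2).
Proof.
set lX := [seq _ | _ <- _]; pose lY := [seq sum_dir z | z <- enum {: 'I_q + 'I_n}].
have N0 := norm1_ge0 (R := R) (k := k); have NZ := @norm1Z R k.
have hF := loglip_softmax (k := k) (ltW p0) (ltW beta0).
pose rq := Num.sqrt (q%:R : R); pose rn := Num.sqrt (n%:R : R).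
have rq0 : 0 <= rq by exact: sqrtr_ge0.
have rn0 : 0 <= rn by exact: sqrtr_ge0.
have step1 : expR (lam ^+ 2 / 2) * gsmooths lX (softmax p beta) 0 <=
    gsmooths lY (softmax p beta) 0.
  have -> : expR (lam ^+ 2 / 2) * gsmooths lX (softmax p beta) 0 =
      gsmooths (const_mx 1 :: lX) (softmax p beta) 0.
    rewrite /= -(gsmooths_scale N0 NZ (ltW lam0) _ _ hF) ?expR_gt0 //.
    congr (gsmooths lX _ 0); apply/funext => y; apply/esym.
    by apply: (gsmooth_exp_shift _ hF) => // s z; exact: softmax_shift.
  apply: softmax_slepian => [|||i|i j]; rewrite ?(ltW p0) ?(ltW beta0) //.
    by rewrite /covar big_cons -!/(covar _ _ _) covar_outer_dir covar_sum_dir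
      !mxE a1 v1 !mulr1.
  rewrite {2}/covar big_cons -!/(covar _ _ _) covar_outer_dir covar_sum_dir !mxE mulr1.
  have := mulr_ge0 (_ : 0 <= 1 - ip (a i) (a j)) (_ : 0 <= 1 - ip (v i) (v j)).
  rewrite !subr_ge0 => /(_ (ip_le1 (a1 i) (a1 j)) (ip_le1 (v1 i) (v1 j))).
  by move: (ip (a i) (a j)) (ip (v i) (v j)) => y z; lra.
have rl c : 0 <= c -> 0 < c + lam by move=> c0; exact: ltr_wpDl.
(* The parameters [rq + lam] and [rn + lam] exceed lam, which keeps the exponents c below 1/2. The
   total exponent is lam (rn + rq) + lam^2, and [step1] gives back half of lam^2. *)
have step2 : gsmooths lY (softmax p beta) 0 <= expR (p * ln k.+1%:R) *
    expR (lam * (rq + lam + (rn + lam)) / 2) * (expR (lam * rq / 2) * expR (lam * rn / 2)).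
  pose c (z : 'I_q + 'I_n) := match z with
    inl _ => lam / (2 * (rq + lam)) | inr _ => lam / (2 * (rn + lam)) end.
  have hc z : c z < 2^-1.
    have half (l : nat) (i : 'I_l) (r := Num.sqrt (l%:R : R)) : lam / (2 * (r + lam)) < 2^-1.
      have r0 : 0 < r by rewrite sqrtr_gt0 ltr0n (leq_ltn_trans (leq0n i)) ?ltn_ord.
      rewrite ltr_pdivrMr ?mulr_gt0 ?addr_gt0 // mulKf ?gt_eqF //.
      by rewrite ltrDr.
    by case: z => i /=; exact: half.
  have := gsmooths_exp_sqr_le N0 NZ (ltW lam0) (enum_uniq _) hF (fun z _ => hc z)
    (fun s => softmax_sum_dir_le s (rl _ rq0) (rl _ rn0)).
  move=> /le_trans; apply; rewrite ler_pM2l ?mulr_gt0 ?expR_gt0 //.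
  rewrite big_enum /= big_sumType /= !prodr_const !card_ord.
  by apply: ler_pM; rewrite ?exprn_ge0 ?invr_ge0 ?sqrtr_ge0 // inv_sqrt_expX_le.
rewrite -(ler_pM2l (expR_gt0 (lam ^+ 2 / 2))) (le_trans step1) // (le_trans step2) //.
rewrite -!expRD ler_expR -/rq -/rn le_eqVlt; apply/orP; left; apply/eqP.
by field.
Qed.

End Gordon.

(** * A countable family of unit pairs that controls a bilinear form *)

Section DenseUnitPairs.
Variable R : realType.

Lemma exists_unit_vector q : (0 < q)%N -> exists x : 'cV[R]_q, ip x x = 1.
Proof.
move=> q0; exists (delta_mx (Ordinal q0) 0); rewrite ip_cV (bigD1 (Ordinal q0)) //=.
rewrite big1 ?addr0 => [|j jq]; first by rewrite mxE !eqxx mulr1.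
by rewrite mxE (negPf jq) mul0r.
Qed.

Lemma rat_vector_approximation q (x : 'cV[R]_q) (e : R) : 0 < e ->
  exists y : 'cV[rat]_q, frobenius_norm (x - map_mx ratr y) <= e.
Proof.
move=> e0; have d0 : 0 < e / q.+1%:R by rewrite divr_gt0.
pose y i := sval (cid (rat_approximation (x i 0) d0)).
exists (\col_i y i); rewrite (le_trans (frobenius_norm_le_sum _)) //.
have -> : e = (e / q.+1%:R) *+ q.+1 by rewrite -mulr_natr divfK.
apply: (@le_trans _ _ ((e / q.+1%:R) *+ q)); last by rewrite [leRHS]mulrSr lerDl ltW.
have -> : (e / q.+1%:R) *+ q = \sum_(z : 'I_q * 'I_1) (e / q.+1%:R).
  by rewrite sumr_const card_prod !card_ord muln1.
apply: ler_sum => -[i j] _ /=; rewrite !mxE ord1; apply: ltW.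
by rewrite /y; case: (cid _).
Qed.

(** The pairs are the normalized rational vectors, with a fixed unit vector in place of 0.
    Homogeneity extends the bound to rational vectors, and approximation to real ones. *)
Lemma dense_unit_pairs q n : (0 < q)%N -> (0 < n)%N ->
  exists (a : nat -> 'cV[R]_q) (b : nat -> 'cV[R]_n),
  [/\ forall i, ip (a i) (a i) = 1, forall i, ip (b i) (b i) = 1 &
    forall (M : 'M[R]_(q, n)) s, 0 <= s -> (forall i, ip (a i) (M *m b i) <= s) ->
    forall (x : 'cV[R]_q) (y : 'cV[R]_n), ip x (M *m y) <= s * (frobenius_norm x * frobenius_norm y)].
Proof.
move=> /exists_unit_vector[a0 a01] /exists_unit_vector[b0 b01].
pose unit l (x0 x : 'cV[R]_l) := if x == 0 then x0 else (frobenius_norm x)^-1 *: x.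
have unit1 l (x0 x : 'cV[R]_l) : ip x0 x0 = 1 -> ip (unit l x0 x) (unit l x0 x) = 1.
  rewrite /unit; case: eqVneq => // x_neq0 _.
  rewrite ipZl ipZr -sqr_frobenius_norm mulrA -expr2 -exprMn mulVf ?expr1n //.
  by rewrite gt_eqF ?frobenius_norm_gt0.
pose pr i := odflt (0, 0) (unpickle i : option ('cV[rat]_q * 'cV[rat]_n)).
exists (fun i => unit q a0 (map_mx ratr (pr i).1)).
exists (fun i => unit n b0 (map_mx ratr (pr i).2)).
split=> [i|i|M s s0 h x y]; [exact: unit1|exact: unit1|].
have hr (z : 'cV[rat]_q) (t : 'cV[rat]_n) : ip (map_mx ratr z) (M *m map_mx ratr t) <=
    s * (frobenius_norm (map_mx ratr z : 'cV[R]_q) * frobenius_norm (map_mx ratr t : 'cV[R]_n)).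
  have := h (pickle (z, t)); rewrite /pr pickleK /= /unit.
  set z' := map_mx _ z; set t' := map_mx _ t.
  have [->|z0] := eqVneq z' 0.
    by rewrite (ipC 0) ip0r !mulr_ge0 ?frobenius_norm_ge0.
  have [->|t0] := eqVneq t' 0.
    by rewrite mulmx0 ip0r !mulr_ge0 ?frobenius_norm_ge0.
  rewrite -scalemxAr ipZl ipZr mulrA -invfM mulrC ler_pdivrMr //.
  by rewrite mulr_gt0 ?frobenius_norm_gt0.
pose c := s * (frobenius_norm x + frobenius_norm y + 1) +
  (frobenius_norm M * frobenius_norm y + (frobenius_norm x + 1) * frobenius_norm M).
apply: (@le_of_le_eps _ _ _ c) => [|e e0 e1].
  by rewrite /c !(addr_ge0, mulr_ge0) ?frobenius_norm_ge0.
have [z hz] := rat_vector_approximation x e0; have [t ht] := rat_vector_approximation y e0.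
move: (hr z t) hz ht; set z' := map_mx _ z; set t' := map_mx _ t => hzt hz ht.
have -> : ip x (M *m y) = ip z' (M *m t') + (ip (x - z') (M *m y) + ip z' (M *m (y - t'))).
  by rewrite mulmxBr !(ipDl, ipDr, ipNl, ipNr); ring.
have nz : frobenius_norm z' <= frobenius_norm x + e.
  rewrite -[z'](subrK x) (le_trans (frobenius_normD _ _)) // addrC lerD2l.
  by rewrite -opprB frobenius_normN.
have nt : frobenius_norm t' <= frobenius_norm y + e.
  rewrite -[t'](subrK y) (le_trans (frobenius_normD _ _)) // addrC lerD2l.
  by rewrite -opprB frobenius_normN.
have h1 : ip (x - z') (M *m y) <= e * (frobenius_norm M * frobenius_norm y).
  rewrite (le_trans (cauchy_schwarz_ip _ _)) //.
  by rewrite ler_pM ?frobenius_norm_ge0 // frobenius_norm_mulmx.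
have h2 : ip z' (M *m (y - t')) <= (frobenius_norm x + 1) * (frobenius_norm M * e).
  rewrite (le_trans (cauchy_schwarz_ip _ _)) // ler_pM ?frobenius_norm_ge0 //.
    by rewrite (le_trans nz) // lerD2l.
  rewrite (le_trans (frobenius_norm_mulmx _ _)) //.
  by rewrite ler_wpM2l ?frobenius_norm_ge0.
have h3 : ip z' (M *m t') <= s * ((frobenius_norm x + e) * (frobenius_norm y + e)).
  by rewrite (le_trans hzt) // ler_wpM2l // ler_pM ?frobenius_norm_ge0.
rewrite (le_trans (lerD h3 (lerD h1 h2))) // /c.
have := frobenius_norm_ge0 x; have := frobenius_norm_ge0 y.
move: (frobenius_norm x) (frobenius_norm y) (frobenius_norm M) => X Y m Y0 X0.
have : s * (e * e) <= s * e by rewrite ler_wpM2l // ler_piMl // ltW.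
lra.
Qed.

End DenseUnitPairs.

(** * Chernoff's bound for finitely many pairs and passage to countably many *)

Section GaussianMax.
Variables (R : realType) (d : measure_display) (T : measurableType d).
Variables (P : probability T R) (m n q : nat) (E : 'I_m * 'I_n -> {RV P >-> R}).
Variables (sigma theta : R).
Hypotheses (E_indep : mutually_independent E) (sigma0 : 0 < sigma) (theta0 : 0 < theta).
Hypothesis E_law : forall i B, measurable B ->
  distribution P (E i) B = normal_prob 0 sigma B.
Let s0 := Num.sqrt (n%:R : R) + Num.sqrt (q%:R : R).
Hypothesis s0_gt0 : 0 < s0.
Let t0 := sigma * (1 + theta) * s0.

Lemma random_mx_ipE (u : 'cV[R]_m) (v : 'cV[R]_n) w :
  ip u (random_mx E w *m v) = \sum_z E z w * (u *m v^T) z.1 z.2.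
Proof.
by rewrite -ip_outer ipE pair_bigA /=; apply: eq_bigr => -[i j] _; rewrite !mxE.
Qed.

Lemma measurable_random_mx_ip (u : 'cV[R]_m) (v : 'cV[R]_n) :
  measurable_fun setT (fun w => ip u (random_mx E w *m v)).
Proof.
under eq_fun do rewrite random_mx_ipE.
by apply: measurable_sum => z; apply: measurable_funM.
Qed.

Variables (u : nat -> 'cV[R]_m) (a : nat -> 'cV[R]_q) (v : nat -> 'cV[R]_n).
Hypotheses (ua : forall i j, ip (u i) (u j) = ip (a i) (a j))
  (a1 : forall i, ip (a i) (a i) = 1) (v1 : forall i, ip (v i) (v i) = 1).

Definition exceed k := \bigcup_(i in `I_k.+1) [set w | t0 < ip (u i) (random_mx E w *m v i)].

Lemma measurable_exceed k : measurable (exceed k).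
Proof.
apply: bigcup_measurable => i _; apply: measurable_gtr_set.
exact: measurable_random_mx_ip.
Qed.

(** With lam = theta s0 the exponent is lam s0 + lam^2/2 - lam (1 + theta) s0 = - theta^2 s0^2 / 2.
    Taking beta = lam/p leaves p free. *)
Lemma chernoff_exceed k (p : R) : 0 < p -> p <= 1 ->
  fine (P (exceed k)) <= expR (p * ln k.+1%:R) * expR (- (theta ^+ 2 * s0 ^+ 2 / 2)).
Proof.
move=> p0 p1; pose lam := theta * s0; have lam0 : 0 < lam by exact: mulr_gt0.
pose beta := lam / p; have beta0 : 0 < beta by exact: divr_gt0.
have pb : p * beta = lam by rewrite mulrC divfK ?gt_eqF.
pose u' (i : 'I_k.+1) := u i; pose a' (i : 'I_k.+1) := a i; pose v' (i : 'I_k.+1) := v i.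
have := gordon_comparison p0 p1 beta0 (u := u') (a := a') (v := v')
  (fun i j => ua i j) (fun i => a1 i) (fun i => v1 i).
rewrite pb -/s0; pose F : 'rV[R]_k.+1 -> R := softmax p beta.
have hF : loglip (@norm1 R k) lam F.
  by rewrite -pb; exact: loglip_softmax (ltW p0) (ltW beta0).
(* The factor [sigma^-1] in the directions standardizes the entries. *)
have := expectation_gsmooths E_indep (norm1_ge0 (R := R) (k := k)) (@norm1Z R k)
  (ltW lam0) (@norm1D R k) (fun z => sigma^-1 *: outer_dir u' v' z) sigma0 E_law
  0 (enum_uniq {: 'I_m * 'I_n}) hF.
rewrite [X in gsmooths X](_ : _ = [seq outer_dir u' v' z | z <- enum {: 'I_m * 'I_n}]);
  last by apply: eq_map => z; rewrite scalerA mulfV ?gt_eqF // scale1r.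
move=> hE hG.
pose x w := 0 + \sum_(z <- enum {: 'I_m * 'I_n}) E z w *: (sigma^-1 *: outer_dir u' v' z).
have xE w (i : 'I_k.+1) : x w 0 i = sigma^-1 * ip (u i) (random_mx E w *m v i).
  rewrite random_mx_ipE /x add0r summxE big_enum /= mulr_sumr.
  by apply: eq_bigr => z _; rewrite !mxE mulrCA.
have mF : measurable_fun setT (fun w => F (x w)).
  rewrite (_ : (fun w => _) = (fun w => F (0 + \sum_z E z w *: (sigma^-1 *: outer_dir u' v' z)))).
    apply: (measurable_loglip_sum (norm1_ge0 (R := R) (k := k)) (@norm1Z R k) (ltW lam0) (@norm1D R k) _ _ hF).
    by move=> z; exact: measurable_funPT.
  by apply/funext => w; rewrite /x big_enum.
pose c := expR (lam * ((1 + theta) * s0)).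
have markov : (c%:E * P (exceed k) <= \int[P]_w (F (x w))%:E)%E.
  rewrite -integral_cst; last exact: measurable_exceed.
  apply: (@le_trans _ _ (\int[P]_(w in exceed k) (F (x w))%:E)%E).
    apply: ge0_le_integral => //.
    - exact: measurable_exceed.
    - by move=> w _; rewrite lee_fin expR_ge0.
    - by apply/measurable_EFinP; exact: measurable_funTS.
    move=> w [i ik hi]; rewrite lee_fin.
    rewrite (le_trans _ (softmax_ge beta p0 (x w) (Ordinal ik))) //.
    rewrite pb ler_expR ler_pM2l // xE /= -ler_pdivrMl ?invr_gt0 // invrK mulrA.
    exact: ltW.
  apply: ge0_subset_integral => //.
  - exact: measurable_exceed.
  - exact/measurable_EFinP.
  - by move=> w _; rewrite lee_fin expR_ge0.
have := markov; rewrite hE -[P _]fineK ?fin_num_measure //; last exact: measurable_exceed.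
rewrite -EFinM lee_fin => /le_trans /(_ hG).
rewrite mulrC -ler_pdivlMr ?expR_gt0 // => /le_trans; apply.
rewrite -expRN -!expRD ler_expR le_eqVlt; apply/orP; left; apply/eqP.
by rewrite /lam; field.
Qed.

(** The factor (k+1)^p is removed as p tends to 0: e^(-pL) >= 1 - pL with L = ln (k+1) gives Q <= B
    + p L Q. *)
Lemma prob_exceed_le k :
  (P (exceed k) <= (expR (- (theta ^+ 2 * s0 ^+ 2 / 2)))%:E)%E.
Proof.
rewrite -[P _]fineK ?fin_num_measure //; last exact: measurable_exceed.
rewrite lee_fin; set Q := fine _; set B := expR _.
have Q0 : 0 <= Q by rewrite fine_ge0.
have L0 : 0 <= ln k.+1%:R :> R by rewrite ln_ge0 // ler1n.
apply: (@le_of_le_eps _ _ _ (ln k.+1%:R * Q)) => [|p p0 p1]; first exact: mulr_ge0.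
have := chernoff_exceed k p0 p1; rewrite -/Q -/B mulrC -ler_pdivrMr ?expR_gt0 //.
rewrite -expRN => h; have := expR_ge1Dx (- (p * ln k.+1%:R)) => h2.
have := ler_wpM2l Q0 h2; move=> /le_trans /(_ h); rewrite mulrA.
by move: (p * _) => L; lra.
Qed.

Lemma prob_exceed_bigcup_le :
  (P (\bigcup_k exceed k) <= (expR (- (theta ^+ 2 * s0 ^+ 2 / 2)))%:E)%E.
Proof.
have ndA : nondecreasing_seq exceed.
  move=> k l kl; apply/subsetPset => w [i ik hi]; exists i => //=.
  exact: leq_trans kl.
have cv := nondecreasing_cvg_mu (mu := P) measurable_exceed
  (bigcup_measurable (fun k _ => measurable_exceed k)) ndA.
rewrite -(cvg_lim _ cv) //; apply: lime_le; first by apply/cvg_ex; eexists; exact: cv.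
by apply: nearW => k; exact: prob_exceed_le.
Qed.

End GaussianMax.

Lemma prob_sv_trmul_le (R : realType) (d : measure_display) (T : measurableType d)
    (P : probability T R) (m n p : nat) (X : 'M[R]_(m, p)) (sigma tau theta : R)
    (E : 'I_m * 'I_n -> {RV P >-> R}) :
  0 <= sigma -> mutually_independent E -> 0 < tau -> 0 < theta ->
  (forall ij B, measurable B ->
    distribution P (E ij) B = normal_prob 0 sigma B) ->
  tau = (1 + theta) * sigma * sv 1 X *
        (Num.sqrt n%:R + Num.sqrt (\rank X)%:R) ->
  (P [set w | (tau < sv 1 (X^T *m random_mx E w))%R] <=
   (expR (- (theta ^+ 2 * (n + \rank X)%:R / 2)))%:E)%E.
Proof.
move=> sigma_ge0 E_indep tau0 theta0 E_law tauE.
pose q := \rank X; pose s0 := Num.sqrt (n%:R : R) + Num.sqrt (q%:R : R).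
have s0_ge0 : 0 <= s0 by rewrite addr_ge0 ?sqrtr_ge0.
(* Positivity of tau excludes the degenerate cases sigma = 0, d_1(X) = 0 and n = q = 0. *)
have : (1 + theta) * sigma * sv 1 X * s0 != 0 by rewrite -tauE gt_eqF.
rewrite !mulf_eq0 !negb_or => /andP[/andP[/andP[_ sg] svX] s0_neq0].
have sigma0 : 0 < sigma by rewrite lt0r sg.
have s0_gt0 : 0 < s0 by rewrite lt0r s0_neq0.
have [n0|n0] := posnP n.
  rewrite (_ : [set w | _] = set0) ?measure0 ?lee_fin ?expR_ge0 //.
  apply/seteqP; split => w //=.
  by rewrite sv_oversize ?n0 // => /(lt_trans tau0); rewrite ltxx.
have q0 : (0 < q)%N.
  rewrite lt0n; apply: contraNneq svX => q0.
  by rewrite sv_rank // -/q q0.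
have [Q QQ [Z XQZ]] := orthonormal_range X.
have [a [b [a1 b1 ab]]] := dense_unit_pairs R q0 n0.
have ua i j : ip (Q *m a i) (Q *m a j) = ip (a i) (a j) by exact: ip_orthogonal.
pose t0 := sigma * (1 + theta) * s0.
have t0_ge0 : 0 <= t0 by rewrite !mulr_ge0 // addr_ge0 // ltW.
pose A := exceed q E sigma theta (fun i => Q *m a i) b.
have mA k : measurable (A k) by exact: measurable_exceed.
apply: (@le_trans _ _ (P (\bigcup_k A k))).
  apply: le_measure; rewrite ?inE.
  - apply: measurable_gtr_set; exact: measurable_sv_random_mx.
  - by apply: bigcup_measurable => k _; exact: mA.
  move=> w /=; apply: contraPP => hA; apply/negP; rewrite -leNgt.
  have -> : tau = sv 1 X * t0 by rewrite tauE /t0 /s0; ring.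
  apply: (sv_trmul_le QQ XQZ t0_ge0) => x y; apply: ab => // i.
  rewrite leNgt; apply/negP => hi; apply: hA; exists i => //; exists i => //=.
  by rewrite ip_mulml mulmxA.
apply: (le_trans (prob_exceed_bigcup_le E_indep sigma0 theta0 E_law s0_gt0 ua a1 b1)).
rewrite lee_fin ler_expR lerN2 ler_pM2r ?invr_gt0 // ler_pM2l ?exprn_gt0 //.
(* The square of sqrt n + sqrt q is at least n + q; dropping the cross term gives the stated
   exponent. *)
rewrite natrD sqrrD !sqr_sqrtr ?ler0n // addrAC lerDl.
by rewrite mulrn_wge0 // mulr_ge0 ?sqrtr_ge0.
Qed.

Theorem theorem13 (R : realType) (d : measure_display) (T : measurableType d)
    (P : probability T R) (m n p : nat)
    (X : 'M[R]_(m, p)) (A : 'M[R]_(p, n)) (sigma tau : R)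
    (E : 'I_m * 'I_n -> {RV P >-> R}) (Atilde : T -> 'M[R]_(p, n))
    (sigma_ge0 : 0 <= sigma)
    (E_indep : mutually_independent E)
    (E_mean : forall ij, ('E_P[E ij] = 0)%E)
    (E_var : forall ij, ('V_P[E ij] = (sigma ^+ 2)%:E)%E)
    (tau_gt0 : 0 < tau)
    (Atilde_min : forall w B,
      penalized_loss tau X (X *m A + random_mx E w) (Atilde w) <=
      penalized_loss tau X (X *m A + random_mx E w) B)
    (A_gap : (0 < \rank A)%N -> 4 * tau < sv (\rank A) (X^T *m X *m A)) :
  (P [set w | nb_sv_above (2 * tau) (X^T *m X *m Atilde w) <> \rank A] <=
   P [set w | (tau < sv 1 (X^T *m random_mx E w))%R])%E
  /\
  (forall theta : R, 0 < theta ->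
    (forall ij B, measurable B ->
      distribution P (E ij) B = normal_prob 0 sigma B) ->
    tau = (1 + theta) * sigma * sv 1 X *
          (Num.sqrt n%:R + Num.sqrt (\rank X)%:R) ->
    (P [set w | (tau < sv 1 (X^T *m random_mx E w))%R] <=
     (expR (- (theta ^+ 2 * (n + \rank X)%:R / 2)))%:E)%E).
Proof.
split; first exact: (prob_rank_error (ltW tau_gt0) Atilde_min A_gap).
move=> theta theta0 E_law tauE.
exact: (prob_sv_trmul_le sigma_ge0 E_indep tau_gt0 theta0 E_law tauE).
Qed.
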